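(* Consider Bayesian binary response regression with random data, with sample size $n$ and dimension $d$, prior $\mathrm{N}_d(0,\alpha^{-1}C)$, posterior $\Pi(\cdot\mid X,Y)$, posterior mode $\beta^*$, and the Metropolis-Hastings independence kernel $P$ with target $\Pi(\cdot\mid X,Y)$ and proposal $\mathrm{N}_d(\beta^*,\alpha^{-1}C)$, as described in the context (in particular $X_i \sim \mathrm{N}_d(0,\sigma^2 n^{-1} I_d)$ and $\operatorname{tr}(C)\to s_0\in(0,+\infty)$ as $d\to+\infty$). Suppose that the following conditions hold. 1. The negative log-likelihood $\ell_n$ is a twice continuously differentiable convex function. 2. There is a universal constant $r_0 \in (0,+\infty)$ such that the largest eigenvalue of the Hessian $H_{\ell_n}$ of the negative log-likelihood satisfies, for every $\beta\in\mathbb{R}^d$, $$\lambda_{\max}\left(H_{\ell_n}(\beta)\right) \le r_0\, \lambda_{\max}\left(X^T X\right).$$ Let $a_0 = r_0 (1+\gamma^{1/2})^2 \sigma^2 s_0/(2\alpha)$. If $d,n\to+\infty$ in such a way that $d/n\to\gamma\in(0,+\infty)$, then, almost surely, for every integer $t\ge1$, $$\limsup_{d/n\to\gamma} \mathcal{W}_\rho\left(P^t(\beta^*,\cdot),\Pi(\cdot\mid X,Y)\right) \le M_0\,(1-\exp(-a_0))^t,$$ where $M_0 = \limsup_{d/n\to\gamma}\int\rho(\beta,\beta^* )\,d\Pi(\beta\mid X,Y)$ (possibly $+\infty$).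
   Context: Model: let $S:\mathbb{R}\to(0,1)$, $\sigma^2,\alpha\in(0,+\infty)$ be fixed. For each sample size $n$ and dimension $d$: $(Y_i,X_i)_{i=1}^n$ are independent, $X_i\sim \mathrm{N}_d(0,\sigma^2 n^{-1}I_d)$ and $Y_i\mid X_i,\beta\sim\mathrm{Bernoulli}(S(\beta^T X_i))$, with $\beta\in\mathbb{R}^d$. Write $Y=(Y_1,\dots,Y_n)^T$ and let $X=(X_1,\dots,X_n)^T$ be the $n\times d$ matrix with rows $X_i^T$. $\ell_n$ is the negative log-likelihood as a function of $\beta$, i.e. $\ell_n(\beta) = -\sum_{i=1}^n\left[Y_i\log S(\beta^T X_i) + (1-Y_i)\log(1-S(\beta^T X_i))\right]$. The prior is $\beta\sim\mathrm{N}_d(0,\alpha^{-1}C)$, where $C=C_d\in\mathbb{R}^{d\times d}$ is a known symmetric positive-definite matrix with $\operatorname{tr}(C)\to s_0\in(0,+\infty)$ as $d\to+\infty$. The posterior $\Pi(\cdot\mid X,Y)$ has density on $\mathbb{R}^d$ proportional to $\exp\left(-\ell_n(\beta)-\frac{\alpha}{2}\beta^T C^{-1}\beta\right)$, and $\beta^*$ is its unique maximizer. The constant $r_0$ does not depend on $d$, $n$, $\beta$ or the data. All data (for the different $n,d$) are defined on a common probability space, and the limit $d/n\to\gamma$ is taken along $n\to\infty$ with $d=d_n\to\infty$ and $d_n/n\to\gamma$; ''almost surely'' refers to the randomness of the data. Metropolis-Hastings independence kernel on $\mathbb{R}^d$ with strictly positive target density $\pi$ and strictly positive proposal density $q$ (proposal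 different from the target): let $a(\theta,\theta') = \min\left\{ \frac{\pi(\theta') q(\theta)}{\pi(\theta) q(\theta')}, 1\right\}$ and $$P(\theta, B) = \int_B a(\theta,\theta') q(\theta')\, d\theta' + \delta_\theta(B)\left(1 - \int a(\theta,\theta') q(\theta')\, d\theta'\right),$$ where $\delta_\theta$ is the Dirac measure at $\theta$; $P^1=P$ and $P^t(\theta,B) = \int P(\theta,d\theta')P^{t-1}(\theta',B)$ for $t\ge 2$. Wasserstein distance: for a lower semicontinuous metric $\rho$ on $\mathbb{R}^d$ (one such metric for each $d$), $\mathcal{W}_\rho(\mu,\nu) = \inf_{\xi\in\mathcal{C}(\mu,\nu)}\int\rho\,d\xi$, where $\mathcal{C}(\mu,\nu)$ is the set of joint probability measures with marginals $\mu$ and $\nu$. *)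

(* Defs.v *)
(* R^d is 'cV[R]_d, equipped with its Borel sigma-algebra. *)
From HB Require Import structures.
From mathcomp Require Import all_boot all_order all_algebra.
From mathcomp Require Import all_classical all_reals all_analysis.

Set Implicit Arguments.
Unset Strict Implicit.
Unset Printing Implicit Defensive.

Import Order.TTheory GRing.Theory Num.Theory.
Import numFieldNormedType.Exports.

Local Open Scope classical_set_scope.
Local Open Scope ring_scope.

Definition borel_mx_display : measure_display.
Proof. exact: default_measure_display. Qed.

Section borel_mx_space.
Variables (R : realType) (m n : nat).

Definition borel_mx : set (set 'M[R]_(m, n)) := <<s open >>.

Let borel_mx0 : borel_mx set0.
Proof. exact: sigma_algebra0. Qed.

Let borel_mxC A : borel_mx A -> borel_mx (~` A).
Proof. by rewrite -setTD; exact: sigma_algebraCD. Qed.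

Let borel_mx_bigcup (F : (set 'M[R]_(m, n))^nat) :
  (forall i, borel_mx (F i)) -> borel_mx (\bigcup_i F i).
Proof. exact: sigma_algebra_bigcup. Qed.

HB.instance Definition _ := @isMeasurable.Build borel_mx_display
  'M[R]_(m, n) borel_mx borel_mx0 borel_mxC borel_mx_bigcup.

End borel_mx_space.

Section euclidean.
Variable R : realType.

Definition dotv d (u v : 'cV[R]_d) : R := (u^T *m v) 0 0.

Definition quadform d (A : 'M[R]_d) (v : 'cV[R]_d) : R := (v^T *m A *m v) 0 0.

Definition sym_posdef d (A : 'M[R]_d) : Prop :=
  A^T = A /\ forall v : 'cV[R]_d, v != 0 -> 0 < quadform A v.

(* Only meaningful for matrices with a real eigenvalue, such as the nonempty
   symmetric ones. *)
Definition lambda_max d (A : 'M[R]_d) : R := sup [set a : R | eigenvalue A a].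

(* Iterated product of the one-dimensional Lebesgue measure, transported along
   R * R^d -> R^(1+d); like the other measures below it is given by its values
   on measurable sets, and is the d-dimensional Lebesgue measure there. *)
Fixpoint lebesgue_vec d : set 'cV[R]_d -> \bar R :=
  match d with
  | 0 => \d_(0 : 'cV[R]_0)
  | d'.+1 => fun A =>
      (@lebesgue_measure R \x @lebesgue_vec d')%E
        [set p : R * 'cV[R]_d' | A (col_mx p.1%:M p.2 : 'cV[R]_(1 + d'))]
  end.

Definition partial d (i : 'I_d) (f : 'cV[R]_d -> R) : 'cV[R]_d -> R :=
  fun x => 'D_(delta_mx i 0) f x.

Definition hessian d (f : 'cV[R]_d -> R) (x : 'cV[R]_d) : 'M[R]_d :=
  \matrix_(i, j) partial i (partial j f) x.

Definition twice_continuously_differentiable d (f : 'cV[R]_d -> R) : Prop :=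
  [/\ continuous f,
      forall i x, derivable f x (delta_mx i 0),
      forall i, continuous (partial i f),
      forall i j x, derivable (partial j f) x (delta_mx i 0)
    & forall i j, continuous (partial i (partial j f))].

Definition mvnormal_pdf d (m : 'cV[R]_d) (Sigma : 'M[R]_d) (x : 'cV[R]_d) : R :=
  (Num.sqrt ((2 * pi) ^+ d * \det Sigma))^-1 *
  expR (- quadform (invmx Sigma) (x - m) / 2).

Definition mvnormal d (m : 'cV[R]_d) (Sigma : 'M[R]_d) (B : set 'cV[R]_d) :
    \bar R :=
  (\int[@lebesgue_vec d]_(x in B) (mvnormal_pdf m Sigma x)%:E)%E.

End euclidean.

Section model.
Variable R : realType.

Definition independent_family dO (Omega : measurableType dO)
    (P : probability Omega R) dT (T : measurableType dT) n
    (Z : 'I_n -> Omega -> T) : Prop :=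
  forall (J : {set 'I_n}) (A : 'I_n -> set T),
    (forall i, measurable (A i)) ->
    P (\bigcap_(i in [set` J]) (Z i @^-1` A i)) =
    (\prod_(i in J) P (Z i @^-1` A i))%E.

(* beta is the fixed parameter generating the data (the argument of
   neg_log_lik below is a free variable). The last clause says that
   S (beta^T X_i) is a version of the conditional probability of Y_i = 1
   given X_i. *)
Definition binary_regression_data dO (Omega : measurableType dO)
    (P : probability Omega R) (S : R -> R) (sigma2 : R) n d
    (beta : 'cV[R]_d) (X : 'I_n -> {RV P >-> 'cV[R]_d})
    (Y : 'I_n -> {RV P >-> bool}) : Prop :=
  [/\ independent_family P (fun i w => (Y i w, X i w)),
      forall i (B : set 'cV[R]_d), measurable B ->
        distribution P (X i) B = mvnormal 0 (sigma2 / n%:R)%:M B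
    & forall i (B : set 'cV[R]_d), measurable B ->
        P (X i @^-1` B `&` Y i @^-1` [set true]) =
        (\int[P]_(w in X i @^-1` B) (S (dotv beta (X i w)))%:E)%E].

Definition design_mx n d (x : 'I_n -> 'cV[R]_d) : 'M[R]_(n, d) :=
  \matrix_(i, j) x i j 0.

Definition neg_log_lik (S : R -> R) n d (x : 'I_n -> 'cV[R]_d)
    (y : 'I_n -> bool) (beta : 'cV[R]_d) : R :=
  - \sum_(i < n) ((y i)%:R * ln (S (dotv beta (x i))) +
                  (1 - (y i)%:R) * ln (1 - S (dotv beta (x i)))).

Definition posterior_weight (S : R -> R) (alpha : R) n d (C : 'M[R]_d)
    (x : 'I_n -> 'cV[R]_d) (y : 'I_n -> bool) (beta : 'cV[R]_d) : R :=
  expR (- neg_log_lik S x y beta - alpha / 2 * quadform (invmx C) beta).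

Definition posterior_pdf (S : R -> R) (alpha : R) n d (C : 'M[R]_d)
    (x : 'I_n -> 'cV[R]_d) (y : 'I_n -> bool) (beta : 'cV[R]_d) : R :=
  posterior_weight S alpha C x y beta /
  fine (\int[@lebesgue_vec R d]_b (posterior_weight S alpha C x y b)%:E)%E.

Definition posterior (S : R -> R) (alpha : R) n d (C : 'M[R]_d)
    (x : 'I_n -> 'cV[R]_d) (y : 'I_n -> bool) (B : set 'cV[R]_d) : \bar R :=
  (\int[@lebesgue_vec R d]_(b in B) (posterior_pdf S alpha C x y b)%:E)%E.

Definition unique_maximizer T (f : T -> R) (x : T) : Prop :=
  forall x', x' <> x -> f x' < f x.

End model.

Section metropolis_hastings.
Variable R : realType.

Definition mh_accept d (ppi q : 'cV[R]_d -> R) (theta theta' : 'cV[R]_d) : R :=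
  Num.min ((ppi theta' * q theta) / (ppi theta * q theta')) 1.

Definition mhi_kernel d (ppi q : 'cV[R]_d -> R) (theta : 'cV[R]_d)
    (B : set 'cV[R]_d) : \bar R :=
  (\int[@lebesgue_vec R d]_(theta' in B)
      (mh_accept ppi q theta theta' * q theta')%:E +
   \d_theta B *
     (1 - \int[@lebesgue_vec R d]_theta'
            (mh_accept ppi q theta theta' * q theta')%:E))%E.

(* kernel_pow K t is the t-fold iterate of K for 1 <= t (and K when t = 0). *)
Definition kernel_pow dT (T : measurableType dT) (K : T -> set T -> \bar R)
    (t : nat) : T -> set T -> \bar R :=
  iter t.-1 (fun Q theta B => (\int[K theta]_theta' Q theta' B)%E) K.

Definition mode_mhi_kernel (S : R -> R) (alpha : R) n d (C : 'M[R]_d)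
    (x : 'I_n -> 'cV[R]_d) (y : 'I_n -> bool) (bstar : 'cV[R]_d) :
    'cV[R]_d -> set 'cV[R]_d -> \bar R :=
  mhi_kernel (posterior_pdf S alpha C x y)
             (mvnormal_pdf bstar (alpha^-1 *: C)).

End metropolis_hastings.

Section wasserstein.
Variable R : realType.

Definition is_metric (T : Type) (rho : T -> T -> R) : Prop :=
  [/\ forall x y, 0 <= rho x y,
      forall x y, rho x y = 0 <-> x = y,
      forall x y, rho x y = rho y x
    & forall x y z, rho x z <= rho x y + rho y z].

Definition lsc_metric (T : topologicalType) (rho : T -> T -> R) : Prop :=
  is_metric rho /\
  lower_semicontinuous (fun z : T * T => (rho z.1 z.2)%:E : \bar R).

Definition coupling dT (T : measurableType dT) (mu nu : set T -> \bar R) :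
    set (probability (T * T)%type R) :=
  [set xi | forall A, measurable A ->
     xi (A `*` setT) = mu A /\ xi (setT `*` A) = nu A].

Definition wasserstein dT (T : measurableType dT) (rho : T -> T -> R)
    (mu nu : set T -> \bar R) : \bar R :=
  ereal_inf [set (\int[xi]_z (rho z.1 z.2)%:E)%E | xi in coupling mu nu].

End wasserstein.

(* Main.v *)
(* Let Pi be the posterior density, q the proposal density and
   eps = q(b) / Pi(b) at the posterior mode b.  Convexity of the negative
   log-likelihood and maximality of b give eps Pi <= q, so the
   chain leaves b with density exactly eps Pi; as Pi is invariant,
   P^t(b, .) = (1 - (1 - eps)^t) Pi + (1 - eps)^t delta_b, and coupling the first
   part with itself gives W(P^t(b, .), Pi) <= (1 - eps)^t int rho(x, b) dPi.

   A second-order expansion at b with Hessian bound L = r0 lambda_max(X^T X)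
   bounds eps below by the Gaussian integral det(1 + L C / alpha)^(-1/2), which
   by Hadamard's inequality is at least exp(- L tr C / (2 alpha)).

   The largest singular value of the design matrix is bounded by Silverstein's
   bidiagonalization: rotating the first row and column of a Gaussian matrix
   away and bounding their norms by chi-square tails gives, by induction on the
   size, sqrt(sigma^2 (1 + delta)) (1 + sqrt(d / n)) outside an event of
   exponentially small probability.  Borel-Cantelli for delta = 1 / k and
   continuity of the rate in delta conclude. *)
Require Import Defs.
From mathcomp Require Import all_boot all_order all_algebra.
From mathcomp Require Import all_classical all_reals all_analysis.
From HB Require Import structures.
From mathcomp Require Import measurable_realfun ring lra.

Set Implicit Arguments.
Unset Strict Implicit.
Unset Printing Implicit Defensive.

Import Order.TTheory GRing.Theory Num.Theory.
Import numFieldNormedType.Exports.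

Local Open Scope classical_set_scope.
Local Open Scope ring_scope.

(** * Borel sets of matrices *)

(** The definitions give Lebesgue measure, the posterior and the kernel as bare set functions, so
    each is first identified with a bundled measure. Gaussian vectors and matrices are also built by
    recursion on the size, which makes Tonelli and induction the working tools. The plain bound |M
    x| <= t |x| does not survive the induction on the size: the first row left after the rotations
    overlaps the trailing block, and the resulting cross term has to be paid for in the direction of
    that row. The weight t / b = 1 + a / b in [strong_bound] is exactly this price. The constants a
    and b are the square roots of the chi-square thresholds n s^2 (1 + delta) and d s^2 (1 + delta)
    with s^2 = sigma^2 / n, so (a + b)^2 = sigma^2 (1 + delta) (1 + sqrt (d / n))^2; times r0 tr C /
    (2 alpha) this tends to (1 + delta) a0. Nothing relates the data of different sizes, so the bad
    events are only required to have summable probabilities. Taking delta in a countable family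
    yields one null set that serves every t and every accuracy. *)

Section measurable_matrices.
Variable R : realType.

Lemma open_mx_measurable m n (U : set 'M[R]_(m, n)) : open U -> measurable U.
Proof. by move=> oU; exact: sub_gen_smallest. Qed.

Lemma closed_mx_measurable m n (U : set 'M[R]_(m, n)) :
  closed U -> measurable U.
Proof.
by move=> /closed_openC/open_mx_measurable/measurableC; rewrite setCK.
Qed.

Lemma continuous_measurable_mx m n (f : 'M[R]_(m, n) -> R) :
  continuous f -> measurable_fun setT f.
Proof.
move=> /continuousP cf; apply: (measurability _ (RGenOpens.measurableE R)).
move=> _ [_ [a [b ->]] <-]; rewrite setTI.
apply: open_mx_measurable; apply: cf.
exact: (@interval_open R (BRight a) (BLeft b)).
Qed.

Lemma measurable_mx_coord m n i j :
  measurable_fun setT (fun M : 'M[R]_(m, n) => M i j).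
Proof. by apply: continuous_measurable_mx; exact: coord_continuous. Qed.

Lemma continuous_mx (T : topologicalType) m n (f : T -> 'M[R]_(m, n)) :
  (forall i j, continuous (fun x => f x i j)) -> continuous f.
Proof.
move=> cf x A [P fP sPA].
have : \forall y \near x, forall i j, P i j (f y i j).
  apply: filter_forall => i; apply: filter_forall => j.
  exact: (cf i j x _ (fP i j)).
by apply: filterS => y; exact: sPA.
Qed.

Lemma countable_bigcup_measurable d (T : measurableType d) (I : countType)
  (D : set I) (F : I -> set T) :
  (forall i, D i -> measurable (F i)) -> measurable (\bigcup_(i in D) F i).
Proof.
move=> mF; pose G k := if unpickle k is Some i then
   (if pselect (D i) then F i else set0) else set0 : set T.
have -> : \bigcup_(i in D) F i = \bigcup_k G k.
  apply/seteqP; split => x /=.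
    move=> [i Di Fix]; exists (pickle i) => //.
    by rewrite /G pickleK; case: pselect.
  move=> [k _]; rewrite /G; case: (unpickle k) => // i.
  by case: pselect => // Di Fi; exists i.
apply: bigcupT_measurable => k; rewrite /G; case: (unpickle k) => // i.
by case: pselect => //= Di; exact: mF.
Qed.

Definition mx_box m n (A : 'I_m -> 'I_n -> set R) : set 'M[R]_(m, n) :=
  [set M | forall i j, A i j (M i j)].

Lemma mx_boxE m n (A : 'I_m -> 'I_n -> set R) : mx_box A =
  ~` \bigcup_ij ~` ((fun M : 'M[R]_(m, n) => M ij.1 ij.2) @^-1` A ij.1 ij.2).
Proof.
apply/seteqP; split => M /=; first by move=> AM [ij _]; apply; exact: AM.
by move=> AM i j; apply: contrapT => Aij; apply: AM; exists (i, j).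
Qed.

Lemma measurable_preimage_box d (T : measurableType d) m n
    (f : T -> 'M[R]_(m, n)) (A : 'I_m -> 'I_n -> set R) :
  (forall i j, measurable_fun setT (fun x => f x i j)) ->
  (forall i j, measurable (A i j)) -> measurable (f @^-1` mx_box A).
Proof.
move=> mf mA; rewrite mx_boxE -preimage_setC preimage_bigcup.
apply/measurableC/countable_bigcup_measurable => ij _; rewrite -preimage_setC.
by apply: measurableC; rewrite -[X in measurable X]setTI; exact: mf.
Qed.

(* Rational cubes form a countable base of the topology of matrices. *)
Lemma open_mx_bigcup m n (U : set 'M[R]_(m, n)) : open U ->
  exists D : set ('M[rat]_(m, n) * rat), U = \bigcup_(k in D)
    mx_box (fun i j => ball (ratr (k.1 i j) : R) (ratr k.2)).
Proof.
move=> oU.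
pose B (k : 'M[rat]_(m, n) * rat) : set 'M[R]_(m, n) :=
  mx_box (fun i j => ball (ratr (k.1 i j) : R) (ratr k.2)).
exists [set k | B k `<=` U].
apply/seteqP; split => x /=; last by move=> [k kU Bk]; exact: kU.
move=> Ux.
have /nbhs_ballP[e /= e0 eU] : nbhs x U by exact: open_nbhs_nbhs.
(* A radius below [e / 2]: a cube of radius [q] whose rational centre is within [q] of [x] contains
   [x] and stays in the [e]-ball. *)
have [q /andP[q0 qe]] : exists q : rat, 0 < (ratr q : R) < e / 2.
  have [q] := rat_in_itvoo (divr_gt0 e0 (@ltr0Sn R 1)).
  by rewrite in_itv/= => qe; exists q.
have r i j : exists r : rat, ball (x i j) (ratr q : R) (ratr r).
  have [r] : exists r : rat, ratr r \in `]x i j - ratr q, x i j + ratr q[.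
    by apply: rat_in_itvoo; lra.
  rewrite in_itv/= => rq; exists r.
  by rewrite /ball/= ltr_distl; apply/andP; lra.
pose c := \matrix_(i, j) xchoose (r i j).
have cE i j : ball (x i j) (ratr q : R) (ratr (c i j)).
  by rewrite mxE; exact: (xchooseP (r i j)).
exists (c, q); last by move=> i j /=; exact: ball_sym.
move=> M BM; apply: eU; split => // i j.
by rewrite [e]splitr; apply: ball_triangle; apply: (le_ball (ltW qe)); [exact: cE|exact: BM].
Qed.

Lemma measurable_fun_mx d (T : measurableType d) m n (f : T -> 'M[R]_(m, n)) :
  (forall i j, measurable_fun setT (fun x => f x i j)) ->
  measurable_fun setT f.
Proof.
move=> mf; apply: (measurability (@open 'M[R]_(m, n) : set (set _))) => //.
move=> _ [U /open_mx_bigcup[D ->] <-]; rewrite setTI preimage_bigcup.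
apply: countable_bigcup_measurable => k _; apply: measurable_preimage_box => // i j.
exact: measurable_ball.
Qed.

Lemma measurable_mx_box m n (A : 'I_m -> 'I_n -> set R) :
  (forall i j, measurable (A i j)) -> measurable (mx_box A).
Proof.
move=> mA; apply: (measurable_preimage_box (f := id)) => // i j.
exact: measurable_mx_coord.
Qed.

(** Stacking the two vectors identifies the product with R^(d+d), where open sets are Borel by
    definition. The stacking map [g] is measurable coordinate by coordinate for the product
    sigma-algebra, and this brings every open set of the product into it. *)
Lemma open_pair_measurable d (O : set ('cV[R]_d * 'cV[R]_d)) :
  open O -> measurable O.
Proof.
move=> oO.
pose f (M : 'cV[R]_(d + d)) := (usubmx M, dsubmx M).
pose g (z : 'cV[R]_d * 'cV[R]_d) := col_mx z.1 z.2.
have fg z : f (g z) = z by rewrite /f /g col_mxKu col_mxKd; case: z.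
have -> : O = g @^-1` (f @^-1` O) by apply/seteqP; split => z /=; rewrite fg.
rewrite -[X in measurable X]setTI.
have mg : measurable_fun setT g.
  apply: measurable_fun_mx => i j; rewrite /g.
  case: (split_ordP i) => k ->.
    under eq_fun do rewrite col_mxEu.
    exact: (measurableT_comp (measurable_mx_coord _ _)).
  under eq_fun do rewrite col_mxEd.
  exact: (measurableT_comp (measurable_mx_coord _ _)).
apply: mg => //; apply: open_mx_measurable.
suff cf : continuous f by move/continuousP : cf; exact.
move=> M; have cu : usubmx x @[x --> M] --> usubmx M.
  apply: (@continuous_mx _ _ _ (fun M : 'cV[R]_(d + d) => usubmx M)) => i j.
  by under eq_fun do rewrite mxE; exact: coord_continuous.
have cd : dsubmx x @[x --> M] --> dsubmx M.
  apply: (@continuous_mx _ _ _ (fun M : 'cV[R]_(d + d) => dsubmx M)) => i j.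
  by under eq_fun do rewrite mxE; exact: coord_continuous.
exact: (cvg_pair cu cd).
Qed.

(** Strict superlevel sets of a lower semicontinuous function are open. *)
Lemma measurable_lsc_metric d (rho : 'cV[R]_d -> 'cV[R]_d -> R) :
  lsc_metric rho -> measurable_fun setT (fun z => (rho z.1 z.2)%:E).
Proof.
move=> [_ lsc]; apply: (measurability _ (ErealGenOInfty.measurableE R)).
move=> _ [_ [r ->] <-]; rewrite setTI; apply: open_pair_measurable.
by rewrite preimage_itvoy; move/lower_semicontinuousP : lsc; exact.
Qed.

End measurable_matrices.

(** * Lebesgue measure on R^d *)

Section lebesgue_vec_measure.
Variable R : realType.
Local Open Scope ereal_scope.

(** The induction step that turns [lebesgue_vec] into a bundled measure. The left inverse [g]
    carries over the exhausting rectangles; sigma-finiteness is kept for the sake of Tonelli. *)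
Lemma sigma_finite_prod_transport d1 d2 d3 (T1 : measurableType d1)
    (T2 : measurableType d2) (T3 : measurableType d3)
    (m1 : {sigma_finite_measure set T1 -> \bar R})
    (m2 : {sigma_finite_measure set T2 -> \bar R})
    (f : T1 * T2 -> T3) (g : T3 -> T1 * T2) :
  measurable_fun setT f -> measurable_fun setT g -> cancel f g ->
  {nu : {sigma_finite_measure set T3 -> \bar R} |
    nu = pushforward (m1 \x m2) f :> (set T3 -> \bar R)}.
Proof.
move=> mf mg fK.
pose nu : {measure set T3 -> \bar R} :=
  measure_function_pushforward__canonical__measure_function_Measure (m1 \x m2) mf.
have sf : sigma_finite setT nu.
  have [A AT Afin] := sigma_finiteT m1; have [B BT Bfin] := sigma_finiteT m2.
  exists (fun k => if unpickle k is Some (i, j) then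
                     g @^-1` (A i `*` B j) else set0).
    apply/seteqP; split => // z _.
    have [i _ Ai] : (\bigcup_i A i) (g z).1 by rewrite -AT.
    have [j _ Bj] : (\bigcup_j B j) (g z).2 by rewrite -BT.
    by exists (pickle (i, j)) => //; rewrite pickleK.
  move=> k; case: (unpickle k) => [[i j]|]; last by rewrite measure0.
  have [[mA Aoo] [mB Boo]] := (Afin i, Bfin j); split.
    by rewrite -[X in measurable X]setTI; apply: mg => //; exact: measurableX.
  rewrite /nu/= /pushforward -comp_preimage (_ : g \o f = id) ?preimage_id//.
    by rewrite product_measure1E// lte_mul_pinfty// ge0_fin_numE.
  by apply/funext => x /=; rewrite fK.
pose sfm := Measure_isSigmaFinite.Build _ _ _ nu sf.
pose nu' : {sigma_finite_measure set T3 -> \bar R} :=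
  HB.pack (nu : set T3 -> \bar R) nu sfm.
by exists nu'.
Qed.

Definition consv d (p : measurableTypeR R * 'cV[R]_d) : 'cV[R]_(1 + d) := col_mx p.1%:M p.2.

Definition unconsv d (v : 'cV[R]_(1 + d)) : measurableTypeR R * 'cV[R]_d :=
  (v 0 0, dsubmx v)%R.

Lemma consvK d : cancel (@consv d) (@unconsv d).
Proof.
move=> [x y]; rewrite /consv /unconsv col_mxKd/=; congr pair.
by rewrite mxE; case: splitP => // j _; rewrite !mxE !ord1.
Qed.

Lemma unconsvK d : cancel (@unconsv d) (@consv d).
Proof.
move=> v; rewrite /consv /unconsv/= -[RHS]vsubmxK; congr col_mx.
apply/matrixP => i j; rewrite !ord1 !mxE eqxx mulr1n; congr (v _ _).
exact: val_inj.
Qed.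

Lemma measurable_consv d : measurable_fun setT (@consv d).
Proof.
apply: measurable_fun_mx => i j; rewrite /consv ord1.
case: (split_ordP i) => k ->.
  under eq_fun do rewrite col_mxEu ord1 mxE eqxx mulr1n.
  exact: measurable_fst.
under eq_fun do rewrite col_mxEd.
exact: (measurableT_comp (measurable_mx_coord _ _)).
Qed.

Lemma measurable_unconsv d : measurable_fun setT (@unconsv d).
Proof.
apply: measurable_fun_pair; first exact: measurable_mx_coord.
apply: measurable_fun_mx => i j.
by under eq_fun do rewrite mxE; exact: measurable_mx_coord.
Qed.

(** A sigma type rather than an existential, so that the measure can be extracted as [lebv]. *)
Lemma lebesgue_vec_spec d :
  {nu : {sigma_finite_measure set 'cV[R]_d -> \bar R} |
    nu = @lebesgue_vec R d :> (set 'cV[R]_d -> \bar R)}.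
Proof.
elim: d => [|d [nu nuE]]; first by exists (@dirac _ 'cV[R]_0 0%R R).
have [mu muE] := @sigma_finite_prod_transport _ _ _ _ _ _
  (@lebesgue_measure R) nu _ _
  (@measurable_consv d) (@measurable_unconsv d) (@consvK d).
by exists mu; rewrite muE /= -nuE.
Qed.

Definition lebv d := sval (lebesgue_vec_spec d).

Lemma lebvE d : @lebesgue_vec R d = lebv d.
Proof. by rewrite /lebv; case: lebesgue_vec_spec. Qed.

Lemma lebv_cons d (A : set 'cV[R]_(1 + d)) :
  lebv d.+1 A = (@lebesgue_measure R \x lebv d) (@consv d @^-1` A).
Proof. by rewrite -lebvE /= lebvE. Qed.

Section integral.
Variables (d : nat) (f : 'cV[R]_(1 + d) -> \bar R).
Hypotheses (mf : measurable_fun setT f) (f0 : forall x, 0 <= f x).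

Let mfc : measurable_fun setT (f \o @consv d).
Proof. by apply: measurableT_comp => //; exact: measurable_consv. Qed.

Let integral_lebv_prod :
  \int[lebv d.+1]_v f v = \int[@lebesgue_measure R \x lebv d]_p f (consv p).
Proof.
have := @ge0_integral_pushforward _ _ _ _ _ _ (@measurable_consv d)
  (@lebesgue_measure R \x lebv d) setT f measurableT mf (fun x _ => f0 x).
rewrite preimage_setT => <-.
apply: eq_measure_integral => [|mcons A mA _]; [exact: measurable_consv|exact: lebv_cons].
Qed.

Lemma integral_lebv_cons : \int[lebv d.+1]_v f v =
  \int[@lebesgue_measure R]_x \int[lebv d]_y f (consv (x, y)).
Proof. rewrite integral_lebv_prod.
exact: (@fubini_tonelli1 _ _ _ _ _ (@lebesgue_measure R) (lebv d)
  (f \o @consv d) mfc (fun p => f0 (consv p))). Qed.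

(** Integrating the first coordinate innermost suits the completion of the square in Gaussian
    integrals; the other order matches the recursion of [gaussv]. *)
Lemma integral_lebv_consC : \int[lebv d.+1]_v f v =
  \int[lebv d]_y \int[@lebesgue_measure R]_x f (consv (x, y)).
Proof. rewrite integral_lebv_prod.
exact: (@fubini_tonelli2 _ _ _ _ _ (@lebesgue_measure R) (lebv d)
  (f \o @consv d) mfc (fun p => f0 (consv p))). Qed.

End integral.

Lemma integral_lebv0 (f : 'cV[R]_0 -> \bar R) :
  measurable_fun setT f -> \int[lebv 0]_v f v = f 0%R.
Proof.
move=> mf; transitivity (\int[\d_ (0 : 'cV[R]_0)%R]_v f v).
  by apply: eq_measure_integral => A mA _; rewrite /= -lebvE.
by rewrite integral_dirac// diracT mul1e.
Qed.

Lemma measurable_shift (a : R) :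
  measurable_fun setT ((fun x => x + a) : measurableTypeR R -> measurableTypeR R)%R.
Proof. by apply: measurable_funD => //; exact: measurable_id. Qed.

(** The shifted measure has the same values on half-open intervals, and these determine Lebesgue
    measure. *)
Lemma lebesgue_measure_shift (a : R) (A : set R) : measurable A ->
  pushforward (@lebesgue_measure R) ((fun x => x + a) : measurableTypeR R -> measurableTypeR R)%R A =
  lebesgue_measure A.
Proof.
move=> mA; apply/esym/lebesgue_measure_unique => //=.
  exact: measurable_shift.
move=> ? _ [[x y]] _ <-.
rewrite /pushforward (_ : _ @^-1` _ = `](x - a)%R, (y - a)%R]%classic).
  rewrite !lebesgue_measure_itv/= !lte_fin ltrBlDr subrK -!EFinD.
  by rewrite (_ : y - a - (x - a) = y - x)%R //; ring.
by apply/seteqP; split => z /=; rewrite !in_itv/= ltrBlDr lerBrDr.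
Qed.

Lemma integral_shift (a : R) (f : R -> \bar R) :
  measurable_fun setT f -> (forall x, 0 <= f x) ->
  \int[lebesgue_measure]_x f (x + a)%R = \int[lebesgue_measure]_x f x.
Proof.
move=> mf f0.
have := @ge0_integral_pushforward _ _ _ _ _ _ (measurable_shift a)
  (@lebesgue_measure R) setT f measurableT mf (fun x _ => f0 x).
rewrite preimage_setT => <-.
apply: eq_measure_integral => [|ms A mA _]; first exact: measurable_shift.
exact: lebesgue_measure_shift.
Qed.

End lebesgue_vec_measure.

(** * Positive definite matrices and Gaussian integrals *)

Section posdef.
Variable R : realType.

Lemma dotvE d (u v : 'cV[R]_d) : dotv u v = \sum_i u i 0 * v i 0.
Proof. by rewrite /dotv mxE; apply: eq_bigr => i _; rewrite mxE. Qed.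

Lemma quadform1 d (v : 'cV[R]_d) : quadform 1%:M v = dotv v v.
Proof. by rewrite /quadform mulmx1. Qed.

Lemma quadformD d (A B : 'M[R]_d) v :
  quadform (A + B) v = quadform A v + quadform B v.
Proof. by rewrite /quadform mulmxDr mulmxDl mxE. Qed.

Lemma quadformZ d c (A : 'M[R]_d) v : quadform (c *: A) v = c * quadform A v.
Proof. by rewrite /quadform -scalemxAr -scalemxAl mxE. Qed.

Lemma dotvv_ge0 d (v : 'cV[R]_d) : 0 <= dotv v v.
Proof. by rewrite dotvE sumr_ge0// => i _; rewrite -expr2 sqr_ge0. Qed.

Lemma dotvv_eq0 d (v : 'cV[R]_d) : dotv v v = 0 -> v = 0.
Proof.
rewrite dotvE => /eqP; rewrite psumr_eq0 => [|i _]; last first.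
  by rewrite -expr2 sqr_ge0.
move=> /allP v0; apply/matrixP => i j; rewrite ord1 mxE.
by have := v0 i (mem_index_enum i); rewrite mulf_eq0 orbb => /eqP.
Qed.

Lemma dotvv_gt0 d (v : 'cV[R]_d) : v != 0 -> 0 < dotv v v.
Proof.
by move=> v0; rewrite lt0r dotvv_ge0 andbT; apply: contra_neq v0 => /dotvv_eq0.
Qed.

Lemma sym_posdef1 d : sym_posdef (1%:M : 'M[R]_d).
Proof. by split=> [|v v0]; rewrite ?trmx1// quadform1 dotvv_gt0. Qed.

Lemma sym_posdefZ d c (A : 'M[R]_d) : 0 < c -> sym_posdef A -> sym_posdef (c *: A).
Proof.
by move=> c0 [sA pA]; split=> [|v v0]; rewrite ?linearZ/= ?sA// quadformZ mulr_gt0 ?pA.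
Qed.

Lemma sym_posdefDZ d c (A B : 'M[R]_d) :
  0 <= c -> sym_posdef A -> sym_posdef B -> sym_posdef (A + c *: B).
Proof.
move=> c0 [sA pA] [sB pB]; split=> [|v v0].
  by rewrite linearD/= linearZ/= sA sB.
by rewrite quadformD quadformZ ltr_wpDr ?pA// mulr_ge0// ltW// pB.
Qed.

Lemma sym_posdef_diag d (A : 'M[R]_d) i : sym_posdef A -> 0 < A i i.
Proof.
move=> [_ pA].
have := pA (delta_mx i 0); rewrite /quadform trmx_delta -rowE mxE.
rewrite (bigD1 i)//= big1 ?addr0 => [|j ji]; last by rewrite !mxE (negbTE ji) mulr0.
rewrite !mxE !eqxx mulr1; apply; apply/eqP => /matrixP/(_ i 0)/eqP.
by rewrite !mxE !eqxx oner_eq0.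
Qed.

Definition schur d (A : 'M[R]_(1 + d)) : 'M[R]_d :=
  drsubmx A - (A 0 0)^-1 *: (dlsubmx A *m (dlsubmx A)^T).

Section schur_complement.
Variables (d : nat) (A : 'M[R]_(1 + d)).
Hypothesis pA : sym_posdef A.

Let a_gt0 : 0 < A 0 0. Proof. exact: sym_posdef_diag. Qed.

Let a_neq0 : A 0 0 != 0. Proof. by rewrite gt_eqF. Qed.

Let ulA : ulsubmx A = (A 0 0)%:M.
Proof. by apply/matrixP => i j; rewrite !ord1 !mxE eqxx mulr1n; congr (A _ _); exact: val_inj. Qed.

Let urA : ursubmx A = (dlsubmx A)^T.
Proof. by rewrite trmx_dlsub pA.1. Qed.

Lemma det_schur : \det A = A 0 0 * \det (schur A).
Proof.
rewrite -[in LHS](submxK A) ulA urA.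
(* One step of block elimination: a unitriangular factor times an upper triangular one with the
   Schur complement in its corner. *)
set b := dlsubmx A; have -> : block_mx (A 0 0)%:M b^T b (drsubmx A) =
    block_mx 1%:M 0 ((A 0 0)^-1 *: b) 1%:M *m
    block_mx (A 0 0)%:M b^T 0 (schur A).
  rewrite mulmx_block !mul1mx !mul0mx !addr0 mul_mx_scalar scalerA divff// scale1r.
  by rewrite /schur -scalemxAl addrC subrK.
by rewrite det_mulmx det_lblock det_ublock !det1 mul1r det_scalar1 mul1r.
Qed.

(** Completing the square in the first coordinate; positivity of the Schur complement and the
    Gaussian integral both rest on this identity. *)
Lemma quadform_schur (x : R) (y : 'cV[R]_d) :
  quadform A (consv (x, y)) =
  A 0 0 * (x + dotv (dlsubmx A) y / A 0 0) ^+ 2 + quadform (schur A) y.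
Proof.
rewrite /quadform /consv/= -[in LHS](submxK A) ulA urA.
set b := dlsubmx A.
have eD (M N : 'M[R]_1) : (M + N) 0 0 = M 0 0 + N 0 0 by rewrite mxE.
have eN (M : 'M[R]_1) : (- M) 0 0 = - M 0 0 by rewrite mxE.
have eZ k (M : 'M[R]_1) : (k *: M) 0 0 = k * M 0 0 by rewrite mxE.
have yb : (y^T *m b) 0 0 = dotv b y.
  by rewrite /dotv -[LHS]trace_mx11 -mxtrace_tr trmx_mul trmxK trace_mx11.
rewrite tr_col_mx mul_row_block mul_row_col tr_scalar_mx.
rewrite !mulmxDl !mul_scalar_mx -!scalemxAl ?mulmxA !mul_mx_scalar.
rewrite /schur mulmxBr mulmxBl -scalemxAr -scalemxAl !(eD, eN, eZ) !mulmxA yb.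
rewrite -/(dotv b y) -/b.
have -> : (y^T *m b *m b^T *m y) 0 0 = dotv b y ^+ 2.
  by rewrite -mulmxA mxE big_ord1 -/(dotv b y) yb expr2.
by rewrite [_%:M _ _]mxE eqxx mulr1n; field.
Qed.

Lemma schur_posdef : sym_posdef (schur A).
Proof.
split=> [|y y0].
  rewrite /schur linearB/= linearZ/= trmx_mul trmxK; congr (_ - _).
  by rewrite trmx_drsub pA.1.
(* This first coordinate cancels the square, leaving only the Schur complement. *)
have := pA.2 (consv (- (dotv (dlsubmx A) y / A 0 0), y)).
rewrite quadform_schur addNr expr0n/= mulr0 add0r; apply.
apply: contra_neq y0 => /(congr1 (@unconsv R d)); rewrite consvK => -[_ ->].
by rewrite linear0.
Qed.

Lemma schur_diag_le i : schur A i i <= A (rshift 1 i) (rshift 1 i).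
Proof.
rewrite /schur !mxE lerBlDr lerDl big_ord1 [X in _ * X]mulrC !mxE.
by rewrite -expr2 mulr_ge0 ?sqr_ge0// invr_ge0 ltW.
Qed.

End schur_complement.

Lemma det_posdef_gt0 d (A : 'M[R]_d) : sym_posdef A -> 0 < \det A.
Proof.
elim: d A => [|d IH] A pA; first by rewrite det_mx00.
by rewrite (det_schur pA) mulr_gt0 ?sym_posdef_diag// IH//; exact: schur_posdef.
Qed.

(** Hadamard's inequality by induction: the determinant splits off the first diagonal entry, and
    passing to the Schur complement only lowers the remaining diagonal entries. *)
Lemma det_posdef_le d (A : 'M[R]_d) : sym_posdef A -> \det A <= \prod_i A i i.
Proof.
elim: d A => [|d IH] A pA; first by rewrite det_mx00 big_ord0.
have pS := schur_posdef pA.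
rewrite (det_schur pA) big_ord_recl ler_wpM2l ?(ltW (sym_posdef_diag _ _))//.
apply: (le_trans (IH _ pS)); apply: ler_prod => i _.
rewrite ltW ?sym_posdef_diag//=; apply: (le_trans (schur_diag_le pA i)).
by rewrite (_ : rshift 1 i = lift ord0 i)//; exact: val_inj.
Qed.

(** Hadamard reduces the determinant to its diagonal, where [1 + x <= expR x] applies entry by
    entry. *)
Lemma det_addZ_le d c (A : 'M[R]_d) : 0 <= c -> sym_posdef A ->
  \det (1%:M + c *: A) <= expR (c * \tr A).
Proof.
move=> c0 pA; apply: (le_trans (det_posdef_le (sym_posdefDZ c0 (sym_posdef1 d) pA))).
rewrite /mxtrace mulr_sumr expR_sum; apply: ler_prod => i _.
by rewrite !mxE eqxx expR_ge1Dx addr_ge0//= mulr_ge0// ltW// sym_posdef_diag.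
Qed.

Lemma posdef_unitmx d (A : 'M[R]_d) : sym_posdef A -> A \in unitmx.
Proof. by move=> /det_posdef_gt0 A0; rewrite unitmxE unitfE gt_eqF. Qed.

Lemma sym_posdef_inv d (A : 'M[R]_d) : sym_posdef A -> sym_posdef (invmx A).
Proof.
move=> pA; have uA := posdef_unitmx pA; split=> [|v v0].
  by rewrite trmx_inv pA.1.
have := pA.2 (invmx A *m v); rewrite /quadform trmx_mul trmx_inv pA.1.
rewrite -!mulmxA (mulmxA A) mulmxV// mul1mx; apply.
by apply: contra_neq v0 => /(congr1 (mulmx A)); rewrite mulmxA mulmxV// mul1mx mulmx0.
Qed.

End posdef.

(** * Gaussian integrals with a quadratic exponent *)

Section gaussian_integral.
Variable R : realType.

Lemma measurable_expR_sqr (a c : R) :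
  measurable_fun setT (fun x : R => (expR (- (a * (x + c) ^+ 2) / 2))%:E).
Proof.
apply/measurable_EFinP; apply: measurableT_comp => //.
by apply: measurable_funM => //; apply: measurableT_comp => //;
  apply: measurable_funM => //; apply: measurable_funX; exact: measurable_funD.
Qed.

Lemma integral_expR_sqr (a c : R) : 0 < a ->
  (\int[lebesgue_measure]_x (expR (- (a * (x + c) ^+ 2) / 2))%:E =
   (Num.sqrt (2 * pi / a))%:E)%E.
Proof.
(* The standard deviation for which the integrand is an unnormalized [normal_pdf] of mean [- c]. *)
move=> a0; pose s : R := Num.sqrt a^-1.
have s0 : s != 0 by rewrite gt_eqF// sqrtr_gt0 invr_gt0.
have sE : s ^+ 2 = a^-1 by rewrite sqr_sqrtr// invr_ge0 ltW.
have pkE : (normal_peak s)^-1 = Num.sqrt (2 * pi / a).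
  by rewrite /normal_peak invrK sE -mulr_natl; congr Num.sqrt; ring.
have := integral_normal_pdf (- c) s.
under eq_integral => x _.
  rewrite normal_pdfE// /normal_fun sE opprK EFinM.
  rewrite (_ : - _ ^+ 2 / _ = - (a * (x + c) ^+ 2) / 2); last first.
    by rewrite -mulr_natl invfM invrK; ring.
  over.
rewrite ge0_integralZl//=; first last.
- by rewrite lee_fin normal_peak_ge0.
- exact: measurable_expR_sqr.
move=> /(congr1 (fun z => (normal_peak s)^-1%:E * z)%E).
by rewrite muleA -EFinM mulVf ?mul1e ?mule1 ?pkE// gt_eqF// normal_peak_gt0.
Qed.

Lemma measurable_quadform d (A : 'M[R]_d) (m : 'cV[R]_d) :
  measurable_fun setT (fun x : 'cV[R]_d => quadform A (x - m)).
Proof.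
rewrite /quadform.
under eq_fun => x.
  rewrite mxE; under eq_bigr => j _ do rewrite mxE big_distrl/=.
  over.
apply: measurable_sum => j; apply: measurable_sum => i.
by apply: measurable_funM; [apply: measurable_funM => //|];
  under eq_fun do rewrite !mxE; apply: measurable_funB => //; exact: measurable_mx_coord.
Qed.

Lemma measurable_expR_quadform d (A : 'M[R]_d) (m : 'cV[R]_d) :
  measurable_fun setT (fun x : 'cV[R]_d => (expR (- quadform A (x - m) / 2))%:E).
Proof.
apply/measurable_EFinP; apply: measurableT_comp => //.
apply: measurable_funM => //; apply: measurableT_comp => //.
exact: measurable_quadform.
Qed.

(** After the square is completed, the inner integral over the first coordinate no longer depends on
    the others, and what remains is the same integral for the Schur complement. *)
Lemma integral_expR_quadform d (A : 'M[R]_d) (m : 'cV[R]_d) : sym_posdef A ->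
  (\int[lebv R d]_x (expR (- quadform A (x - m) / 2))%:E =
   (Num.sqrt ((2 * pi) ^+ d / \det A))%:E)%E.
Proof.
elim: d A m => [|d IH] A m pA; last (change d.+1 with (1 + d)%N in A, m, pA).
  rewrite integral_lebv0; last exact: measurable_expR_quadform.
  rewrite /quadform det_mx00 divr1 expr0 sqrtr1 (_ : _ 0 0 = 0) ?oppr0 ?mul0r ?expR0//.
  by rewrite mxE big_ord0.
rewrite integral_lebv_consC; last 2 first.
- exact: measurable_expR_quadform.
- by move=> x; rewrite lee_fin expR_ge0.
have a0 : 0 < A 0 0 by exact: sym_posdef_diag.
have pS := schur_posdef pA.
pose m2 : 'cV[R]_d := (unconsv m).2; pose m1 : R := (unconsv m).1.
pose c y := dotv (dlsubmx A) (y - m2) / A 0 0 - m1.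
under eq_integral => y _.
  under eq_integral => x _.
    rewrite (_ : consv (x, y) - m = consv (x - m1, y - m2)); last first.
      by rewrite -{1}(unconsvK m) /consv opp_col_mx add_col_mx -scalar_mx_is_additive.
    rewrite quadform_schur// -addrA [- m1 + _]addrC -/(c y) opprD mulrDl expRD mulrC EFinM.
    over.
  rewrite ge0_integralZl//=; last exact: measurable_expR_sqr.
  rewrite integral_expR_sqr// muleC.
  over.
rewrite ge0_integralZl//=; last exact: measurable_expR_quadform.
rewrite IH// -EFinM -sqrtrM; last by rewrite divr_ge0 ?mulr_ge0// ?pi_ge0 ?ltW.
rewrite (det_schur pA); congr (Num.sqrt _)%:E.
by rewrite exprS; field; rewrite !gt_eqF ?det_posdef_gt0.
Qed.

Lemma measurable_mvnormal_pdf d (m : 'cV[R]_d) Sigma :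
  measurable_fun setT (mvnormal_pdf m Sigma).
Proof.
apply: measurable_funM => //; apply/measurable_EFinP.
exact: measurable_expR_quadform.
Qed.

Lemma mvnormal_pdf_gt0 d (m : 'cV[R]_d) Sigma x : sym_posdef Sigma ->
  0 < mvnormal_pdf m Sigma x.
Proof.
move=> pS; rewrite mulr_gt0 ?expR_gt0// invr_gt0 sqrtr_gt0 mulr_gt0//.
  by rewrite exprn_gt0// mulr_gt0// pi_gt0.
exact: det_posdef_gt0.
Qed.

(** The exponents add up to a Gaussian of precision [invmx Sigma + L *: 1%:M], so the value is a
    ratio of determinants. *)
Lemma integral_mvnormal_tilt d (m : 'cV[R]_d) Sigma (L : R) :
  0 <= L -> sym_posdef Sigma ->
  (\int[lebv R d]_x
     (mvnormal_pdf m Sigma x * expR (- (L * dotv (x - m) (x - m)) / 2))%:E =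
  (Num.sqrt (\det (1%:M + L *: Sigma)))^-1%:E)%E.
Proof.
move=> L0 pS; have pI := sym_posdef_inv pS.
have pQ : sym_posdef (invmx Sigma + L *: 1%:M) by exact: sym_posdefDZ (sym_posdef1 _ _).
under eq_integral => x _.
  rewrite /mvnormal_pdf -mulrA -expRD -mulrDl -opprD -quadform1 -quadformZ -quadformD EFinM.
  over.
rewrite ge0_integralZl//=; last exact: measurable_expR_quadform.
rewrite integral_expR_quadform// -EFinM; congr EFin.
have dS := det_posdef_gt0 pS; have dQ := det_posdef_gt0 pQ.
have dE : \det (1%:M + L *: Sigma) = \det Sigma * \det (invmx Sigma + L *: 1%:M).
  rewrite -det_mulmx mulmxDr mulmxV ?posdef_unitmx// -scalemxAr mulmx1.
  by [].
have p0 : 0 < (2 * pi : R) ^+ d by rewrite exprn_gt0// mulr_gt0// pi_gt0.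
rewrite -sqrtrV ?mulr_ge0 ?ltW// -sqrtrM ?invr_ge0 ?mulr_ge0 ?ltW//.
rewrite -sqrtrV ?dE ?mulr_ge0 ?ltW//; congr Num.sqrt.
by field; rewrite !gt_eqF ?dS ?dQ.
Qed.

Lemma integral_mvnormal_pdf d (m : 'cV[R]_d) Sigma : sym_posdef Sigma ->
  (\int[lebv R d]_x (mvnormal_pdf m Sigma x)%:E = 1)%E.
Proof.
move=> pS; have := integral_mvnormal_tilt m (lexx 0) pS.
rewrite scale0r addr0 det1 sqrtr1 invr1 => <-; apply: eq_integral => x _.
by rewrite mul0r oppr0 mul0r expR0 mulr1.
Qed.

Lemma integral_mvnormal_tilt_ge d (m : 'cV[R]_d) Sigma (L : R) :
  0 <= L -> sym_posdef Sigma ->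
  ((expR (- (L * \tr Sigma / 2)))%:E <= \int[lebv R d]_x
     (mvnormal_pdf m Sigma x * expR (- (L * dotv (x - m) (x - m)) / 2))%:E)%E.
Proof.
move=> L0 pS; rewrite integral_mvnormal_tilt// lee_fin expRN.
have d0 : 0 < \det (1%:M + L *: Sigma) by apply/det_posdef_gt0/sym_posdefDZ => //; exact: sym_posdef1.
rewrite lef_pV2 ?posrE ?expR_gt0 ?sqrtr_gt0//.
(* Writing the exponential as the square root of its square doubles the exponent, which matches
   [det_addZ_le]. *)
rewrite -[leRHS]ger0_norm ?expR_ge0// -sqrtr_sqr ler_wsqrtr// expr2 -expRD -splitr.
exact: det_addZ_le.
Qed.

End gaussian_integral.

(** * The independence sampler started at the mode *)

Section density.
Context d (T : measurableType d) (R : realType).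
Variables (mu : {measure set T -> \bar R}) (f : T -> R).
Hypotheses (mf : measurable_fun setT f) (f0 : forall x, 0 <= f x).
Local Open Scope ereal_scope.

Definition dens (B : set T) : \bar R := \int[mu]_(x in B) (f x)%:E.

Let mfE : measurable_fun setT (EFin \o f). Proof. exact/measurable_EFinP. Qed.

Let dens0 : dens set0 = 0. Proof. by rewrite /dens integral_set0. Qed.

Let dens_ge0 B : 0 <= dens B.
Proof. by apply: integral_ge0 => x _; rewrite lee_fin. Qed.

Let dens_semi_sigma_additive : semi_sigma_additive dens.
Proof.
move=> F mF tF mUF; rewrite /dens ge0_integral_bigcup//; last 2 first.
- exact: measurable_funTS.
- by move=> x _; rewrite lee_fin.
by apply: is_cvg_ereal_nneg_natsum_cond => n _ _; exact: dens_ge0.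
Qed.

Let dens_mixin := isMeasure.Build _ _ _ dens dens0 dens_ge0 dens_semi_sigma_additive.

Definition dens_measure : {measure set T -> \bar R} := HB.pack dens dens_mixin.

Import HBNNSimple.

Let integral_dens_nnsfun (h : {nnsfun T >-> R}) :
  \int[dens_measure]_x (h x)%:E = \int[mu]_x ((f x)%:E * (h x)%:E).
Proof.
under [RHS]eq_integral => x _.
  rewrite fimfunE -fsumEFin// ge0_mule_fsumr; last first.
    by move=> r; rewrite EFinM nnfun_muleindic_ge0.
  over.
rewrite ge0_integral_fsum//; last 2 first.
- by move=> r; apply: emeasurable_funM => //; exact/measurable_EFinP/measurable_funM.
- by move=> r x _; apply: mule_ge0; rewrite ?lee_fin// -lee_fin EFinM nnfun_muleindic_ge0.
rewrite integralT_nnsfun sintegralE; apply: eq_fsbigr => r rh.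
have r0 : (0 <= r)%R by move: rh; rewrite inE => -[x _ <-].
transitivity (\int[mu]_x (r%:E * ((EFin \o f) \_ (h @^-1` [set r])) x)).
  rewrite ge0_integralZl//.
  - by rewrite -integral_mkcond.
  - by apply/(measurable_restrictT _ _).1 => //; exact: measurable_funTS.
  - by move=> x _; apply: erestrict_ge0 => ? _; rewrite lee_fin.
apply: eq_integral => x _.
rewrite patchE indicE; case: ifPn => _; last by rewrite mulr0 !mule0.
by rewrite mulr1 muleC.
Qed.

(** Proved on simple functions and extended by monotone convergence. *)
Lemma integral_dens (g : T -> \bar R) :
  measurable_fun setT g -> (forall x, 0 <= g x) ->
  \int[dens_measure]_x g x = \int[mu]_x ((f x)%:E * g x).
Proof.
move=> mg g0; pose g_ := nnsfun_approx measurableT mg.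
have gE x : g x = limn (EFin \o g_^~ x).
  by apply/esym/cvg_lim => //; apply: cvg_nnsfun_approx => // ? _; exact: g0.
transitivity (limn (fun n => \int[dens_measure]_x (g_ n x)%:E)).
  rewrite -monotone_convergence//.
  - by apply: eq_integral => x _; exact: gE.
  - by move=> n; exact/measurable_EFinP/measurable_funP.
  - by move=> n x _; rewrite lee_fin.
  - by move=> x _ m n mn; rewrite lee_fin; exact/lefP/nd_nnsfun_approx.
under eq_fun do rewrite integral_dens_nnsfun.
rewrite -monotone_convergence//.
- apply: eq_integral => x _; rewrite gE; apply/cvg_lim => //.
  apply: cvgeZl => //.
  rewrite -gE; apply: cvg_nnsfun_approx => // ? _; exact: g0.
- by move=> n; apply: emeasurable_funM => //; exact/measurable_EFinP/measurable_funP.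
- by move=> n x _; rewrite mule_ge0 ?lee_fin.
- move=> x _ m n mn; rewrite lee_wpmul2l ?lee_fin//.
  exact/lefP/nd_nnsfun_approx.
Qed.

End density.

(** * Invariance and powers of the independence kernel *)

Section independence_sampler.
Variables (R : realType) (d : nat) (ppi q : 'cV[R]_d -> R).
Hypotheses (mpi : measurable_fun setT ppi) (mq : measurable_fun setT q).
Hypotheses (pi0 : forall x, 0 < ppi x) (q0 : forall x, 0 < q x).
Hypothesis intpi : (\int[lebv R d]_x (ppi x)%:E = 1)%E.
Hypothesis intq : (\int[lebv R d]_x (q x)%:E = 1)%E.
Local Open Scope ereal_scope.
Local Notation V := 'cV[R]_d.
Local Notation mu := (lebv R d).

Definition acc (th th' : V) : R := (mh_accept ppi q th th' * q th')%R.

Lemma acc_ge0 th th' : (0 <= acc th th')%R.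
Proof.
rewrite mulr_ge0 ?(ltW (q0 _))// le_min ler01 andbT.
by rewrite divr_ge0 ?mulr_ge0 ?ltW ?mulr_gt0.
Qed.

Lemma acc_le th th' : (acc th th' <= q th')%R.
Proof. by rewrite ger_pMl// ge_min lexx orbT. Qed.

(** Detailed balance: both sides equal the minimum of [ppi th' * q th] and [ppi th * q th']. *)
Lemma acc_sym th th' : (ppi th * acc th th' = ppi th' * acc th' th)%R.
Proof.
have pq0 x y : (0 < ppi x * q y)%R by rewrite mulr_gt0.
have E x y : (ppi x * acc x y = Num.min (ppi y * q x) (ppi x * q y))%R.
  rewrite /acc /mh_accept mulrCA minr_pMl ?ltW// mul1r; congr Num.min.
  by rewrite divfK// gt_eqF.
by rewrite !E minC.
Qed.

Lemma measurable_acc : measurable_fun setT (fun z : V * V => acc z.1 z.2).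
Proof.
have m1 (f : V -> R) : measurable_fun setT f -> measurable_fun setT (fun z : V * V => f z.1).
  by move=> mf; exact: (measurableT_comp mf measurable_fst).
have m2 (f : V -> R) : measurable_fun setT f -> measurable_fun setT (fun z : V * V => f z.2).
  by move=> mf; exact: (measurableT_comp mf measurable_snd).
apply: measurable_funM; last exact: m2.
apply: measurable_minr => //; apply: measurable_funM.
  by apply: measurable_funM; [exact: m2|exact: m1].
(* The reciprocal of the positive product is written through [expR] and [ln], whose measurability is
   known. *)
rewrite (_ : (fun _ => _) = (fun z : V * V => expR (- ln (ppi z.1 * q z.2))%R)).
  do 2 apply: measurableT_comp => //; apply: measurableT_comp; first exact: measurable_ln.
  by apply: measurable_funM; [exact: m1|exact: m2].
by apply/funext => z; rewrite expRN lnK// posrE mulr_gt0.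
Qed.

Lemma measurable_acc2 th : measurable_fun setT (acc th).
Proof. exact: (measurableT_comp measurable_acc (pair1_measurable th)). Qed.

Definition accrate th : R := fine (\int[mu]_x (acc th x)%:E).

Lemma accrateE th : \int[mu]_x (acc th x)%:E = (accrate th)%:E.
Proof.
rewrite /accrate fineK// ge0_fin_numE ?integral_ge0//; last first.
  by move=> x _; rewrite lee_fin acc_ge0.
apply: (@le_lt_trans _ _ 1); last by rewrite ltry.
rewrite -intq; apply: ge0_le_integral => //.
- by move=> x _; rewrite lee_fin acc_ge0.
- by apply/measurable_EFinP; exact: measurable_acc2.
- exact/measurable_EFinP.
- by move=> x _; rewrite lee_fin acc_le.
Qed.

Lemma accrate_itv th : (0 <= accrate th <= 1)%R.
Proof.
apply/andP; split.
  by rewrite fine_ge0// integral_ge0// => x _; rewrite lee_fin acc_ge0.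
rewrite -lee_fin -accrateE -intq; apply: ge0_le_integral => //.
- by move=> x _; rewrite lee_fin acc_ge0.
- by apply/measurable_EFinP; exact: measurable_acc2.
- exact/measurable_EFinP.
- by move=> x _; rewrite lee_fin acc_le.
Qed.

Let rejrate_ge0 th : (0 <= 1 - accrate th)%R.
Proof. by rewrite subr_ge0; case/andP: (accrate_itv th). Qed.

Definition rejrate th : {nonneg R} := NngNum (rejrate_ge0 th).

(** The accepted moves have density [acc th]; the rejected ones form an atom of mass
    [1 - accrate th]. Bundling both lets integrals against the kernel split. *)
Definition mh_measure th : {measure set V -> \bar R} :=
  measure_add (dens_measure mu (measurable_acc2 th) (acc_ge0 th))
    (mscale (rejrate th) (\d_th)).

Lemma mhi_kernelE th : mhi_kernel ppi q th = mh_measure th.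
Proof.
apply/funext => B; rewrite /mhi_kernel lebvE accrateE.
transitivity (dens mu (acc th) B + (1 - accrate th)%:E * \d_th B); last first.
  exact/esym/measure_addE.
by rewrite muleC -EFinB.
Qed.

Lemma integral_mhi_kernel th (g : V -> \bar R) :
  measurable_fun setT g -> (forall x, 0 <= g x) ->
  \int[mhi_kernel ppi q th]_x g x =
  \int[mu]_x ((acc th x)%:E * g x) + (1 - accrate th)%:E * g th.
Proof.
move=> mg g0; rewrite mhi_kernelE ge0_integral_measure_add//; congr (_ + _).
  exact: integral_dens.
by rewrite ge0_integral_mscale// integral_dirac// diracT mul1e.
Qed.

Lemma measurable_accrate : measurable_fun setT accrate.
Proof.
apply/measurable_EFinP; rewrite (_ : EFin \o accrate = fubini_F mu (fun z : V * V => (acc z.1 z.2)%:E)).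
  apply: measurable_fun_fubini_tonelli_F => /=.
    by apply/measurable_EFinP; exact: measurable_acc.
  by move=> z; rewrite lee_fin acc_ge0.
by apply/funext => x; rewrite /fubini_F/= accrateE.
Qed.

Lemma measurable_integral_mhi (g : V -> \bar R) :
  measurable_fun setT g -> (forall x, 0 <= g x) ->
  measurable_fun setT (fun th => \int[mhi_kernel ppi q th]_x g x).
Proof.
move=> mg g0; under eq_fun do rewrite integral_mhi_kernel//.
apply: emeasurable_funD; last first.
  apply: emeasurable_funM => //; apply/measurable_EFinP; apply: measurable_funB => //.
  exact: measurable_accrate.
apply: (@measurable_fun_fubini_tonelli_F _ _ _ _ _ mu
  (fun z : V * V => (acc z.1 z.2)%:E * g z.2)).
  apply: emeasurable_funM; first by apply/measurable_EFinP; exact: measurable_acc.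
  exact: (measurableT_comp mg measurable_snd).
by move=> z; rewrite mule_ge0// lee_fin acc_ge0.
Qed.

(** Invariance in its functional form, which iterates directly. Tonelli and detailed balance turn
    the accepted part into the weight [accrate x], the rejected part carries [1 - accrate x], and
    the two add up to one. *)
Lemma mhi_invariant (g : V -> \bar R) :
  measurable_fun setT g -> (forall x, 0 <= g x) ->
  \int[mu]_th ((ppi th)%:E * \int[mhi_kernel ppi q th]_x g x) =
  \int[mu]_x ((ppi x)%:E * g x).
Proof.
move=> mg g0.
have mpiE : measurable_fun setT (EFin \o ppi) by exact/measurable_EFinP.
have mF : measurable_fun setT (fun z : V * V => (ppi z.1 * acc z.1 z.2)%:E * g z.2).
  apply: emeasurable_funM; last exact: (measurableT_comp mg measurable_snd).
  apply/measurable_EFinP/measurable_funM; last exact: measurable_acc.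
  exact: (measurableT_comp mpi measurable_fst).
have F0 z : 0 <= (ppi z.1 * acc z.1 z.2)%:E * g z.2.
  by rewrite mule_ge0// lee_fin mulr_ge0 ?acc_ge0 ?ltW.
have mA : measurable_fun setT (fun x => (ppi x * accrate x)%:E * g x).
  apply: emeasurable_funM => //; apply/measurable_EFinP/measurable_funM => //.
  exact: measurable_accrate.
have mA' : measurable_fun setT (fun x => (ppi x * (1 - accrate x))%:E * g x).
  apply: emeasurable_funM => //; apply/measurable_EFinP/measurable_funM => //.
  by apply: measurable_funB => //; exact: measurable_accrate.
have piA0 x : (0 <= ppi x * accrate x)%R.
  by rewrite mulr_ge0 ?(ltW (pi0 _))//; case/andP: (accrate_itv x).
have piA0' x : (0 <= ppi x * (1 - accrate x))%R by rewrite mulr_ge0 ?(ltW (pi0 _)) ?rejrate_ge0.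
under eq_integral => th _.
  rewrite integral_mhi_kernel// ge0_muleDr; last 2 first.
  - by apply: integral_ge0 => x _; rewrite mule_ge0// lee_fin acc_ge0.
  - by rewrite mule_ge0// lee_fin.
  rewrite muleA -EFinM -ge0_integralZl//; last 3 first.
  - by apply: emeasurable_funM => //; apply/measurable_EFinP; exact: measurable_acc2.
  - by move=> x _; rewrite mule_ge0// lee_fin acc_ge0.
  - by rewrite lee_fin ltW.
  under eq_integral do rewrite muleA -EFinM.
  over.
have intF0 x : setT x -> 0 <= \int[mu]_y ((ppi x * acc x y)%:E * g y).
  by move=> _; apply: integral_ge0 => y _; exact: (F0 (x, y)).
have mintF : measurable_fun setT (fun x => \int[mu]_y ((ppi x * acc x y)%:E * g y)).
  exact: (measurable_fun_fubini_tonelli_F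
    (fun z : V * V => (ppi z.1 * acc z.1 z.2)%:E * g z.2)).
have piAg0 x : setT x -> 0 <= (ppi x * accrate x)%:E * g x.
  by move=> _; rewrite mule_ge0// lee_fin.
have piAg0' x : setT x -> 0 <= (ppi x * (1 - accrate x))%:E * g x.
  by move=> _; rewrite mule_ge0// lee_fin.
rewrite ge0_integralD//.
rewrite -[X in X + _]/(\int[mu]_x fubini_F mu (fun z : V * V => (ppi z.1 * acc z.1 z.2)%:E * g z.2) x).
rewrite (fubini_tonelli (fun z : V * V => (ppi z.1 * acc z.1 z.2)%:E * g z.2))//.
rewrite /fubini_G/=.
(* After the exchange of integrals, detailed balance moves the density to the outer variable [y],
   and the inner integral is the acceptance rate there. *)
under eq_integral => y _.
  under eq_integral do rewrite acc_sym mulrC EFinM -muleA.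
  rewrite ge0_integralZr//; last 3 first.
  - by apply/measurable_EFinP; exact: measurable_acc2.
  - by move=> x _; rewrite lee_fin acc_ge0.
  - by rewrite mule_ge0// lee_fin ltW.
  rewrite accrateE muleA -EFinM mulrC.
  over.
rewrite -ge0_integralD//.
apply: eq_integral => x _; rewrite -ge0_muleDl ?lee_fin// -EFinD -mulrDr.
by rewrite addrC subrK mulr1.
Qed.

Section at_mode.
Variables (b : V) (B : set V).
Hypotheses (bP : forall x, (q b / ppi b * ppi x <= q x)%R) (mB : measurable B).
Let eps := (q b / ppi b)%R.

(** By [bP] the acceptance ratio from [b] never exceeds one, so the minimum is the ratio itself and
    the factor [q x] cancels. *)
Let accb x : acc b x = (eps * ppi x)%R.
Proof.
rewrite /acc /mh_accept (min_idPl _); last first.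
  rewrite ler_pdivrMr ?mulr_gt0// mul1r -ler_pdivrMl//.
  by rewrite mulrC [(ppi x * _)%R]mulrC mulrAC.
by rewrite /eps; field; rewrite !gt_eqF.
Qed.

Let accrateb : accrate b = eps.
Proof.
rewrite /accrate; under eq_integral do rewrite accb EFinM.
rewrite ge0_integralZl//; last 3 first.
- exact/measurable_EFinP.
- by move=> x _; rewrite lee_fin ltW.
- by rewrite lee_fin divr_ge0 ?ltW.
by rewrite intpi mule1.
Qed.

Lemma mode_ratio_itv : (0 < eps <= 1)%R.
Proof. by rewrite divr_gt0//= -accrateb; case/andP: (accrate_itv b). Qed.

(** The iterates of the kernel on the indicator of [B], with [t = 0] included; [kernel_pow] starts
    at one iterate, hence the shifted index in [kernel_powE]. *)
Let Q t := iter t (fun (Q : V -> \bar R) th => \int[mhi_kernel ppi q th]_x Q x)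
  (fun x => (\1_B x)%:E).

Let Q_ge0 t x : 0 <= Q t x.
Proof.
case: t => [|t] /=; first by rewrite lee_fin.
by rewrite mhi_kernelE; apply: integral_ge0 => y _;
  elim: t y => [|t IH] y /=; [rewrite lee_fin|rewrite mhi_kernelE integral_ge0].
Qed.

Let mQ t : measurable_fun setT (Q t).
Proof.
elim: t => [|t IH]/=; first exact/measurable_EFinP/measurable_indic.
exact: measurable_integral_mhi.
Qed.

Let kernel_powE t th : kernel_pow (mhi_kernel ppi q) t.+1 th B = Q t.+1 th.
Proof.
rewrite /kernel_pow; elim: t th => [|t IH] th /=.
  by rewrite mhi_kernelE integral_indic// setIT.
by congr (integral _ _ _); apply/funext => x; exact: IH.
Qed.

(** A chain started from the target keeps it as its law at every time. *)
Let piQ t : \int[mu]_x ((ppi x)%:E * Q t x) = dens mu ppi B.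
Proof.
elim: t => [|t IH]/=; last by rewrite mhi_invariant.
rewrite /dens [RHS]integral_mkcond; apply: eq_integral => x _.
by rewrite patchE indicE; case: ifPn; rewrite ?mule1 ?mule0.
Qed.

(** Conditioning on the first step: with probability [eps] the chain moves to an exact draw from the
    target and is stationary from then on, otherwise it is still at [b]. The resulting affine
    recurrence [Qb] is solved by induction. *)
Lemma kernel_pow_mode t : (0 < t)%N ->
  kernel_pow (mhi_kernel ppi q) t b B =
  (1 - (1 - eps) ^+ t)%:E * dens mu ppi B + ((1 - eps) ^+ t)%:E * \d_b B.
Proof.
case: t => // t _; rewrite kernel_powE.
have eps01 := mode_ratio_itv.
have pB : dens mu ppi B \is a fin_num.
  rewrite ge0_fin_numE ?integral_ge0//; last by move=> x _; rewrite lee_fin ltW.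
  apply: (@le_lt_trans _ _ 1); last by rewrite ltry.
  rewrite -intpi; apply: ge0_subset_integral => //; first exact/measurable_EFinP.
  by move=> x _; rewrite lee_fin ltW.
suff H : Q t.+1 b = ((1 - (1 - eps) ^+ t.+1) * fine (dens mu ppi B) +
   (1 - eps) ^+ t.+1 * \1_B b)%:E.
  by rewrite H EFinD !EFinM fineK.
have Qb u : Q u.+1 b = (eps * fine (dens mu ppi B))%:E + (1 - eps)%:E * Q u b.
  rewrite /= integral_mhi_kernel// accrateb; congr (_ + _).
  under eq_integral do rewrite accb EFinM -muleA.
  rewrite ge0_integralZl//; last 3 first.
  - by apply: emeasurable_funM => //; exact/measurable_EFinP.
  - by move=> x _; rewrite mule_ge0// lee_fin ltW.
  - by rewrite lee_fin ltW; case/andP: eps01.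
  by rewrite piQ [RHS]EFinM fineK.
elim: t => [|t IH]; rewrite Qb; first by rewrite -EFinM -EFinD; congr EFin; rewrite /=; ring.
by rewrite IH -EFinM -EFinD; congr EFin; rewrite !exprS; ring.
Qed.

End at_mode.

End independence_sampler.

(** * A coupling for mixtures of the target and an atom *)

Section coupling_with_mode.
Variables (R : realType) (d : nat) (Pi : {measure set 'cV[R]_d -> \bar R}).
Hypothesis PiT : (Pi setT = 1)%E.
Variables (b : 'cV[R]_d) (p : R).
Hypothesis p01 : 0 <= p <= 1.
Variable rho : 'cV[R]_d -> 'cV[R]_d -> R.
Hypothesis lrho : lsc_metric rho.
Local Notation V := 'cV[R]_d.
Local Open Scope ereal_scope.

Let p0 : (0 <= p)%R. Proof. by case/andP: p01. Qed.
Let q0 : (0 <= 1 - p)%R. Proof. by rewrite subr_ge0; case/andP: p01. Qed.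

Let diag (x : V) : V * V := (x, x).
Let withb (x : V) : V * V := (b, x).

Let mdiag : measurable_fun setT diag.
Proof. by apply: measurable_fun_pair; exact: measurable_id. Qed.

Let mwithb : measurable_fun setT withb.
Proof. by apply: measurable_fun_pair; [exact: measurable_cst|exact: measurable_id]. Qed.

Let push_diag : {measure set (V * V)%type -> \bar R} :=
  measure_function_pushforward__canonical__measure_function_Measure Pi mdiag.

Let push_withb : {measure set (V * V)%type -> \bar R} :=
  measure_function_pushforward__canonical__measure_function_Measure Pi mwithb.

(** With weight [p] both coordinates are the same draw from [Pi]; with weight [1 - p] the first one
    is [b] and the second a draw from [Pi]. The second marginal is [Pi] in either case, and only the
    second case costs anything. *)
Let xi0 : {measure set (V * V)%type -> \bar R} :=
  measure_add (mscale (NngNum p0) push_diag) (mscale (NngNum q0) push_withb).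

Let xi0E A : xi0 A = p%:E * Pi (diag @^-1` A) + (1 - p)%:E * Pi (withb @^-1` A).
Proof. exact: measure_addE. Qed.

Let xi0T : xi0 setT = 1.
Proof. by rewrite xi0E !preimage_setT PiT !mule1 -EFinD addrC subrK. Qed.

Let xi_mixin := Measure_isProbability.Build _ _ _ xi0 xi0T.
Let xi : probability (V * V)%type R := HB.pack (xi0 : set _ -> \bar R) xi0 xi_mixin.

Lemma wasserstein_mode_mixture (mu : set V -> \bar R) :
  (forall A, measurable A -> mu A = p%:E * Pi A + (1 - p)%:E * \d_b A) ->
  wasserstein rho mu Pi <= (1 - p)%:E * \int[Pi]_x (rho x b)%:E.
Proof.
move=> muE; apply: ereal_inf_lbound => /=; exists xi.
  move=> A mA; rewrite muE//; split; rewrite [LHS]xi0E.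
    congr (_ * Pi _ + _ * _); first by apply/seteqP; split => x //= [].
    rewrite /dirac indicE; have [bA|bA] := boolP (b \in A).
      rewrite (_ : _ @^-1` _ = setT)//; apply/seteqP; split => x //= _.
      by split => //; rewrite -in_setE.
    rewrite (_ : _ @^-1` _ = set0) ?measure0//; apply/seteqP; split => x //= -[].
    by rewrite /= -in_setE (negbTE bA).
  rewrite (_ : diag @^-1` _ = A); last by apply/seteqP; split => x //= [].
  rewrite (_ : withb @^-1` _ = A); last by apply/seteqP; split => x //= [].
  by rewrite -ge0_muleDl ?lee_fin// -EFinD addrC subrK mul1e.
have mrho := measurable_lsc_metric lrho.
have [[rho0 rhoxx rhoC _] _] := lrho.
have rho0E z : setT z -> 0 <= (rho z.1 z.2)%:E by move=> _; rewrite lee_fin.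
rewrite [LHS]ge0_integral_measure_add// !ge0_integral_mscale//.
rewrite [X in _ * X + _]ge0_integral_pushforward//; last by move=> z _; exact: rho0E.
rewrite [X in _ + _ * X]ge0_integral_pushforward//; last by move=> z _; exact: rho0E.
rewrite !preimage_setT /=.
under eq_integral do rewrite (rhoxx _ _).2//.
rewrite integral0 mule0 add0e; congr (_ * _).
by apply: eq_integral => x _; rewrite rhoC.
Qed.

End coupling_with_mode.

Section wasserstein_sampler.
Variables (R : realType) (d : nat) (ppi q : 'cV[R]_d -> R).
Hypotheses (mpi : measurable_fun setT ppi) (mq : measurable_fun setT q).
Hypotheses (pi0 : forall x, 0 < ppi x) (q0 : forall x, 0 < q x).
Hypothesis intpi : (\int[lebv R d]_x (ppi x)%:E = 1)%E.
Hypothesis intq : (\int[lebv R d]_x (q x)%:E = 1)%E.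
Variable b : 'cV[R]_d.
Hypothesis bP : forall x, q b / ppi b * ppi x <= q x.
Variable rho : 'cV[R]_d -> 'cV[R]_d -> R.
Hypothesis lrho : lsc_metric rho.

Lemma wasserstein_kernel_pow_mode t : (0 < t)%N ->
  (wasserstein rho (kernel_pow (mhi_kernel ppi q) t b) (dens (lebv R d) ppi) <=
   ((1 - q b / ppi b) ^+ t)%:E * \int[dens (lebv R d) ppi]_x (rho x b)%:E)%E.
Proof.
move=> t0; set eps := q b / ppi b.
have /andP[e0 e1] : 0 < eps <= 1 by exact: mode_ratio_itv.
have r01 : 0 <= 1 - (1 - eps) ^+ t <= 1.
  have : 0 <= (1 - eps) ^+ t <= 1.
    by rewrite exprn_ge0 ?exprn_ile1// ?subr_ge0// lerBlDr lerDl ltW.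
  by move=> /andP[]; lra.
have piT : (dens_measure (lebv R d) mpi (fun x => ltW (pi0 x)) setT = 1)%E by [].
have := wasserstein_mode_mixture piT r01 lrho (b := b)
  (mu := kernel_pow (mhi_kernel ppi q) t b).
rewrite subKr; apply=> A mA.
by rewrite kernel_pow_mode// subKr.
Qed.

End wasserstein_sampler.

(** * Second-order calculus on R^d *)

Lemma cvg_sumR (R : realType) (T : Type) (F : set_system T) {FF : Filter F}
    (I : Type) (r : seq I) (f : I -> T -> R) (l : I -> R) :
  (forall i, f i x @[x --> F] --> l i) ->
  \sum_(i <- r) f i x @[x --> F] --> \sum_(i <- r) l i.
Proof.
move=> fl; elim: r => [|i r IH].
  by rewrite big_nil; under eq_fun do rewrite big_nil; exact: cvg_cst.
by rewrite big_cons; under eq_fun do rewrite big_cons; exact: cvgD.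
Qed.

Lemma continuous_sumR (R : realType) (T : topologicalType)
    (I : Type) (r : seq I) (f : I -> T -> R) :
  (forall i, continuous (f i)) -> continuous (fun x => \sum_(i <- r) f i x).
Proof. by move=> cf x; apply: cvg_sumR => i; exact: cf. Qed.

Section directional_derivatives.
Variables (R : realType) (d : nat).
Local Notation V := 'cV[R]_d.
Implicit Types (f a b : V -> R) (u v w x : V).

(** A relation naming the limit of the difference quotient. Smoothness is assumed through partial
    derivatives along the axes, so derivatives in other directions have to be built from these. *)
Definition dirder f x v (l : R) :=
  h^-1 * (f (x + h *: v) - f x) @[h --> (0:R)^'] --> l.

Lemma dirder_is_derive f x v t l :
  dirder f (x + t *: v) v l -> is_derive t (1:R) (fun s => f (x + s *: v)) l.
Proof.
move=> fl.
have E : (fun h : R => h^-1 *: (((fun s => f (x + s *: v)) \o shift t) (h *: 1) -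
   f (x + t *: v))) = (fun h => h^-1 * (f (x + t *: v + h *: v) - f (x + t *: v))).
  apply/funext => h /=; rewrite [h *: 1]mulr1 [in LHS]scalerDl.
  by rewrite addrA addrAC.
split; first by rewrite /derivable E; apply/cvg_ex; exists l.
by rewrite /derive E; exact: cvg_lim.
Qed.

Lemma is_derive_dirder f x v l :
  is_derive (0:R) (1:R) (fun s => f (x + s *: v)) l -> dirder f x v l.
Proof.
move=> [dvf <-]; rewrite /dirder /derive.
have E : (fun h : R => h^-1 *: (((fun s => f (x + s *: v)) \o shift 0) (h *: 1) -
   f (x + 0 *: v))) = (fun h => h^-1 * (f (x + h *: v) - f x)).
  by apply/funext => h /=; rewrite [h *: 1]mulr1 addr0 scale0r addr0.
by move: dvf; rewrite /derivable -E.
Qed.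

Lemma derivable_dirder f x v : derivable f x v -> dirder f x v ('D_v f x).
Proof.
rewrite /dirder /derive /derivable.
have -> : (fun h : R => h^-1 *: ((f \o shift x) (h *: v) - f x)) =
   (fun h => h^-1 * (f (x + h *: v) - f x)).
  by apply/funext => h; rewrite /= [h *: v + x]addrC.
by [].
Qed.

Lemma dirderZ f x v (k l : R) : dirder f x v l -> dirder f x (k *: v) (k * l).
Proof.
move=> fl; apply: is_derive_dirder.
have -> : (fun s : R => f (x + s *: (k *: v))) = (fun s => f (x + s *: v)) \o (fun s => k * s).
  by apply/funext => s /=; rewrite scalerA mulrC.
rewrite [k * l]mulrC; apply: is_derive1_comp.
  by apply: dirder_is_derive; rewrite mulr0 scale0r addr0.
rewrite -[X in is_derive _ _ _ X](mulr1 k).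
exact: is_deriveZ.
Qed.

(** The mean value theorem for [h] of either sign and for [h = 0], with [|c| <= |h|] in place of an
    open interval, so that a point [c] can be chosen for every [h] at once. *)
Lemma line_MVT f v (l : V -> R) : (forall x, dirder f x v (l x)) ->
  forall x h, exists c, `|c| <= `|h| /\ f (x + h *: v) - f x = h * l (x + c *: v).
Proof.
move=> fl x h; pose g (s : R) := f (x + s *: v).
have dg t : is_derive t (1:R) g (l (x + t *: v)) by exact: dirder_is_derive.
have cg t : {for t, continuous g}.
  by apply: differentiable_continuous; apply/derivable1_diffP; exact: ex_derive.
have wg (A : set R) : {within A, continuous g}.
  by apply: continuous_subspaceT => t; exact: cg.
have [h0|h0|->] := ltgtP h 0; last first.
- by exists 0; rewrite normr0 lexx mul0r scale0r addr0 subrr.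
- have [c] := MVT h0 (fun t _ => dg t) (wg _).
  rewrite in_itv/= => /andP[c0 ch]; rewrite subr0 /g scale0r addr0 mulrC => E.
  by exists c; split=> //; rewrite !gtr0_norm// ltW.
- have [c] := MVT h0 (fun t _ => dg t) (wg _).
  rewrite in_itv/= => /andP[hc c0]; rewrite sub0r /g scale0r addr0 => E.
  exists c; split; first by rewrite !ltr0_norm// lerN2 ltW.
  by apply: oppr_inj; rewrite opprB E mulrN mulrC.
Qed.

Lemma cvg_near_line x u w (c e : R -> R) :
  (forall h, `|c h| <= `|h|) -> (forall h, `|e h| <= `|h|) ->
  x + c h *: u + e h *: w @[h --> (0:R)^'] --> x.
Proof.
have to0 (k : R -> R) : (forall h, `|k h| <= `|h|) -> k h @[h --> (0:R)^'] --> (0:R).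
  move=> kh; apply/cvgrPdist_le => r r0; near=> h; rewrite sub0r normrN.
  by apply: (le_trans (kh h)); near: h; exact: dnbhs0_le.
move=> /to0 c0 /to0 e0.
have : x + c h *: u + e h *: w @[h --> (0:R)^'] --> x + 0 *: u + 0 *: w.
  apply: cvgD; last exact: cvgZr_tmp.
  by apply: cvgD; [exact: cvg_cst|exact: cvgZr_tmp].
by rewrite !scale0r !addr0.
Unshelve. all: by end_near. Qed.

(** The increment passes through [x + h *: u]. Its second leg is [h] times [b] at a point tending to
    [x], which is where continuity of [b] enters. *)
Lemma dirderD f u w a b :
  (forall x, dirder f x u (a x)) -> (forall x, dirder f x w (b x)) ->
  continuous b -> forall x, dirder f x (u + w) (a x + b x).
Proof.
move=> fu fw cb x; rewrite /dirder.
have /choice[c cP] : forall h, exists c, `|c| <= `|h| /\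
    f (x + h *: u + h *: w) - f (x + h *: u) = h * b (x + h *: u + c *: w).
  by move=> h; exact: line_MVT.
have cb0 : b (x + h *: u + c h *: w) @[h --> (0:R)^'] --> b x.
  apply: (@cvg_comp _ _ _ (fun h => x + h *: u + c h *: w) b _ (nbhs x)); last exact: cb.
  by apply: (@cvg_near_line x u w id c) => // h; exact: (cP h).1.
apply: cvg_trans (cvgD (fu x) cb0); apply: near_eq_cvg; near=> h.
have h0 : h != 0 by near: h; exact: nbhs_dnbhs_neq.
change (h^-1 * (f (x + h *: u) - f x) + b (x + h *: u + c h *: w) =
  h^-1 * (f (x + h *: (u + w)) - f x)).
rewrite -[b _](mulKf h0) -(cP h).2 -mulrDr scalerDr.
by congr (_ * _); rewrite [x + (_ + _)]addrA; ring.
Unshelve. all: by end_near. Qed.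

Lemma dirder_sum (I : Type) (r : seq I) f (u : I -> V) (a : I -> V -> R) :
  (forall i x, dirder f x (u i) (a i x)) -> (forall i, continuous (a i)) ->
  forall x, dirder f x (\sum_(i <- r) u i) (\sum_(i <- r) a i x).
Proof.
move=> fu ca; elim: r => [|i r IH] x.
  rewrite !big_nil /dirder; under eq_fun do rewrite scaler0 addr0 subrr mulr0.
  exact: cvg_cst.
rewrite !big_cons addrC [X in dirder _ _ _ X]addrC.
exact: (dirderD IH (fu i) (ca i)).
Qed.

Lemma col_sum_delta (v : V) : v = \sum_i v i 0 *: delta_mx i 0.
Proof.
rewrite [LHS]matrix_sum_delta; apply: eq_bigr => i _.
by rewrite big_ord1.
Qed.

Lemma dirder_partial f v : (forall i x, derivable f x (delta_mx i 0)) ->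
  (forall i, continuous (partial i f)) ->
  forall x, dirder f x v (\sum_i v i 0 * partial i f x).
Proof.
move=> df cf x; rewrite {1}(col_sum_delta v).
apply: (@dirder_sum _ _ f (fun i => v i 0 *: delta_mx i 0) (fun i x => v i 0 * partial i f x)).
  by move=> i y; apply: dirderZ; exact: derivable_dirder.
by move=> i y; apply: continuousM; [exact: cst_continuous|exact: cf].
Qed.

(* Both iterated derivatives are limits of the same second difference. *)
Lemma second_dirder_sym f u w a b (a' b' : V -> R) :
  (forall x, dirder f x u (a x)) -> (forall x, dirder f x w (b x)) ->
  (forall x, dirder a x w (a' x)) -> (forall x, dirder b x u (b' x)) ->
  continuous a' -> continuous b' -> a' =1 b'.
Proof.
move=> fu fw aw bu ca' cb' x.
(* The mean value theorem in each direction turns the second difference into [h * h] times an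
   iterated derivative at a point tending to [x]. *)
have half (u1 w1 : V) (a1 a1' : V -> R) : (forall x, dirder f x u1 (a1 x)) ->
    (forall x, dirder a1 x w1 (a1' x)) -> forall h, exists c : R * R,
    [/\ `|c.1| <= `|h|, `|c.2| <= `|h| &
    (f (x + h *: w1 + h *: u1) - f (x + h *: w1)) - (f (x + h *: u1) - f x) =
    h * (h * a1' (x + c.1 *: u1 + c.2 *: w1))].
  move=> fu1 aw1 h.
  have phi y : dirder (fun z => f (z + h *: w1) - f z) y u1 (a1 (y + h *: w1) - a1 y).
    rewrite /dirder.
    have -> : (fun k : R => k^-1 * (f (y + k *: u1 + h *: w1) - f (y + k *: u1) -
       (f (y + h *: w1) - f y))) =
      (fun k : R => k^-1 * (f (y + h *: w1 + k *: u1) - f (y + h *: w1)) -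
         k^-1 * (f (y + k *: u1) - f y)).
      by apply/funext => k; rewrite [y + k *: u1 + h *: w1]addrAC; ring.
    by apply: cvgB; exact: fu1.
  have [c [ch E]] := line_MVT phi x h.
  have [c2 [c2h E2]] := line_MVT aw1 (x + c *: u1) h.
  exists (c, c2); split=> //=; rewrite -E2 -E.
  by rewrite [x + h *: u1 + h *: w1]addrAC; ring.
have /choice[c cP] := half u w a a' fu aw.
have /choice[e eP] := half w u b b' fw bu.
have lim1 : a' (x + (c h).1 *: u + (c h).2 *: w) @[h --> (0:R)^'] --> a' x.
  apply: (@cvg_comp _ _ _ (fun h => x + (c h).1 *: u + (c h).2 *: w) a' _ (nbhs x)); last exact: ca'.
  by apply: (@cvg_near_line x u w (fun h => (c h).1) (fun h => (c h).2)) => h; have [] := cP h.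
have lim2 : b' (x + (e h).1 *: w + (e h).2 *: u) @[h --> (0:R)^'] --> b' x.
  apply: (@cvg_comp _ _ _ (fun h => x + (e h).1 *: w + (e h).2 *: u) b' _ (nbhs x)); last exact: cb'.
  by apply: (@cvg_near_line x w u (fun h => (e h).1) (fun h => (e h).2)) => h; have [] := eP h.
suff lim3 : a' (x + (c h).1 *: u + (c h).2 *: w) @[h --> (0:R)^'] --> b' x.
  exact: (cvg_unique _ lim1 lim3).
apply: cvg_trans lim2; apply: near_eq_cvg; near=> h.
have h0 : h != 0 by near: h; exact: nbhs_dnbhs_neq.
have [_ _ E1] := cP h; have [_ _ E2] := eP h.
apply: (mulfI h0); apply: (mulfI h0); rewrite -E1 -E2.
by rewrite [x + h *: w + h *: u]addrAC; ring.
Unshelve. all: by end_near. Qed.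


(** The mean value theorem applied to [f] minus its quadratic majorant on the segment; a second
    application, to [l], shows that the derivative of this difference is nonpositive. *)
Lemma line_taylor_le f v (l : V -> R) (m : V -> R) (K : R) x :
  (forall x, dirder f x v (l x)) -> (forall x, dirder l x v (m x)) ->
  (forall x, m x <= K) -> f (x + v) <= f x + l x + K / 2.
Proof.
move=> fl lm mK.
pose h (s : R) := f (x + s *: v) - (l x * s + K / 2 * s ^+ 2).
pose dh (s : R) := l (x + s *: v) - (l x + K * s).
have dhP s : is_derive s (1:R) h (dh s).
  apply: is_deriveB; first exact: dirder_is_derive.
  apply: is_derive_eq; rewrite /GRing.scale/=.
  by field.
have ch (A : set R) : {within A, continuous h}.
  apply: continuous_subspaceT => t; have [dht _] := dhP t.
  by apply: differentiable_continuous; apply/derivable1_diffP.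
have [c] := MVT ltr01 (fun t _ => dhP t) (ch _).
rewrite in_itv/= subr0 mulr1 => /andP[c0 c1].
have : dh c <= 0.
  rewrite /dh; have [e [ec]] := line_MVT lm x c.
  by rewrite opprD addrA => ->; rewrite subr_le0 mulrC ler_pM2r.
rewrite /h !scale1r scale0r addr0 expr1n expr0n/= !mulr0 !addr0 subr0 !mulr1.
by move=> + E; rewrite -E; lra.
Qed.

End directional_derivatives.

(** * Rayleigh quotients and the Hessian bound *)

Section hessian_bound.
Variables (R : realType) (d : nat).
Local Notation V := 'cV[R]_d.

Lemma quadform_bilin (A : 'M[R]_d) (u v : V) : A^T = A ->
  quadform A (u + v) = quadform A u + 2 * dotv (A *m u) v + quadform A v.
Proof.
move=> sA; rewrite /quadform /dotv.
have -> : (u + v)^T = u^T + v^T by rewrite linearD.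
rewrite !mulmxDl !mulmxDr.
have E (M N : 'M[R]_1) : (M + N) 0 0 = M 0 0 + N 0 0 by rewrite mxE.
have -> : (A *m u)^T *m v = u^T *m A *m v by rewrite trmx_mul sA.
have vu : (v^T *m A *m u) 0 0 = (u^T *m A *m v) 0 0.
  by rewrite -[LHS]trace_mx11 -mxtrace_tr !trmx_mul trmxK sA mulmxA trace_mx11.
by rewrite !E vu; ring.
Qed.

Lemma quadform_scale (A : 'M[R]_d) c (v : V) : quadform A (c *: v) = c ^+ 2 * quadform A v.
Proof.
have cv : (c *: v)^T = c *: v^T by rewrite linearZ.
by rewrite /quadform cv -!scalemxAl -scalemxAr !mxE mulrA expr2.
Qed.

Lemma dotvZr c (u v : V) : dotv u (c *: v) = c * dotv u v.
Proof. by rewrite /dotv -scalemxAr mxE. Qed.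

Lemma dotvZl c (u v : V) : dotv (c *: u) v = c * dotv u v.
Proof. by rewrite /dotv linearZ/= -scalemxAl mxE. Qed.

Lemma sphere_max (A : 'M[R]_d) : (0 < d)%N ->
  exists2 v : V, dotv v v = 1 & forall u : V, dotv u u = 1 -> quadform A u <= quadform A v.
Proof.
(* The sphere lives in row vectors so that [bounded_closed_compact] applies. *)
move=> d0; pose S : set 'rV[R]_d := [set x | dotv x^T x^T = 1].
have cT (f : V -> R) : continuous f -> continuous (fun x : 'rV[R]_d => f x^T).
  move=> cf x; apply: continuous_comp; last exact: cf.
  apply: (@continuous_mx _ _ _ _ (fun x : 'rV[R]_d => x^T)) => i j.
  by under eq_fun do rewrite mxE; exact: coord_continuous.
have cq (B : 'M[R]_d) : continuous (fun v : V => quadform B v).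
  have -> : (fun v : V => quadform B v) =
      (fun v => \sum_j (\sum_i v i 0 * B i j) * v j 0).
    apply/funext => v; rewrite /quadform mxE; apply: eq_bigr => j _.
    by rewrite mxE; congr (_ * _); apply: eq_bigr => i _; rewrite mxE.
  apply: continuous_sumR => j v; apply: continuousM; last exact: coord_continuous.
  move: v; apply: continuous_sumR => i v.
  by apply: continuousM; [exact: coord_continuous|exact: cst_continuous].
have S0 : S !=set0.
  exists (delta_mx 0 (Ordinal d0)); rewrite /S/= dotvE (bigD1 (Ordinal d0))//= big1.
    by rewrite addr0 !mxE !eqxx mulr1.
  by move=> i i0; rewrite !mxE (negbTE i0) andbF mul0r.
have cS : compact S.
  apply: bounded_closed_compact.
    exists 1; split=> // M M1 x /= xS.
    rewrite /Num.norm/= mx_normrE; apply: bigmax_le => [|[i j] _ /=]; first by apply: ltW; apply: lt_trans M1.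
    apply: ltW; apply: le_lt_trans M1; rewrite ord1 -(ler_pXn2r (n := 2)) ?nnegrE//.
    rewrite expr1n -xS dotvE (bigD1 j)//= !mxE -expr2 real_normK ?num_real// lerDl.
    by apply: sumr_ge0 => k _; rewrite -expr2 sqr_ge0.
  have -> : S = (fun x : 'rV[R]_d => quadform 1%:M x^T) @^-1` [set 1].
    by apply/seteqP; split=> x; rewrite /S/= quadform1.
  apply: preimage_closed; last exact: closed_eq.
  by move=> y _; apply: cT; exact: cq.
have cA : {within S, continuous (fun x : 'rV[R]_d => quadform A x^T)}.
  by apply: continuous_subspaceT; apply: cT; exact: cq.
have [c cS1 cmax] := compact_EVT_max S0 cS cA.
exists c^T; first by move: cS1; rewrite inE.
move=> u u1; have := cmax u^T; rewrite trmxK; apply.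
by rewrite inE /S/= trmxK.
Qed.

(** Since [lambda_max] is a supremum of eigenvalues, the maximum of the Rayleigh quotient must be
    shown to be one of them: a maximizer [u] on the sphere is an eigenvector, by a first-order
    variation. *)
Lemma quadform_le_lambda_max (A : 'M[R]_d) (v : V) : A^T = A ->
  quadform A v <= lambda_max A * dotv v v.
Proof.
move=> sA; have [->|v0] := eqVneq v 0.
  by rewrite /quadform /dotv !mulmx0 mxE mulr0.
have d0 : (0 < d)%N.
  by case: d v v0 A sA => // v; rewrite (_ : v = 0) ?eqxx//; apply/matrixP => -[].
have [u u1 umax] := sphere_max A d0.
have qle (w : V) : quadform A w <= quadform A u * dotv w w.
  have [->|w0] := eqVneq w 0.
    by rewrite /quadform /dotv !mulmx0 mxE mulr0.
  have w2 := dotvv_gt0 w0; pose c := (Num.sqrt (dotv w w))^-1.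
  have c2 : c ^+ 2 = (dotv w w)^-1 by rewrite exprVn sqr_sqrtr// ltW.
  have := umax (c *: w); rewrite dotvZr dotvZl mulrA -expr2 c2 mulVf ?gt_eqF// => /(_ erefl).
  by rewrite quadform_scale c2 ler_pdivrMl// mulrC.
have eigu : A *m u = quadform A u *: u.
  apply/eqP; rewrite -subr_eq0; apply/eqP/dotvv_eq0.
  set lam := quadform A u; set z := A *m u - lam *: u.
  (* Moving [u] along the residual [z] gains [2 * t * dotv z z] to first order, which optimality
     forbids unless [z] vanishes. *)
  have zle (t : R) : t * (2 * dotv z z) + t ^+ 2 * (quadform A z - lam * dotv z z) <= 0.
    have := qle (u + t *: z).
    rewrite quadform_bilin// -/lam -quadform1 quadform_bilin ?trmx1// !quadform_scale.
    rewrite !quadform1 u1 mul1mx !dotvZr.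
    have -> : dotv z z = dotv (A *m u) z - lam * dotv u z.
      have zT : z^T = (A *m u)^T - lam *: u^T by rewrite /z linearB/= linearZ.
      have e3 (M N : 'M[R]_1) : (M - lam *: N) 0 0 = M 0 0 - lam * N 0 0 by rewrite !mxE.
      by rewrite {1}/dotv zT mulmxBl -scalemxAl e3.
    by rewrite -subr_le0 => /(le_trans _); apply; lra.
  set a := dotv z z in zle *; set b := quadform A z - lam * a in zle.
  have a0 : 0 <= a by exact: dotvv_ge0.
  apply/eqP; rewrite eq_le a0 andbT leNgt; apply/negP => a1.
  (* A step small enough that the quadratic term removes at most half of the linear gain. *)
  have := zle (a / (1 + `|b|)).
  have b1 : 0 < 1 + `|b| by rewrite ltr_pwDl.
  set t := a / _; have t0 : 0 < t by rewrite divr_gt0.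
  have tb : t * - b <= a.
    apply: (@le_trans _ _ (t * (1 + `|b|))); last by rewrite divfK ?gt_eqF.
    by rewrite ler_pM2l//; have := ler_norm (- b); rewrite normrN; lra.
  rewrite expr2 -mulrA -mulrDr pmulr_rle0//; lra.
have elam : eigenvalue A (quadform A u).
  apply/eigenvalueP; exists u^T.
    by rewrite -{1}sA -trmx_mul eigu linearZ.
  by apply: contra_eq_neq u1 => /(congr1 trmx); rewrite trmxK trmx0 => ->; rewrite /dotv mulmx0 mxE eq_sym oner_eq0.
(* Every eigenvalue is a Rayleigh quotient; the bound makes [sup] an actual supremum. *)
have ub : has_ubound [set a | eigenvalue A a].
  exists (quadform A u) => a /= /eigenvalueP[w wA w0].
  have w0' : w^T != 0 by apply: contra_neq w0 => /(congr1 trmx); rewrite trmxK trmx0.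
  have := qle w^T; rewrite {1}/quadform trmxK wA -scalemxAl mxE.
  rewrite -[w in (w *m _) 0 0]trmxK -/(dotv w^T w^T) ler_pM2r//.
  exact: dotvv_gt0.
apply: (le_trans (qle v)); rewrite ler_wpM2r ?dotvv_ge0//.
exact: ub_le_sup.
Qed.

Lemma lambda_max_le (A : 'M[R]_d) (M : R) : 0 <= M ->
  (forall v : V, quadform A v <= M * dotv v v) -> lambda_max A <= M.
Proof.
move=> M0 AM; rewrite /lambda_max.
have [[a ea]|A0] := pselect ([set a | eigenvalue A a] !=set0); last first.
  (* The [sup] of an empty spectrum is 0 by convention, which is where [0 <= M] serves. *)
  by rewrite sup_out// => -[].
apply: sup_le_ub; first by exists a.
move=> b /= /eigenvalueP[w wA w0].
have w0' : w^T != 0 by apply: contra_neq w0 => /(congr1 trmx); rewrite trmxK trmx0.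
have := AM w^T; rewrite {1}/quadform trmxK wA -scalemxAl mxE.
rewrite -[w in (w *m _) 0 0]trmxK -/(dotv w^T w^T) ler_pM2r//.
exact: dotvv_gt0.
Qed.

Lemma twice_diff_taylor_le (f : V -> R) (L : R) (x v : V) :
  twice_continuously_differentiable f ->
  (forall y, lambda_max (hessian f y) <= L) ->
  f (x + v) <= f x + (\sum_i v i 0 * partial i f x) + L * dotv v v / 2.
Proof.
move=> [cf df cpf d2f c2f] HL.
apply: (@line_taylor_le _ _ f v (fun x => \sum_i v i 0 * partial i f x)
  (fun x => quadform (hessian f x) v)).
- by move=> y; exact: dirder_partial.
- move=> y; rewrite /quadform mxE.
  have -> : \sum_j (v^T *m hessian f y) 0 j * v j 0 =
      \sum_j v j 0 * \sum_i v i 0 * partial i (partial j f) y.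
    apply: eq_bigr => j _; rewrite mulrC mxE; congr (_ * _).
    by apply: eq_bigr => i _; rewrite !mxE.
  rewrite /dirder.
  have -> : (fun h : R => h^-1 * (\sum_i v i 0 * partial i f (y + h *: v) -
       \sum_i v i 0 * partial i f y)) =
    (fun h : R => \sum_j v j 0 * (h^-1 * (partial j f (y + h *: v) - partial j f y))).
    apply/funext => h; rewrite -sumrB mulr_sumr; apply: eq_bigr => i _; ring.
  apply: cvg_sumR => j; apply: cvgMl_tmp.
  by apply: dirder_partial => [i z|i]; [exact: d2f|exact: c2f].
- move=> y; apply: le_trans (quadform_le_lambda_max _ _) _; last first.
    by rewrite ler_wpM2r ?dotvv_ge0.
  (* The comparison with [lambda_max] asks for a symmetric Hessian, supplied by the exchange of
     second derivatives. *)
  apply/matrixP => i j; rewrite !mxE.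
  have dp k z : dirder f z (delta_mx k 0) (partial k f z) by exact: derivable_dirder.
  have dp2 k l z : dirder (partial k f) z (delta_mx l 0) (partial l (partial k f) z).
    exact: derivable_dirder.
  exact: (second_dirder_sym (dp i) (dp j) (dp2 i j) (dp2 j i)).
Qed.

End hessian_bound.

(** * The posterior mode *)

Section posterior_mode.
Variables (R : realType) (d : nat) (C : 'M[R]_d) (alpha : R).
Hypotheses (pC : sym_posdef C) (alpha0 : 0 < alpha).
Local Notation V := 'cV[R]_d.
Variables (f : V -> R) (L : R).
Hypotheses (fC2 : twice_continuously_differentiable f)
  (fcvx : convex_function [set: V] f).
Hypotheses (L0 : 0 <= L) (fL : forall y, lambda_max (hessian f y) <= L).

Let w (x : V) := expR (- f x - alpha / 2 * quadform (invmx C) x).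

Variable b : V.
Hypothesis bmax : forall x, w x <= w b.

Let pI : sym_posdef (invmx C). Proof. exact: sym_posdef_inv. Qed.

Let bmin (v : V) (t : R) : 0 <= (f (b + t *: v) - f b) +
  t * (alpha * dotv (invmx C *m b) v) + t ^+ 2 * (alpha / 2 * quadform (invmx C) v).
Proof.
have := bmax (b + t *: v); rewrite /w ler_expR quadform_bilin ?pI.1//.
by rewrite quadform_scale dotvZr; lra.
Qed.

Let convex_ineq (v : V) (t : R) : 0 <= t <= 1 ->
  f (b + t *: v) - f b <= t * (f (b + v) - f b).
Proof.
move=> /andP[t0 t1].
have /= := @fcvx (Itv01 t0 t1) (b + v) b (mem_set I) (mem_set I).
rewrite /conv/=.
have -> : t *: (b + v) + (1 - t) *: b = b + t *: v.
  have tt : t + (1 - t) = 1 by ring.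
  by rewrite scalerDr addrAC -scalerDl tt scale1r.
by rewrite -[X in _ <= X]/(t * f (b + v) + (1 - t) * f b); lra.
Qed.

(** It suffices that the first-order term [D] at [b] be nonnegative. No derivative of [f] is taken:
    if [D] were negative, convexity would transfer the decrease to [b + t *: v] for small [t],
    against maximality. *)
Lemma log_ratio_le (x : V) :
  w x / w b <= expR (- (alpha / 2 * quadform (invmx C) (x - b))).
Proof.
rewrite /w -expRB ler_expR; set v := x - b.
have -> : x = b + v by rewrite addrC subrK.
rewrite quadform_bilin ?pI.1//.
set B := dotv _ _; set qv := quadform _ v.
suff : 0 <= f (b + v) - f b + alpha * B.
  by lra.
rewrite leNgt; apply/negP; set D := _ + alpha * B => D0.
have qv0 : 0 <= alpha * qv.
  rewrite mulr_ge0 ?(ltW alpha0)// /qv; have [v0|v0] := eqVneq v 0; last exact/ltW/pI.2.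
  by rewrite v0 /quadform mulmx0 mxE.
(* With this [t] the bracket [D + t * (alpha * qv) / 2] equals [D * (1 + t) / 2], which is
   negative. *)
pose t := - D / (- D + alpha * qv).
have den : 0 < - D + alpha * qv by lra.
have t0 : 0 < t by rewrite divr_gt0// oppr_gt0.
have t1 : t <= 1 by rewrite ler_pdivrMr// mul1r lerDl.
have tD : t * (- D + alpha * qv) = - D by rewrite divfK// gt_eqF.
have := bmin v t; have := @convex_ineq v t; rewrite t1 ltW// => /(_ isT) c1 c2.
have : 0 <= t * (D + t * (alpha * qv) / 2).
  by apply: (le_trans c2); rewrite /D -/B -/qv; lra.
by rewrite pmulr_rge0//; nra.
Qed.

Let grad_b (v : V) :
  \sum_i v i 0 * partial i f b = - (alpha * dotv (invmx C *m b) v).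
Proof.
set l := fun x => \sum_i v i 0 * partial i f x.
have [_ df cpf _ _] := fC2.
have fl x : dirder f x v (l x) by exact: dirder_partial.
set B := alpha * _; pose k := alpha / 2 * quadform (invmx C) v.
(* Up to a constant, minus the log weight along the line through [b], hence minimal at 0. *)
pose psi (s : R) := f (b + s *: v) + (B * s + k * s ^+ 2).
have dpsi s : is_derive s (1:R) psi (l (b + s *: v) + (B + 2 * k * s)).
  apply: is_deriveD; first exact: dirder_is_derive.
  apply: is_derive_eq; rewrite /GRing.scale/=.
  by ring.
have psi0 : is_derive (0:R) (1:R) psi 0.
  apply: (@derive1_at_min _ psi (-1) 1 0); rewrite ?lerN10 ?in_itv/= ?ltrN10 ?ltr01//.
    move=> s _; have := bmin v s.
    by rewrite /psi scale0r addr0 /k -/B mulr0 expr0n/= mulr0 !addr0; lra.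
have := dpsi 0; rewrite scale0r addr0 mulr0 addr0 => d0.
have : l b + B = 0 by rewrite -(@derive_val _ _ _ _ _ _ _ d0) (@derive_val _ _ _ _ _ _ _ psi0).
by move=> /eqP; rewrite addr_eq0 => /eqP.
Qed.

Lemma log_ratio_ge (x : V) :
  expR (- (alpha / 2 * quadform (invmx C) (x - b)) - L * dotv (x - b) (x - b) / 2)
  <= w x / w b.
Proof.
rewrite /w -expRB ler_expR; set v := x - b.
have -> : x = b + v by rewrite addrC subrK.
rewrite quadform_bilin ?pI.1//.
have := @twice_diff_taylor_le _ _ f L b v fC2 fL; rewrite grad_b => H.
by lra.
Qed.

Let Sigma := alpha^-1 *: C.

Let pSigma : sym_posdef Sigma.
Proof. by apply: sym_posdefZ => //; rewrite invr_gt0. Qed.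

Let invSigma : invmx Sigma = alpha *: invmx C.
Proof. by rewrite /Sigma invmxZ ?invrK// posdef_unitmx. Qed.

Let q := mvnormal_pdf b Sigma.

Let qE x : q x = q b * expR (- (alpha / 2 * quadform (invmx C) (x - b))).
Proof.
rewrite /q /mvnormal_pdf invSigma !quadformZ subrr -[RHS]mulrA -expRD; congr (_ * expR _).
have -> : quadform (invmx C) 0 = 0 by rewrite /quadform mulmx0 mxE.
by field.
Qed.

Let w0 x : 0 < w x. Proof. exact: expR_gt0. Qed.

Let q0 x : 0 < q x. Proof. exact: mvnormal_pdf_gt0. Qed.

Variable Z : R.
Hypotheses (Z0 : 0 < Z) (intw : (\int[lebv R d]_x (w x)%:E = Z%:E)%E).

Lemma mode_ratio_le x : q b / (w b / Z) * (w x / Z) <= q x.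
Proof.
rewrite [leRHS]qE (_ : _ * _ = q b * (w x / w b)).
  by rewrite ler_pM2l// log_ratio_le.
by field; rewrite !gt_eqF.
Qed.

(** The ratio is the integral of [q b * (w x / w b)]. The prior part of [log_ratio_ge] rebuilds
    [q x], so the integrand dominates the proposal density tilted by
    [expR (- (L * dotv (x - b) (x - b)) / 2)]. *)
Lemma mode_ratio_ge : measurable_fun setT w ->
  expR (- (L * \tr C / (2 * alpha))) <= q b / (w b / Z).
Proof.
move=> mw; rewrite -lee_fin.
have -> : - (L * \tr C / (2 * alpha)) = - (L * \tr Sigma / 2).
  by rewrite /Sigma mxtraceZ; field; rewrite gt_eqF.
apply: (le_trans (integral_mvnormal_tilt_ge b L0 pSigma)).
have -> : q b / (w b / Z) = (q b / w b) * Z by field; rewrite !gt_eqF.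
have qw0 : 0 <= q b / w b by rewrite divr_ge0// ltW.
rewrite EFinM -intw -ge0_integralZl//; last 2 first.
- exact/measurable_EFinP.
- by move=> x _; rewrite lee_fin ltW.
apply: ge0_le_integral => //.
- by move=> x _; rewrite lee_fin mulr_ge0 ?expR_ge0// ltW.
- apply/measurable_EFinP/measurable_funM; first exact: measurable_mvnormal_pdf.
  apply: measurableT_comp => //; apply: measurable_funM => //.
  apply: measurableT_comp => //; apply: measurable_funM => //.
  by under eq_fun do rewrite -quadform1; exact: measurable_quadform.
- apply/measurable_EFinP; exact: measurable_funM.
- move=> x _; rewrite lee_fin -/(q x) qE -mulrA -expRD.
  have -> : q b / w b * w x = q b * (w x / w b) by ring.
  rewrite ler_pM2l//; apply: le_trans (log_ratio_ge x).
  by rewrite ler_expR mulNr.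
Qed.

End posterior_mode.

(** * Gaussian matrices *)

Section mx_measure_unique.
Variable R : realType.
Local Open Scope ereal_scope.

(** Boxes are stable under intersection, and they generate the Borel sets because rational cubes
    do. *)
Lemma mx_measure_unique m n (P Q : probability 'M[R]_(m, n) R) :
  (forall A : 'I_m -> 'I_n -> set R, (forall i j, measurable (A i j)) ->
     P (mx_box A) = Q (mx_box A)) ->
  forall B, measurable B -> P B = Q B.
Proof.
move=> PQ B mB.
pose G : set (set 'M[R]_(m, n)) :=
  [set B | exists2 A : 'I_m -> 'I_n -> set R, (forall i j, measurable (A i j)) & B = mx_box A].
apply: (measure_unique G (fun=> setT)) => //.
- apply/seteqP; split.
    apply: smallest_sub; first exact: smallest_sigma_algebra.
    move=> U /open_mx_bigcup[D ->].
    have := @countable_bigcup_measurable _ (g_sigma_algebraType G) _ D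
      (fun k => mx_box (fun i j => ball (ratr (k.1 i j) : R) (ratr k.2))).
    apply=> k _; apply: sub_gen_smallest.
    exists (fun i j => ball (ratr (k.1 i j) : R) (ratr k.2)) => // i j.
    exact: measurable_ball.
  apply: smallest_sub; first exact: sigma_algebra_measurable.
  by move=> _ [A mA ->]; exact: measurable_mx_box.
- move=> _ _ [A1 mA1 ->] [A2 mA2 ->].
  exists (fun i j => A1 i j `&` A2 i j); first by move=> i j; exact: measurableI.
  by apply/seteqP; split=> M /=; [move=> [H1 H2] i j|move=> H; split=> i j; have [] := H i j].
- move=> _; exists (fun _ _ => setT) => //.
  by apply/seteqP; split => M.
- by rewrite bigcup_const//; exists 0%N.
- by move=> _ [A mA ->]; exact: PQ.
- by move=> _; rewrite [X in X < _]probability_setT ltry.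
Qed.

(** A conditional union bound: sections over [B] are bounded by one, the others by [K]. *)
Lemma product_measure_bound d1 d2 (T1 : measurableType d1) (T2 : measurableType d2)
    (P : probability T1 R) (Q : probability T2 R) (A : set (T1 * T2)) (B : set T1) (K : R) :
  measurable A -> measurable B -> (0 <= K)%R ->
  (forall x, ~ B x -> Q (xsection A x) <= K%:E) ->
  (P \x Q) A <= P B + K%:E.
Proof.
move=> mA mB K0 QK; rewrite /product_measure1/=.
have mBK : measurable_fun setT (fun x => (\1_B x)%:E + K%:E).
  by apply: emeasurable_funD => //; exact/measurable_EFinP/measurable_indic.
apply: (@le_trans _ _ (\int[P]_x ((\1_B x)%:E + K%:E))).
  apply: ge0_le_integral => //.
  - exact: measurable_fun_xsection.
  - move=> x _; rewrite indicE; have [xB|xB] := boolP (x \in B).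
      apply: (@le_trans _ _ 1); first exact/probability_le1/measurable_xsection.
      by rewrite leeDl// lee_fin.
    by rewrite add0e; apply: QK => Bx; move/negP: xB; rewrite inE.
rewrite ge0_integralD//; last exact/measurable_EFinP/measurable_indic.
by rewrite integral_indic// setIT integral_cst// [X in _ * X]probability_setT mule1.
Qed.

End mx_measure_unique.

(** * Gaussian vectors and matrices as iterated products *)

Section gaussian_measures.
Variables (R : realType) (s : R).
Local Open Scope ereal_scope.

Local Notation N := (normal_prob 0%R s : probability (measurableTypeR R) R).

Lemma consv0 d x (v : 'cV[R]_d) j : (consv (x, v) : 'cV[R]_d.+1) ord0 j = x.
Proof. by rewrite mxE; case: splitP => // k _; rewrite mxE !ord1 eqxx mulr1n. Qed.

Lemma consvS d x (v : 'cV[R]_d) i j :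
  (consv (x, v) : 'cV[R]_d.+1) (lift ord0 i) j = v i j.
Proof.
rewrite mxE; case: splitP => [[[]]//|k /= kE].
by congr (v _ _); apply: val_inj; case: kE.
Qed.

Definition consv_mfun d : {mfun (measurableTypeR R * 'cV[R]_d)%type >-> 'cV[R]_(1 + d)} :=
  let H := isMeasurableFun.Build _ _ _ _ _ (@measurable_consv R d) in
  HB.pack (@consv R d) H.

Fixpoint gaussv d : probability 'cV[R]_d R :=
  match d with
  | 0 => \d_(0%R : 'cV[R]_0)
  | d'.+1 => distribution (N \x gaussv d')%E (consv_mfun d')
  end.

Definition rowm n d (p : 'cV[R]_n * 'M[R]_(n, d)) : 'M[R]_(n, 1 + d) :=
  row_mx p.1 p.2.

Lemma rowm0 n d g (M : 'M[R]_(n, d)) i : (rowm (g, M) : 'M[R]_(n, d.+1)) i ord0 = g i 0%R.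
Proof. by rewrite mxE; case: splitP => // k _; rewrite !ord1. Qed.

Lemma rowmS n d g (M : 'M[R]_(n, d)) i j :
  (rowm (g, M) : 'M[R]_(n, d.+1)) i (lift ord0 j) = M i j.
Proof.
rewrite mxE; case: splitP => [[[]]//|k /= kE].
by congr (M _ _); apply: val_inj; case: kE.
Qed.

Lemma measurable_rowm n d : measurable_fun setT (@rowm n d).
Proof.
apply: measurable_fun_mx => i j; rewrite /rowm.
case: (split_ordP j) => k ->.
  under eq_fun do rewrite row_mxEl.
  exact: (measurableT_comp (measurable_mx_coord _ _) measurable_fst).
under eq_fun do rewrite row_mxEr.
exact: (measurableT_comp (measurable_mx_coord _ _) measurable_snd).
Qed.

Definition rowm_mfun n d : {mfun ('cV[R]_n * 'M[R]_(n, d))%type >-> 'M[R]_(n, 1 + d)} :=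
  let H := isMeasurableFun.Build _ _ _ _ _ (@measurable_rowm n d) in
  HB.pack (@rowm n d) H.

(** Built column by column, so that the first column is independent of the rest by construction; the
    splitting by rows is recovered from the values on boxes. *)
Fixpoint gaussm n d : probability 'M[R]_(n, d) R :=
  match d with
  | 0 => \d_(0%R : 'M[R]_(n, 0))
  | d'.+1 => distribution (gaussv n \x gaussm n d')%E (rowm_mfun n d')
  end.

Lemma gaussv_cons d (A : set 'cV[R]_(1 + d)) :
  gaussv d.+1 A = (N \x gaussv d) (@consv R d @^-1` A).
Proof. by []. Qed.

Lemma gaussm_row n d (A : set 'M[R]_(n, 1 + d)) :
  gaussm n d.+1 A = (gaussv n \x gaussm n d) (@rowm n d @^-1` A).
Proof. by []. Qed.

Lemma gaussv_box d (A : 'I_d -> 'I_1 -> set R) :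
  (forall i j, measurable (A i j)) ->
  gaussv d (mx_box A) = \prod_i N (A i 0%R).
Proof.
elim: d A => [|d IH] A mA.
  rewrite big_ord0 /= diracE (_ : _ \in _)//.
  by rewrite inE => -[].
rewrite big_ord_recl -(IH (fun i j => A (lift ord0 i) j))//.
rewrite -product_measure1E//; [|exact: mA|exact: measurable_mx_box].
rewrite gaussv_cons; congr ((_ \x _) _).
apply/seteqP; split => [[x v] AM|[x v] [/= Ax Av] i j].
  split => [|i j]; first by have := AM ord0 ord0; rewrite /= consv0.
  by have := AM (lift ord0 i) j; rewrite /= consvS.
by case: (unliftP ord0 i) => [k|] ->; rewrite ?consvS ?consv0 ?ord1//; exact: Av.
Qed.

Lemma gaussm_box n d (A : 'I_n -> 'I_d -> set R) :
  (forall i j, measurable (A i j)) ->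
  gaussm n d (mx_box A) = \prod_j \prod_i N (A i j).
Proof.
elim: d A => [|d IH] A mA.
  rewrite big_ord0 /= diracE (_ : _ \in _)//.
  by rewrite inE => i [].
rewrite big_ord_recl -(IH (fun i j => A i (lift ord0 j)))//.
rewrite -(gaussv_box (A := fun i j => A i ord0))//.
rewrite -product_measure1E//; [|exact: measurable_mx_box|exact: measurable_mx_box].
rewrite gaussm_row; congr ((_ \x _) _).
apply/seteqP; split => [[g M] AM|[g M] [/= Ag AM] i j].
  split => [i j|i j]; first by have := AM i ord0; rewrite /= rowm0 ord1.
  by have := AM i (lift ord0 j); rewrite /= rowmS.
by case: (unliftP ord0 j) => [k|] ->; rewrite ?rowmS ?rowm0; [exact: AM|exact: Ag].
Qed.

Lemma measurable_trmx m n : measurable_fun setT (@trmx R m n).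
Proof.
by apply: measurable_fun_mx => i j; under eq_fun do rewrite mxE; exact: measurable_mx_coord.
Qed.

Definition trmx_mfun m n : {mfun 'M[R]_(m, n) >-> 'M[R]_(n, m)} :=
  let H := isMeasurableFun.Build _ _ _ _ _ (@measurable_trmx m n) in
  HB.pack (@trmx R m n) H.

Lemma gaussm_trmx n d (A : set 'M[R]_(d, n)) : measurable A ->
  gaussm n d (@trmx R n d @^-1` A) = gaussm d n A.
Proof.
move=> mA.
apply: (@mx_measure_unique _ _ _ (distribution (gaussm n d) (trmx_mfun n d)) (gaussm d n)) => // B mB.
rewrite gaussm_box// exchange_big/=.
rewrite -(gaussm_box (A := fun i j => B j i))//=.
by congr (gaussm _ _ _); apply/seteqP; split => M BM i j; have := BM j i; rewrite ?mxE//= mxE.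
Qed.

Definition colm n d (p : 'cV[R]_d * 'M[R]_(n, d)) : 'M[R]_(1 + n, d) :=
  col_mx p.1^T p.2.

Lemma colm0 n d h (M : 'M[R]_(n, d)) j : (colm (h, M) : 'M[R]_(n.+1, d)) ord0 j = h j 0%R.
Proof. by rewrite mxE; case: splitP => // k _; rewrite mxE !ord1. Qed.

Lemma colmS n d h (M : 'M[R]_(n, d)) i j :
  (colm (h, M) : 'M[R]_(n.+1, d)) (lift ord0 i) j = M i j.
Proof.
rewrite mxE; case: splitP => [[[]]//|k /= kE].
by congr (M _ _); apply: val_inj; case: kE.
Qed.

Lemma measurable_colm n d : measurable_fun setT (@colm n d).
Proof.
apply: measurable_fun_mx => i j; rewrite /colm.
case: (split_ordP i) => k ->.
  under eq_fun do rewrite col_mxEu mxE.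
  exact: (measurableT_comp (measurable_mx_coord _ _) measurable_fst).
under eq_fun do rewrite col_mxEd.
exact: (measurableT_comp (measurable_mx_coord _ _) measurable_snd).
Qed.

Definition colm_mfun n d : {mfun ('cV[R]_d * 'M[R]_(n, d))%type >-> 'M[R]_(1 + n, d)} :=
  let H := isMeasurableFun.Build _ _ _ _ _ (@measurable_colm n d) in
  HB.pack (@colm n d) H.

(** On boxes both sides are the same double product, taken in two orders. *)
Lemma gaussm_col n d (A : set 'M[R]_(1 + n, d)) : measurable A ->
  gaussm n.+1 d A = (gaussv d \x gaussm n d) (@colm n d @^-1` A).
Proof.
move=> mA; apply: (@mx_measure_unique _ _ _ (gaussm n.+1 d)
  (distribution (gaussv d \x gaussm n d) (colm_mfun n d))) => // B mB.
rewrite gaussm_box// exchange_big/= big_ord_recl.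
rewrite -(gaussv_box (A := fun j _ => B ord0 j))//.
rewrite exchange_big/= -(gaussm_box (A := fun i j => B (lift ord0 i) j))//.
rewrite -product_measure1E//; [|exact: measurable_mx_box|exact: measurable_mx_box].
rewrite /distribution /pushforward/=; congr ((_ \x _) _).
apply/seteqP; split => [[h M] [/= Bh BM] i j|[h M] BM].
  by case: (unliftP ord0 i) => [k|] ->; rewrite ?colmS ?colm0; [exact: BM|exact: Bh].
split => i j; first by have := BM ord0 i; rewrite /= colm0 ord1.
by have := BM (lift ord0 i) j; rewrite /= colmS.
Qed.

End gaussian_measures.

(** * Rotation invariance of Gaussian vectors and matrices *)

Section plane_rotation.
Variable R : realType.
Local Open Scope ereal_scope.
Local Notation RR := (measurableTypeR R).
Local Notation leb := (@lebesgue_measure R).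

Definition int2 (G : RR * RR -> \bar R) : \bar R := \int[leb]_x \int[leb]_y G (x, y).

Lemma measurable_shear1 (t : R) :
  measurable_fun setT (fun p : RR * RR => ((p.1 + t * p.2)%R : RR, p.2)).
Proof.
apply: measurable_fun_pair; last exact: measurable_snd.
apply: measurable_funD; first exact: measurable_fst.
by apply: measurable_funM => //; exact: measurable_snd.
Qed.

Lemma measurable_shear2 (t : R) :
  measurable_fun setT (fun p : RR * RR => (p.1, (p.2 - t * p.1)%R : RR)).
Proof.
apply: measurable_fun_pair; first exact: measurable_fst.
apply: measurable_funB; first exact: measurable_snd.
by apply: measurable_funM => //; exact: measurable_fst.
Qed.

Section shears.
Variable G : RR * RR -> \bar R.
Hypotheses (mG : measurable_fun setT G) (G0 : forall p, 0 <= G p).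

Lemma int2_shear2 (t : R) : int2 (fun p => G (p.1, (p.2 - t * p.1)%R)) = int2 G.
Proof.
apply: eq_integral => x _ /=.
apply: (@integral_shift R (- (t * x))%R (fun y => G (x, y))) => //.
exact: (measurableT_comp mG (pair1_measurable x)).
Qed.

Lemma int2_shear1 (t : R) : int2 (fun p => G ((p.1 + t * p.2)%R, p.2)) = int2 G.
Proof.
pose G' := fun p : RR * RR => G ((p.1 + t * p.2)%R, p.2).
have mG' : measurable_fun setT G' by exact: (measurableT_comp mG (measurable_shear1 t)).
have E (H : RR * RR -> \bar R) : measurable_fun setT H -> (forall p, 0 <= H p) ->
    int2 H = \int[leb]_y \int[leb]_x H (x, y).
  by move=> mH H0; exact: (@fubini_tonelli _ _ _ _ _ leb leb H mH H0).
rewrite -/G' !E//; last by move=> p; exact: G0.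
apply: eq_integral => y _ /=.
apply: (@integral_shift R (t * y)%R (fun x => G (x, y))) => //.
exact: (measurableT_comp mG (measurable_pair2 y)).
Qed.

End shears.

(* A rotation of angle other than pi is a product of three shears. *)
Lemma int2_rot (c u : R) (G : RR * RR -> \bar R) :
  measurable_fun setT G -> (forall p, 0 <= G p) ->
  (c ^+ 2 + u ^+ 2 = 1)%R -> (-1 < c)%R ->
  int2 (fun p => G ((c * p.1 + u * p.2)%R, (- u * p.1 + c * p.2)%R)) = int2 G.
Proof.
(* The tangent of half the angle, finite because [c] exceeds [-1]. *)
move=> mG G0 cu c1; pose t : R := (u / (1 + c))%R.
have c10 : (1 + c != 0)%R by rewrite gt_eqF//; lra.
pose G3 := fun p : RR * RR => G ((p.1 + t * p.2)%R, p.2).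
pose G2 := fun p : RR * RR => G3 (p.1, (p.2 - u * p.1)%R).
have mG3 : measurable_fun setT G3 by exact: (measurableT_comp mG (measurable_shear1 t)).
have mG2 : measurable_fun setT G2 by exact: (measurableT_comp mG3 (measurable_shear2 u)).
have tu : (t * u = 1 - c)%R.
  by rewrite /t mulrAC -expr2; apply: (mulIf c10); rewrite divfK//; lra.
have tc : (t * (1 + c) = u)%R by rewrite divfK.
rewrite -[RHS](@int2_shear1 G mG G0 t) -[RHS](@int2_shear2 G3 mG3 _ u); last by move=> p; exact: G0.
rewrite -[RHS](@int2_shear1 G2 mG2 _ t); last by move=> p; exact: G0.
congr int2; apply/funext => -[x y]; rewrite /G2 /G3 /=.
have E1 : (- u * x + c * y = y - u * (x + t * y))%R.
  have -> : (y - u * (x + t * y) = y - u * x - t * u * y)%R by ring.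
  by rewrite tu; ring.
have E2 : (c * x + u * y = x + t * y + t * (y - u * (x + t * y)))%R.
  have -> : (x + t * y + t * (y - u * (x + t * y)) = x - t * u * x + (t + t - t * u * t) * y)%R by ring.
  rewrite tu -{1}tc; ring.
by rewrite E1 E2.
Qed.

Variable s : R.
Hypothesis s0 : s != 0%R.
Local Notation N := (normal_prob 0%R s : probability RR R).

Lemma integral_normal_prob (f : RR -> \bar R) :
  measurable_fun setT f -> (forall x, 0 <= f x) ->
  \int[N]_x f x = \int[leb]_x ((normal_pdf 0 s x)%:E * f x).
Proof.
move=> mf f0.
by rewrite -(integral_dens leb (measurable_normal_pdf 0 s) (normal_pdf_ge0 0 s)).
Qed.

(** The joint density depends only on [x ^+ 2 + y ^+ 2], and rotations preserve the plane
    integral. *)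
Lemma normal_rot (c u : R) (F : RR * RR -> \bar R) :
  measurable_fun setT F -> (forall p, 0 <= F p) ->
  (c ^+ 2 + u ^+ 2 = 1)%R -> (-1 < c)%R ->
  \int[N]_x \int[N]_y F ((c * x + u * y)%R, (- u * x + c * y)%R) =
  \int[N]_x \int[N]_y F (x, y).
Proof.
move=> mF F0 cu c1.
have mphi : measurable_fun setT (fun p : RR * RR => (normal_pdf 0 s p.1 * normal_pdf 0 s p.2)%:E).
  apply/measurable_EFinP/measurable_funM.
    exact: (measurableT_comp (measurable_normal_pdf 0 s) measurable_fst).
  exact: (measurableT_comp (measurable_normal_pdf 0 s) measurable_snd).
have phi0 x y : (0 <= normal_pdf 0 s x * normal_pdf 0 s y)%R.
  by rewrite mulr_ge0 ?normal_pdf_ge0.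
have E (H : RR * RR -> \bar R) : measurable_fun setT H -> (forall p, 0 <= H p) ->
    \int[N]_x \int[N]_y H (x, y) =
    int2 (fun p => (normal_pdf 0 s p.1 * normal_pdf 0 s p.2)%:E * H p).
  move=> mH H0; rewrite integral_normal_prob; last 2 first.
  - exact: (measurable_fun_fubini_tonelli_F H).
  - by move=> x; exact: integral_ge0.
  apply: eq_integral => x _; rewrite integral_normal_prob//; last first.
    exact: (measurableT_comp mH (pair1_measurable x)).
  rewrite -ge0_integralZl//; last 3 first.
  - apply: emeasurable_funM; last exact: (measurableT_comp mH (pair1_measurable x)).
    by apply/measurable_EFinP; exact: measurable_normal_pdf.
  - by move=> y _; rewrite mule_ge0// lee_fin normal_pdf_ge0.
  - by rewrite lee_fin normal_pdf_ge0.
  by apply: eq_integral => y _ /=; rewrite muleA -EFinM.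
have mrot : measurable_fun setT (fun p : RR * RR =>
    ((c * p.1 + u * p.2)%R : RR, (- u * p.1 + c * p.2)%R : RR)).
  by apply: measurable_fun_pair; apply: measurable_funD; apply: measurable_funM => //;
    (exact: measurable_fst || exact: measurable_snd).
have mFrot : measurable_fun setT
    (fun p : RR * RR => F ((c * p.1 + u * p.2)%R, (- u * p.1 + c * p.2)%R)).
  exact: (measurableT_comp mF mrot).
pose G := fun p : RR * RR => (normal_pdf 0 s p.1 * normal_pdf 0 s p.2)%:E * F p.
have mG : measurable_fun setT G by exact: emeasurable_funM.
have G0 p : 0 <= G p by rewrite mule_ge0// lee_fin.
transitivity (int2 G); last exact/esym/E.
transitivity (int2 (fun p => G ((c * p.1 + u * p.2)%R, (- u * p.1 + c * p.2)%R))).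
  rewrite (E (fun p => F ((c * p.1 + u * p.2)%R, (- u * p.1 + c * p.2)%R)) mFrot (fun p => F0 _)).
  congr int2; apply/funext => -[x y]; rewrite /G /=; congr (_%:E * _).
  rewrite !normal_pdfE// [LHS]mulrACA [RHS]mulrACA; congr (_ * _)%R.
  rewrite /normal_fun !subr0 -!expRD -!mulrDl -!opprD; congr expR; congr (- _ / _)%R.
  have -> : ((c * x + u * y) ^+ 2 + (- u * x + c * y) ^+ 2 = (c ^+ 2 + u ^+ 2) * (x ^+ 2 + y ^+ 2))%R by ring.
  by rewrite cu mul1r.
exact: int2_rot.
Qed.

Lemma gaussv_integral_cons d (A : set 'cV[R]_(1 + d)) : measurable A ->
  gaussv s d.+1 A = \int[N]_x gaussv s d [set v | A (consv (x, v))].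
Proof.
move=> mA; rewrite gaussv_cons /product_measure1; apply: eq_integral => x _ /=.
by congr (gaussv _ _ _); apply/seteqP; split => v; rewrite /xsection/= inE.
Qed.

Lemma dotv_cons d x y (v w : 'cV[R]_d) :
  (dotv (consv (x, v)) (consv (y, w)) = x * y + dotv v w)%R.
Proof.
rewrite dotvE (@big_ord_recl _ _ _ d) !consv0 dotvE; congr (_ + _)%R.
by apply: eq_bigr => i _; rewrite !consvS.
Qed.

(** Polarization: a symmetric matrix whose quadratic form vanishes is zero. *)
Lemma isometry_mulVmx d (H : 'M[R]_d) :
  (forall v : 'cV[R]_d, dotv (H *m v) (H *m v) = dotv v v) -> H^T *m H = 1%:M.
Proof.
move=> oH; apply/eqP; rewrite -subr_eq0; apply/eqP.
set A := (_ - _)%R; have sA : A^T = A.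
  by rewrite /A linearB/= trmx_mul trmxK trmx1.
have A0 v : quadform A v = 0%R.
  rewrite /quadform /A mulmxBr mulmxBl mulmx1 [LHS]mxE.
  rewrite [X in (_ + X)%R]mxE -/(dotv v v) -(oH v) /dotv trmx_mul !mulmxA.
  by rewrite subrr.
apply/matrixP => i j; rewrite [RHS]mxE.
have := A0 (delta_mx i 0 + delta_mx j 0)%R.
rewrite quadform_bilin// !A0 add0r addr0 => /eqP.
rewrite mulf_eq0 pnatr_eq0/= => /eqP; rewrite /dotv trmx_mul sA trmx_delta.
by rewrite -rowE -colE !mxE.
Qed.

(** Orthogonality packaged with invariance of the Gaussian law. Only products of plane rotations are
    needed, so invariance is proved for these generators and propagated through products and
    blocks. *)
Definition gauss_orth d (H : 'M[R]_d) := H^T *m H = 1%:M /\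
  forall A, measurable A -> gaussv s d ((fun v => H *m v) @^-1` A) = gaussv s d A.

Lemma measurable_mulmx m n p (H : 'M[R]_(m, n)) :
  measurable_fun setT (fun M : 'M[R]_(n, p) => H *m M).
Proof.
apply: measurable_fun_mx => i j; under eq_fun do rewrite mxE.
apply: measurable_sum => k; apply: measurable_funM => //.
exact: measurable_mx_coord.
Qed.

Lemma measurable_mulmxr m n p (H : 'M[R]_(n, p)) :
  measurable_fun setT (fun M : 'M[R]_(m, n) => M *m H).
Proof.
apply: measurable_fun_mx => i j; under eq_fun do rewrite mxE.
apply: measurable_sum => k; apply: measurable_funM => //.
exact: measurable_mx_coord.
Qed.

Lemma gauss_orth1 d : gauss_orth (1%:M : 'M[R]_d).
Proof.
split; first by rewrite trmx1 mul1mx.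
by move=> A mA; congr (gaussv _ _ _); apply/seteqP; split => v /=; rewrite mul1mx.
Qed.

Lemma gauss_orthM d (H K : 'M[R]_d) : gauss_orth H -> gauss_orth K -> gauss_orth (K *m H).
Proof.
move=> [oH pH] [oK pK]; split.
  by rewrite trmx_mul mulmxA -(mulmxA H^T) oK mulmx1.
move=> A mA; rewrite -(pK _ mA) -(pH (mulmx K @^-1` A)); last first.
  by rewrite -[X in measurable X]setTI; exact: measurable_mulmx.
by congr (gaussv _ _ _); apply/seteqP; split => v /=; rewrite mulmxA.
Qed.

Lemma measurable_cons_slice d (A : set 'cV[R]_(1 + d)) (x : RR) : measurable A ->
  measurable [set v | A (consv (x, v))].
Proof.
move=> mA; rewrite -[X in measurable X]setTI.
exact: (measurableT_comp (@measurable_consv R d) (pair1_measurable x)).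
Qed.

Lemma gauss_orth_block d (H : 'M[R]_d) : gauss_orth H ->
  gauss_orth (block_mx 1%:M 0 0 H : 'M[R]_(1 + d)).
Proof.
move=> [oH pH]; split.
  by rewrite tr_block_mx mulmx_block !trmx0 !mul0mx !mulmx0 trmx1 mul1mx oH !addr0 !add0r -scalar_mx_block.
move=> A mA.
rewrite [LHS]gaussv_integral_cons; last first.
  by rewrite -[X in measurable X]setTI; exact: measurable_mulmx.
rewrite [RHS]gaussv_integral_cons//; apply: eq_integral => x _.
rewrite -(pH [set v | A (consv (x, v))]); last exact: measurable_cons_slice.
congr (gaussv _ _ _); apply/seteqP; split => v /=;
  by rewrite /consv/= mul_block_col !mul0mx mul1mx addr0 add0r.
Qed.

Definition rot2 d (c u : R) : 'M[R]_(1 + (1 + d)) :=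
  block_mx c%:M (row_mx u%:M 0) (col_mx (- u)%:M 0) (block_mx c%:M 0 0 1%:M).

Lemma rot2E d c u x y (v : 'cV[R]_d) :
  rot2 d c u *m consv (x, consv (y, v)) =
  consv ((c * x + u * y)%R, consv ((- u * x + c * y)%R, v)).
Proof.
rewrite /rot2 /consv/= mul_block_col mul_row_col mul_col_mx mul_block_col.
rewrite !mul0mx mul1mx !addr0 add0r add_col_mx add0r.
by rewrite -!scalar_mxM -!raddfD.
Qed.

Lemma gauss_orth_rot2 d c u : (c ^+ 2 + u ^+ 2 = 1)%R -> (-1 < c)%R ->
  gauss_orth (rot2 d c u).
Proof.
move=> cu c1; split.
  apply: isometry_mulVmx => v0.
  rewrite -(unconsvK v0); case: (unconsv v0) => x v1.
  rewrite -(unconsvK v1); case: (unconsv v1) => y v.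
  rewrite rot2E !dotv_cons !addrA; congr (_ + _)%R.
  have -> : ((c * x + u * y) * (c * x + u * y) + (- u * x + c * y) * (- u * x + c * y) =
    (c ^+ 2 + u ^+ 2) * (x * x + y * y))%R by ring.
  by rewrite cu mul1r.
move=> A mA.
(* Measuring the remaining coordinates by slices reduces the claim to a function on the plane. *)
pose F (p : RR * RR) := gaussv s d [set v | A (consv (p.1, consv (p.2, v)))].
have E B : measurable B -> gaussv s d.+2 B =
    \int[N]_x \int[N]_y gaussv s d [set v | B (consv (x, consv (y, v)))].
  move=> mB; rewrite (@gaussv_integral_cons d.+1 B mB); apply: eq_integral => x _.
  exact: (@gaussv_integral_cons d _ (measurable_cons_slice x mB)).
have mRA : measurable ((fun v => rot2 d c u *m v) @^-1` A).
  by rewrite -[X in measurable X]setTI; exact: measurable_mulmx.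
have mF : measurable_fun setT F.
  pose A3 : set ((RR * RR) * 'cV[R]_d) := [set q | A (consv (q.1.1, consv (q.1.2, q.2)))].
  have mA3 : measurable A3.
    rewrite -[X in measurable X]setTI.
    have m1 : measurable_fun setT (fun q : (RR * RR) * 'cV[R]_d => consv (q.1.2, q.2)).
      apply: (measurableT_comp (@measurable_consv R d)).
      apply: measurable_fun_pair; last exact: measurable_snd.
      exact: (measurableT_comp measurable_snd measurable_fst).
    have m2 : measurable_fun setT (fun q : (RR * RR) * 'cV[R]_d =>
        consv (q.1.1, consv (q.1.2, q.2))).
      apply: (measurableT_comp (@measurable_consv R d.+1)).
      apply: measurable_fun_pair; last exact: m1.
      exact: (measurableT_comp measurable_fst measurable_fst).
    exact: m2.
  have := measurable_fun_xsection (gaussv s d) mA3.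
  congr measurable_fun; apply/funext => p; rewrite /F /=.
  by congr (gaussv _ _ _); apply/seteqP; split => v; rewrite /xsection/= inE.
have F0 p : 0 <= F p by [].
transitivity (\int[N]_x \int[N]_y F (x, y)); last exact/esym/E.
transitivity (\int[N]_x \int[N]_y F ((c * x + u * y)%R, (- u * x + c * y)%R)); last exact: normal_rot.
rewrite (E _ mRA); apply: eq_integral => x _; apply: eq_integral => y _.
by congr (gaussv _ _ _); apply/seteqP; split => v /=; rewrite rot2E.
Qed.

(** Givens rotations from the bottom up: the tail is aligned by induction, then one rotation in the
    first two coordinates absorbs what is left of it. *)
Lemma gauss_orth_align d (g : 'cV[R]_(1 + d)) :
  exists2 H : 'M[R]_(1 + d), gauss_orth H & exists a, H *m g = consv (a, 0%R).
Proof.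
elim: d g => [|d IH] g.
  exists 1%:M; first exact: gauss_orth1.
  exists (unconsv g).1; rewrite mul1mx -[LHS]unconsvK; congr consv.
  by rewrite [LHS]surjective_pairing; congr pair; apply/matrixP => -[].
rewrite -(unconsvK g); case: (unconsv g) => x g'.
have [H oH [y Hg']] := IH g'.
pose H1 : 'M[R]_(1 + (1 + d)) := block_mx 1%:M 0 0 H.
have oH1 : gauss_orth H1 by exact: (@gauss_orth_block d.+1).
have H1g : H1 *m consv (x, g') = consv (x, consv (y, 0%R)).
  by rewrite /H1 /consv/= mul_block_col !mul0mx mul1mx addr0 add0r Hg'.
(* With [y = 0] the vector is already aligned; otherwise [y] keeps the cosine [x / r] above [-1], as
   [gauss_orth_rot2] requires. *)
have [y0|y0] := eqVneq y 0%R.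
  exists H1 => //; exists x; rewrite H1g y0; congr (consv (_, _)).
  by rewrite /consv/= (_ : 0%:M = 0%R) ?col_mx0//; apply/matrixP => i j; rewrite !mxE mul0rn.
pose r := Num.sqrt (x ^+ 2 + y ^+ 2).
have y2 : (0 < y ^+ 2)%R by rewrite exprn_even_gt0.
have r2 : (r ^+ 2 = x ^+ 2 + y ^+ 2)%R by rewrite sqr_sqrtr// addr_ge0 ?sqr_ge0.
have xy0 : (0 < x ^+ 2 + y ^+ 2)%R by rewrite ltr_wpDl ?sqr_ge0.
have r0 : (0 < r)%R by rewrite sqrtr_gt0.
have cu : ((x / r) ^+ 2 + (y / r) ^+ 2 = 1)%R.
  by rewrite !expr_div_n -mulrDl -r2 divff// expf_neq0// gt_eqF.
have c1 : (-1 < x / r)%R.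
  rewrite ltr_pdivlMr// mulN1r ltrNl.
  rewrite (le_lt_trans (ler_norm _))// normrN -sqrtr_sqr ltr_sqrt//.
  by rewrite ltrDl.
exists (rot2 d (x / r) (y / r) *m H1); first exact: gauss_orthM (gauss_orth_rot2 _ _ _).
exists r; rewrite -mulmxA H1g rot2E; congr (consv (_, _)).
  have -> : (x / r * x + y / r * y = (x ^+ 2 + y ^+ 2) / r)%R by ring.
  by rewrite -r2 expr2 mulfK// gt_eqF.
have -> : (- (y / r) * x + x / r * y = 0)%R by ring.
by rewrite /consv/= (_ : 0%:M = 0%R) ?col_mx0//; apply/matrixP => i j; rewrite !mxE mul0rn.
Qed.

(** [H] acts on each column separately, and the columns are independent Gaussian vectors. *)
Lemma gaussm_mull n d (H : 'M[R]_n) (A : set 'M[R]_(n, d)) : gauss_orth H -> measurable A ->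
  gaussm s n d ((fun M => H *m M) @^-1` A) = gaussm s n d A.
Proof.
move=> [oH pH]; elim: d A => [|d IH] A mA.
  by congr (gaussm _ _ _ _); apply/seteqP; split => M /=; rewrite (_ : H *m M = M)//;
    apply/matrixP => i [].
pose k g := gaussm s n d [set M | A (rowm (g, M))].
have slice g (B : set 'M[R]_(n, 1 + d)) : measurable B -> measurable [set M | B (rowm (g, M))].
  move=> mB; rewrite -[X in measurable X]setTI.
  exact: (measurableT_comp (@measurable_rowm R n d) (pair1_measurable g)).
have E (B : set 'M[R]_(n, 1 + d)) : measurable B ->
    gaussm s n d.+1 B = \int[gaussv s n]_g gaussm s n d [set M | B (rowm (g, M))].
  move=> mB; rewrite gaussm_row /product_measure1; apply: eq_integral => g _ /=.
  by congr (gaussm _ _ _ _); apply/seteqP; split => v; rewrite /xsection/= inE.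
have mk : measurable_fun setT k.
  have mA' : measurable (@rowm R n d @^-1` A).
    by rewrite -[X in measurable X]setTI; exact: measurable_rowm.
  have := measurable_fun_xsection (gaussm s n d) mA'.
  congr measurable_fun; apply/funext => p; rewrite /k /=.
  by congr (gaussm _ _ _ _); apply/seteqP; split => v; rewrite /xsection/= inE.
have k0 g : 0 <= k g by [].
have mHA : measurable ((fun M : 'M[R]_(n, 1 + d) => H *m M) @^-1` A).
  by rewrite -[X in measurable X]setTI; exact: measurable_mulmx.
transitivity (\int[gaussv s n]_g k g); last exact/esym/E.
transitivity (\int[gaussv s n]_g k (H *m g)).
  rewrite (E _ mHA); apply: eq_integral => g _.
  rewrite /k -(IH _ (slice _ _ mA)); congr (gaussm _ _ _ _).
  by apply/seteqP; split => M /=; rewrite /rowm/= mul_mx_row.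
have := @ge0_integral_pushforward _ _ _ _ _ _ (@measurable_mulmx n n 1 H) (gaussv s n) setT k
  measurableT mk (fun x _ => k0 x).
rewrite preimage_setT => <-.
by apply: eq_measure_integral => [|? B mB _]; [exact: measurable_mulmx|exact: pH].
Qed.

Lemma gaussm_mulr n d (V : 'M[R]_d) (A : set 'M[R]_(n, d)) : gauss_orth V -> measurable A ->
  gaussm s n d ((fun M => M *m V^T) @^-1` A) = gaussm s n d A.
Proof.
move=> oV mA.
have mAT : measurable (@trmx R d n @^-1` A).
  by rewrite -[X in measurable X]setTI; exact: measurable_trmx.
rewrite -[RHS]gaussm_trmx// -(gaussm_mull oV mAT).
rewrite -[LHS]gaussm_trmx; last first.
  by rewrite -[X in measurable X]setTI; exact: measurable_mulmxr.
by congr (gaussm _ _ _ _); apply/seteqP; split => M /=; rewrite trmx_mul.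
Qed.

End plane_rotation.

(** * The largest singular value of a Gaussian matrix *)

Section chi_square_tail.
Variables (R : realType) (s : R).
Hypothesis s0 : s != 0.
Local Open Scope ereal_scope.
Local Notation RR := (measurableTypeR R).
Local Notation N := (normal_prob 0%R s : probability RR R).
Local Notation leb := (@lebesgue_measure R).

Lemma measurable_dotvv d : measurable_fun setT (fun v : 'cV[R]_d => dotv v v).
Proof.
under eq_fun do rewrite dotvE; apply: measurable_sum => i.
by apply: measurable_funM; exact: measurable_mx_coord.
Qed.

Lemma integral_gaussv_cons d (f : 'cV[R]_(1 + d) -> \bar R) :
  measurable_fun setT f -> (forall v, 0 <= f v) ->
  \int[gaussv s d.+1]_v f v = \int[N]_x \int[gaussv s d]_v f (consv (x, v)).
Proof.
move=> mf f0.
have mfc : measurable_fun setT (f \o @consv R d).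
  by apply: measurableT_comp => //; exact: measurable_consv.
transitivity (\int[N \x gaussv s d]_p f (consv p)).
  have := @ge0_integral_pushforward _ _ _ _ _ _ (@measurable_consv R d)
    (N \x gaussv s d) setT f measurableT mf (fun x _ => f0 x).
  rewrite preimage_setT => <-.
  by apply: eq_measure_integral => [|? B mB _]; [exact: measurable_consv|].
exact: (@fubini_tonelli1 _ _ _ _ _ N (gaussv s d) (f \o @consv R d) mfc (fun p => f0 (consv p))).
Qed.

Variable delta : R.
Hypothesis delta0 : (0 < delta)%R.
(* The minimizer of the Chernoff bound [E expR (theta |v|^2) / expR (theta a)]
   with [a = n s^2 (1 + delta)]. *)
Let theta : R := (delta / (2 * (1 + delta) * s ^+ 2))%R.

Let s2 : (0 < s ^+ 2)%R. Proof. by rewrite exprn_even_gt0. Qed.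
Let delta1 : (0 < 1 + delta)%R. Proof. by rewrite addr_gt0. Qed.
Let theta0 : (0 <= theta)%R.
Proof.
by rewrite /theta divr_ge0 ?(ltW delta0)// mulr_ge0 ?(ltW s2)// mulr_ge0 ?(ltW delta1).
Qed.

Let normal_moment : \int[N]_x (expR (theta * (x : R) ^+ 2))%:E = (Num.sqrt (1 + delta))%:E.
Proof.
(* The precision left after the tilt: [1 / s ^+ 2 - 2 * theta]. *)
pose a : R := (s ^+ 2 * (1 + delta))^-1%R.
have a0 : (0 < a)%R by rewrite invr_gt0 mulr_gt0.
rewrite integral_normal_prob//; last first.
  by apply/measurable_EFinP; apply: measurableT_comp => //; apply: measurable_funM.
have E x : (normal_pdf 0 s x * expR (theta * x ^+ 2) =
    normal_peak s * expR (- (a * (x + 0) ^+ 2) / 2))%R.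
  rewrite normal_pdfE// /normal_fun -mulrA -expRD; congr (_ * expR _)%R.
  rewrite /theta /a -mulr_natl; field.
  by rewrite (gt_eqF delta1) s0.
under eq_integral do rewrite -EFinM E EFinM.
rewrite ge0_integralZl//=; last 2 first.
- exact: measurable_expR_sqr.
- by rewrite lee_fin normal_peak_ge0.
rewrite integral_expR_sqr// -EFinM; congr EFin.
have p0 : (0 < (2 * pi : R))%R by rewrite mulr_gt0// pi_gt0.
rewrite /normal_peak -sqrtrV; last by rewrite mulrn_wge0// mulr_ge0 ?pi_ge0// ltW.
rewrite -sqrtrM; last by rewrite invr_ge0 mulrn_wge0// mulr_ge0 ?pi_ge0// ltW.
congr Num.sqrt; rewrite /a -mulr_natl.
move: (pi_gt0 R); move: (pi : R) => q q0; field.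
by rewrite (gt_eqF delta1) s0 gt_eqF.
Qed.

Let gauss_moment d :
  \int[gaussv s d]_v (expR (theta * dotv v v))%:E = (Num.sqrt (1 + delta) ^+ d)%:E.
Proof.
have mexp k : measurable_fun setT (fun v : 'cV[R]_k => (expR (theta * dotv v v))%:E).
  apply/measurable_EFinP; apply: measurableT_comp => //; apply: measurable_funM => //.
  exact: measurable_dotvv.
elim: d => [|d IH].
  transitivity (\int[\d_(0%R : 'cV[R]_0)]_v (expR (theta * dotv v v))%:E) => //.
  rewrite integral_dirac//; last exact: mexp.
  by rewrite diracE in_setT mul1e dotvE big_ord0 mulr0 expR0.
rewrite integral_gaussv_cons//.
under eq_integral => x _.
  under eq_integral do rewrite dotv_cons mulrDr expRD EFinM.
  rewrite ge0_integralZl//; last exact: mexp.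
  rewrite IH -expr2.
  over.
rewrite ge0_integralZr//; last first.
  by apply/measurable_EFinP; apply: measurableT_comp => //; apply: measurable_funM.
by rewrite normal_moment -EFinM -exprS.
Qed.

(** Threshold and rate are those of length [n] for every [d <= n], so one bound serves all the
    shorter vectors met during the bidiagonalization. *)
Lemma gaussv_tail d n : (d <= n)%N ->
  gaussv s d [set v | (n%:R * s ^+ 2 * (1 + delta) < dotv v v)%R] <=
  ((expR (- (delta / 2)) * Num.sqrt (1 + delta)) ^+ n)%:E.
Proof.
move=> dn; set a := (n%:R * s ^+ 2 * (1 + delta))%R; set B := [set v | _].
have mB : measurable B.
  rewrite (_ : B = (fun v : 'cV[R]_d => dotv v v) @^-1` `]a, +oo[%classic).
    by rewrite -[X in measurable X]setTI; exact: measurable_dotvv.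
  by apply/seteqP; split => v /=; rewrite in_itv/= andbT.
have mexp : measurable_fun setT (fun v : 'cV[R]_d => (expR (theta * dotv v v))%:E).
  apply/measurable_EFinP; apply: measurableT_comp => //; apply: measurable_funM => //.
  exact: measurable_dotvv.
have -> : gaussv s d B = \int[gaussv s d]_v (\1_B v)%:E.
  by rewrite integral_indic// setIT.
apply: (@le_trans _ _ (\int[gaussv s d]_v ((expR (- (theta * a)))%:E * (expR (theta * dotv v v))%:E))).
  apply: ge0_le_integral => //.
  - exact/measurable_EFinP/measurable_indic.
  - exact: measurable_funeM.
  - move=> v _; rewrite -EFinM lee_fin -expRD indicE; have [vB|_] := boolP (v \in B); last exact: expR_ge0.
    move: vB; rewrite inE /B/= => vB.
    rewrite -[X in (X <= _)%R]expR0 ler_expR addrC subr_ge0.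
    by rewrite ler_wpM2l// ltW.
rewrite ge0_integralZl//.
rewrite gauss_moment -EFinM lee_fin.
have -> : (theta * a = n%:R * (delta / 2))%R.
  by rewrite /theta /a; field; rewrite (gt_eqF delta1) s0.
rewrite -mulrN expRM_natl exprMn ler_wpM2l ?exprn_ge0 ?expR_ge0//.
apply: ler_weXn2l => //.
by rewrite -[X in (X <= _)%R]sqrtr1 ler_wsqrtr// lerDl ltW.
Qed.

(** After squaring, this is [1 + delta < expR delta]. *)
Lemma tail_rate_lt1 : (expR (- (delta / 2)) * Num.sqrt (1 + delta) < 1)%R.
Proof.
rewrite expRN mulrC ltr_pdivrMr ?expR_gt0// mul1r.
rewrite -[ltRHS]ger0_norm ?expR_ge0// -sqrtr_sqr ltr_sqrt ?exprn_gt0 ?expR_gt0//.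
rewrite expr2 -expRD -splitr; apply: expR_gt1Dx.
by rewrite gt_eqF.
Qed.

End chi_square_tail.

(** * Bidiagonalization and the strengthened norm bound *)

Section bidiagonalization.
Variables (R : realType) (s : R).
Hypothesis s0 : s != 0.
Variables (a b : R).
Hypotheses (a0 : 0 < a) (b0 : 0 < b).
Let t := a + b.

(* The bound |M x| <= t |x|, strengthened in the direction of h; this is the
   form that passes from a trailing block to the whole matrix. *)
Definition strong_bound n d (h : 'cV[R]_d) : set 'M[R]_(n, d) :=
  [set M | forall x : 'cV[R]_d,
    dotv (M *m x) (M *m x) + t / b * dotv h x ^+ 2 <= t ^+ 2 * dotv x x].

(** The event quantifies over uncountably many [x]; it is measurable because it is an intersection
    of closed sets. *)
Lemma closed_strong_bound n d (h : 'cV[R]_d) : closed (@strong_bound n d h).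
Proof.
have -> : @strong_bound n d h = \bigcap_(x in [set: 'cV[R]_d])
   ((fun M : 'M[R]_(n, d) => dotv (M *m x) (M *m x)) @^-1`
     [set r | r <= t ^+ 2 * dotv x x - t / b * dotv h x ^+ 2]).
  apply/seteqP; split => M /=; first by move=> GM x _ /=; rewrite lerBrDr.
  by move=> GM x; have := GM x I; rewrite /= lerBrDr.
apply: closed_bigI => x _; apply: preimage_closed; last exact: closed_le.
move=> M _; move: M.
have -> : (fun M : 'M[R]_(n, d) => dotv (M *m x) (M *m x)) =
   (fun M => \sum_i (\sum_j M i j * x j 0) * (\sum_j M i j * x j 0)).
  by apply/funext => M; rewrite dotvE; apply: eq_bigr => i _; rewrite mxE.
have cl i : continuous (fun M : 'M[R]_(n, d) => \sum_j M i j * x j 0).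
  apply: continuous_sumR => j M.
  by apply: continuousM; [exact: coord_continuous|exact: cst_continuous].
by apply: continuous_sumR => i M; apply: continuousM; exact: cl.
Qed.

Lemma measurable_strong_bound n d (h : 'cV[R]_d) : measurable (@strong_bound n d h).
Proof. by apply: closed_mx_measurable; exact: closed_strong_bound. Qed.

Lemma dotv0 d (u : 'cV[R]_d) : dotv u 0 = 0.
Proof. by rewrite /dotv mulmx0 mxE. Qed.

Lemma dot0v d (u : 'cV[R]_d) : dotv 0 u = 0.
Proof. by rewrite /dotv linear0 mul0mx mxE. Qed.

Lemma dotv_cauchy d (u v : 'cV[R]_d) : dotv u v ^+ 2 <= dotv u u * dotv v v.
Proof.
have [->|v0] := eqVneq v 0; first by rewrite !dotv0 expr0n/= mulr0.
have v1 := dotvv_gt0 v0.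
have E : dotv (dotv v v *: u - dotv u v *: v) (dotv v v *: u - dotv u v *: v) =
    dotv v v * (dotv u u * dotv v v - dotv u v ^+ 2).
  have sym : dotv v u = dotv u v by rewrite !dotvE; apply: eq_bigr => i _; rewrite mulrC.
  have D (w z : 'cV[R]_d) : dotv (w - z) (w - z) = dotv w w - dotv w z - dotv z w + dotv z z.
    by rewrite !dotvE -!sumrB -big_split/=; apply: eq_bigr => i _; rewrite !mxE; ring.
  by rewrite D !dotvZl !dotvZr sym; ring.
have := dotvv_ge0 (dotv v v *: u - dotv u v *: v).
by rewrite E pmulr_rge0// subr_ge0.
Qed.

Lemma dotv_mull d n (H : 'M[R]_(n, d)) (u v : 'cV[R]_d) : H^T *m H = 1%:M ->
  dotv (H *m u) (H *m v) = dotv u v.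
Proof. by move=> HH; rewrite /dotv trmx_mul mulmxA -(mulmxA _ H^T) HH mulmx1. Qed.

Lemma strong_bound_mull n d (H : 'M[R]_n) (h : 'cV[R]_d) M : H^T *m H = 1%:M ->
  strong_bound h (H *m M) -> strong_bound h M.
Proof. by move=> HH GM x; have := GM x; rewrite -!mulmxA dotv_mull. Qed.

Lemma strong_bound_mulr n d (V : 'M[R]_d) (h : 'cV[R]_d) (M : 'M[R]_(n, d)) :
  V^T *m V = 1%:M -> strong_bound (V *m h) (M *m V^T) -> strong_bound h M.
Proof.
move=> VV GM x; have := GM (V *m x).
by rewrite -mulmxA (mulmxA _ V) VV mul1mx (dotv_mull h x VV) (dotv_mull x x VV).
Qed.

(** Of the weight [t / b] = [1 + a / b] on [dotv h y ^+ 2], the 1 pays for the square in the first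
    row and [a / b] for the cross term with [u * x]. The coefficients of [x ^+ 2] are then
    [a ^+ 2 + a * b] from the first row and [a * b + b ^+ 2] from the direction [v], in total
    [t ^+ 2]. *)
Lemma strong_bound_block n d (u v : R) (h : 'cV[R]_d) (M : 'M[R]_(n, d)) :
  u ^+ 2 <= a ^+ 2 -> v ^+ 2 <= b ^+ 2 -> strong_bound h M ->
  strong_bound (consv (v, 0)) (rowm (consv (u, 0), colm (h, M))).
Proof.
move=> ua vb GM x0; rewrite -(unconsvK x0); case: (unconsv x0) => x y.
have E : rowm (consv (u, 0), colm (h, M)) *m consv (x, y) =
    consv (u * x + dotv h y, M *m y).
  rewrite /rowm /colm /consv/= mul_row_col mul_col_mx mul_mx_scalar mul_col_mx.
  rewrite mul0mx add_col_mx add0r; congr col_mx.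
  by apply/matrixP => i j; rewrite !ord1 !mxE eqxx !mulr1n mulrC /dotv mxE.
rewrite E !dotv_cons dot0v; have := GM y.
set w := dotv h y; set My := dotv (M *m y) _; set yy := dotv y y.
rewrite addr0 => Gy.
have t0 : 0 < t by rewrite addr_gt0.
have ab0 : 0 < a / b by rewrite divr_gt0.
have tb : t / b = a / b + 1 by rewrite /t mulrDl divff// gt_eqF.
(* AM-GM with the weight [a / b], which is [t / b - 1]. *)
have cross : 2 * (u * x * w) <= a / b * w ^+ 2 + a * b * x ^+ 2.
  have sq : 0 <= a / b * (w - b / a * (u * x)) ^+ 2 by rewrite mulr_ge0 ?sqr_ge0 ?ltW.
  have E2 : a / b * (w - b / a * (u * x)) ^+ 2 =
    a / b * w ^+ 2 - 2 * (u * x * w) + b / a * (u ^+ 2 * x ^+ 2).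
    by field; rewrite !gt_eqF.
  have : b / a * (u ^+ 2 * x ^+ 2) <= a * b * x ^+ 2.
    have -> : a * b * x ^+ 2 = b / a * (a ^+ 2 * x ^+ 2) by field; rewrite gt_eqF.
    by rewrite ler_pM2l ?divr_gt0// ler_wpM2r ?sqr_ge0.
  by lra.
have vx : t / b * (v * x) ^+ 2 <= t * b * x ^+ 2.
  have -> : t * b * x ^+ 2 = t / b * (b ^+ 2 * x ^+ 2) by field; rewrite gt_eqF.
  by rewrite exprMn ler_pM2l ?divr_gt0// ler_wpM2r ?sqr_ge0.
have ux : u ^+ 2 * x ^+ 2 <= a ^+ 2 * x ^+ 2 by rewrite ler_wpM2r ?sqr_ge0.
move: Gy vx; rewrite tb => Gy vx.
have tE : t ^+ 2 = a ^+ 2 + 2 * (a * b) + b ^+ 2 by rewrite /t; ring.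
have tbE : t * b = a * b + b ^+ 2 by rewrite /t; ring.
rewrite tbE in vx; rewrite tE in Gy *.
lra.
Qed.

Variables (e1 e2 : R) (N D : nat).
Hypotheses (e10 : 0 <= e1) (e20 : 0 <= e2).
Hypothesis tail1 : forall k, (k <= N)%N ->
  (gaussv s k [set v | (a ^+ 2 < dotv v v)%R] <= e1%:E)%E.
Hypothesis tail2 : forall k, (k <= D)%N ->
  (gaussv s k [set v | (b ^+ 2 < dotv v v)%R] <= e2%:E)%E.

Lemma measurable_norm_gt d (c : R) : measurable [set v : 'cV[R]_d | (c < dotv v v)%R].
Proof.
rewrite (_ : [set v | _] = (fun v : 'cV[R]_d => dotv v v) @^-1` `]c, +oo[%classic).
  by rewrite -[X in measurable X]setTI; exact: measurable_dotvv.
by apply/seteqP; split => v /=; rewrite in_itv/= andbT.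
Qed.

(* One rotation of the columns aligns h with the first axis, then one of the
   rows aligns the first column g with the first axis; the rest of the first row
   is the vector h for the remaining block. *)
Lemma gaussm_strong_bound n d (h : 'cV[R]_d) : (n <= N)%N -> (d <= D)%N ->
  dotv h h <= b ^+ 2 ->
  (gaussm s n d (~` strong_bound h) <= (n%:R * (e1 + e2))%:E)%E.
Proof.
elim: n d h => [|n IH] d h nN dD hb.
  (* With no rows only the [h] term remains; Cauchy-Schwarz and [dotv h h <= b ^+ 2] bound it by
     [t * b * dotv x x]. *)
  rewrite (_ : ~` _ = set0) ?measure0 ?mul0r//; apply/seteqP; split => // M.
  apply=> x; rewrite {1}dotvE big_ord0 add0r.
  have t0 : 0 < t by rewrite addr_gt0.
  have xx := dotvv_ge0 x.
  apply: (@le_trans _ _ (t / b * (b ^+ 2 * dotv x x))).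
    rewrite ler_pM2l ?divr_gt0// (le_trans (dotv_cauchy h x))//.
    by rewrite ler_wpM2r.
  have -> : t / b * (b ^+ 2 * dotv x x) = t * b * dotv x x by field; rewrite gt_eqF.
  by rewrite ler_wpM2r// expr2 ler_pM2l// /t lerDr ltW.
case: d h dD hb => [|d] h dD hb.
  rewrite (_ : ~` _ = set0) ?measure0 ?lee_fin ?mulr_ge0 ?addr_ge0//.
  apply/seteqP; split => // M; apply=> x.
  rewrite (_ : x = 0); last by apply/matrixP => -[].
  by rewrite /dotv !mulmx0 mxE expr0n/= !mulr0 addr0.
have [V oV [v hV]] := gauss_orth_align s0 (h : 'cV[R]_(1 + d)).
have v2 : v ^+ 2 <= b ^+ 2.
  rewrite -(dotv_mull _ _ oV.1) hV dotv_cons in hb.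
  by rewrite dotv0 addr0 in hb.
have mbad k l (g : 'cV[R]_l) : measurable (~` @strong_bound k l g).
  by apply: measurableC; exact: measurable_strong_bound.
apply: (@le_trans _ _ (gaussm s n.+1 d.+1 (~` strong_bound (consv (v, 0) : 'cV[R]_d.+1)))).
  rewrite -[leRHS](gaussm_mulr oV (mbad _ _ _)); apply: le_measure; rewrite ?inE//.
  - exact: mbad.
  - by rewrite -[X in measurable X]setTI; apply: measurable_mulmxr => //; exact: mbad.
  move=> M /= nGM GM; apply: nGM; apply: (strong_bound_mulr oV.1).
  by rewrite hV.
(* One step costs [e1] for a first column longer than [a] and [e2] for a remaining first row longer
   than [b]. *)
rewrite gaussm_row -(natr1 n) mulrDl mul1r addrC -addrA EFinD.
have mrow : measurable (@rowm R n.+1 d @^-1` (~` strong_bound (consv (v, 0) : 'cV[R]_(1 + d)))).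
  by rewrite -[X in measurable X]setTI; apply: measurable_rowm => //; exact: mbad.
have K0 : 0 <= e2 + n%:R * (e1 + e2) by rewrite addr_ge0// mulr_ge0// addr_ge0.
have PB := @product_measure_bound _ _ _ _ _ (gaussv s n.+1) (gaussm s n.+1 d) _ _ _ mrow (measurable_norm_gt (a ^+ 2)) K0.
apply: (le_trans (PB _)); last first.
  by rewrite leeD2r//; apply: tail1.
move=> g /negP; rewrite -leNgt => ga.
have [H oH [u gH]] := gauss_orth_align s0 (g : 'cV[R]_(1 + n)).
have u2 : u ^+ 2 <= a ^+ 2.
  rewrite -(dotv_mull _ _ oH.1) gH dotv_cons in ga.
  by rewrite dotv0 addr0 in ga.
pose A2 : set 'M[R]_(1 + n, d) :=
  [set M | (~` strong_bound (consv (v, 0) : 'cV[R]_(1 + d))) (rowm (consv (u, 0), M))].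
have mA2 : measurable A2.
  rewrite -[X in measurable X]setTI.
  exact: (measurableT_comp (@measurable_rowm R n.+1 d) (pair1_measurable (consv (u, 0)))
    measurableT (mbad _ _ _)).
apply: (@le_trans _ _ (gaussm s n.+1 d A2)).
  rewrite -(gaussm_mull oH mA2); apply: le_measure; rewrite ?inE//.
  - exact: measurable_xsection.
  - by rewrite -[X in measurable X]setTI; exact: measurable_mulmx.
  move=> M; rewrite /xsection/= inE /= => nG G; apply: nG.
  apply: (strong_bound_mull oH.1).
  by rewrite /rowm/= mul_mx_row gH.
rewrite gaussm_col// EFinD.
have mcol : measurable (@colm R n d @^-1` A2).
  by rewrite -[X in measurable X]setTI; exact: measurable_colm.
have K1 : 0 <= n%:R * (e1 + e2) by rewrite mulr_ge0// addr_ge0.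
have PB2 := @product_measure_bound _ _ _ _ _ (gaussv s d) (gaussm s n d) _ _ _ mcol (measurable_norm_gt (b ^+ 2)) K1.
apply: (le_trans (PB2 _)); last first.
  by rewrite leeD2r//; apply: tail2; exact: ltnW.
move=> k /negP; rewrite -leNgt => kb.
apply: le_trans (IH d k (ltnW nN) (ltnW dD) kb).
apply: le_measure; rewrite ?inE//; [exact: measurable_xsection|exact: mbad|].
move=> M; rewrite /xsection/= inE /= => nG G; apply: nG.
exact: strong_bound_block.
Qed.

End bidiagonalization.

(** * The design matrix *)

Section design_law.
Variables (R : realType) (s : R).
Hypothesis s0 : s != 0.
Local Open Scope ereal_scope.
Local Notation RR := (measurableTypeR R).
Local Notation N := (normal_prob 0%R s : probability RR R).

Lemma mvnormal_pdf_cons d x (v : 'cV[R]_d) :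
  (mvnormal_pdf 0 (s ^+ 2)%:M (consv (x, v) : 'cV[R]_d.+1) =
   normal_pdf 0 s x * mvnormal_pdf 0 (s ^+ 2)%:M v)%R.
Proof.
rewrite normal_pdfE// /mvnormal_pdf mulrACA !invmx_scalar !subr0 -expRD.
have s2 : (0 < s ^+ 2)%R by rewrite exprn_even_gt0.
have Q k (w : 'cV[R]_k) : quadform (s ^+ 2)^-1%:M w = ((s ^+ 2)^-1 * dotv w w)%R.
  by rewrite -scalemx1 quadformZ quadform1.
congr (_ * expR _)%R.
  have p0 : (0 < (pi : R))%R by exact: pi_gt0.
  rewrite !det_scalar -invrM ?unitfE ?sqrtr_eq0 -?ltNge//; last 2 first.
  - by apply: mulr_gt0; apply: exprn_gt0 => //; exact: mulr_gt0.
  - by rewrite mulrn_wgt0// mulr_gt0.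
  rewrite -sqrtrM; last by apply: mulr_ge0; apply: exprn_ge0; rewrite ?sqr_ge0// mulr_ge0// ltW.
  congr (Num.sqrt _)^-1%R.
  by rewrite !exprS -mulr_natl; ring.
rewrite !Q dotv_cons -mulr_natl; field.
by rewrite s0.
Qed.

(** Both laws peel off the first coordinate in the same way, since the isotropic density factors. *)
Lemma gaussv_mvnormal d (B : set 'cV[R]_d) : measurable B ->
  mvnormal 0 (s ^+ 2)%:M B = gaussv s d B.
Proof.
have s2 : (0 < s ^+ 2)%R by rewrite exprn_even_gt0.
have pS k : sym_posdef ((s ^+ 2)%:M : 'M[R]_k).
  by rewrite -scalemx1; apply: sym_posdefZ => //; exact: sym_posdef1.
have p0 k (v : 'cV[R]_k) : (0 <= mvnormal_pdf 0 (s ^+ 2)%:M v)%R.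
  exact/ltW/mvnormal_pdf_gt0.
have mF k (A : set 'cV[R]_k) : measurable A ->
    measurable_fun setT (fun v => (mvnormal_pdf 0 (s ^+ 2)%:M v * \1_A v)%:E).
  move=> mA; apply/measurable_EFinP; apply: measurable_funM; first exact: measurable_mvnormal_pdf.
  exact: measurable_indic.
have F0 k (A : set 'cV[R]_k) v : 0 <= (mvnormal_pdf 0 (s ^+ 2)%:M v * \1_A v)%:E.
  by rewrite lee_fin mulr_ge0.
have E k (A : set 'cV[R]_k) : mvnormal 0 (s ^+ 2)%:M A =
    \int[lebv R k]_v (mvnormal_pdf 0 (s ^+ 2)%:M v * \1_A v)%:E.
  rewrite /mvnormal lebvE integral_mkcond; apply: eq_integral => v _.
  by rewrite patchE indicE; case: (v \in A); rewrite ?mulr1 ?mulr0.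
elim: d B => [|d IH] B mB.
  rewrite E integral_lebv0; last exact: mF.
  rewrite /mvnormal_pdf det_mx00 expr0 mulr1 sqrtr1 invr1 mul1r.
  rewrite -[quadform _ _]/((_ *m _) 0%R 0%R) mxE big_ord0 oppr0 mul0r expR0 mul1r.
  by rewrite indicE/= diracE.
rewrite E integral_lebv_cons; [|exact: mF|exact: F0].
rewrite gaussv_integral_cons// integral_normal_prob; last 2 first.
- have mB' : measurable (@consv R d @^-1` B).
    by rewrite -[X in measurable X]setTI; exact: measurable_consv.
  have := measurable_fun_xsection (gaussv s d) mB'.
  congr measurable_fun; apply/funext => x; congr (gaussv _ _ _).
  by apply/seteqP; split => v; rewrite /xsection/= inE.
- by [].
apply: eq_integral => x _.
have mBx := measurable_cons_slice x mB.
rewrite -IH// E -ge0_integralZl//; [|exact: mF|by rewrite lee_fin normal_pdf_ge0].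
by apply: eq_integral => v _; rewrite mvnormal_pdf_cons -EFinM -mulrA; congr ((_ * (_ * _))%:E)%R.
Qed.

Variables (dO : measure_display) (Omega : measurableType dO) (P : probability Omega R).
Variables (n d : nat) (X : 'I_n -> {RV P >-> 'cV[R]_d}).

Lemma measurable_design_mx : measurable_fun setT (fun w => design_mx (X ^~ w)).
Proof.
apply: measurable_fun_mx => i j; under eq_fun do rewrite mxE.
exact: (measurableT_comp (measurable_mx_coord _ _)).
Qed.

Definition design_mfun : {mfun Omega >-> 'M[R]_(n, d)} :=
  let H := isMeasurableFun.Build _ _ _ _ _ measurable_design_mx in
  HB.pack (fun w => design_mx (X ^~ w)) H.

Lemma design_mx_law :
  (forall A : 'I_n -> set 'cV[R]_d, (forall i, measurable (A i)) ->
    P (\bigcap_i (X i @^-1` A i)) = \prod_i P (X i @^-1` A i)) ->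
  (forall i (B : set 'cV[R]_d), measurable B ->
    P (X i @^-1` B) = mvnormal 0 (s ^+ 2)%:M B) ->
  forall B, measurable B -> P [set w | B (design_mx (X ^~ w))] = gaussm s n d B.
Proof.
move=> indepX lawX B mB.
apply: (@mx_measure_unique _ _ _ (distribution P design_mfun) (gaussm s n d)) => // A mA.
pose A' i := mx_box (fun j (_ : 'I_1) => A i j).
have mA' i : measurable (A' i) by exact: measurable_mx_box.
rewrite gaussm_box// exchange_big/=.
transitivity (P (\bigcap_i (X i @^-1` A' i))).
  congr (P _); apply/seteqP; split => [w /= Aw i _ j k|w /= Aw i j].
    by have := Aw i j; rewrite /= mxE (ord1 k).
  by have := Aw i I j 0%R; rewrite /= mxE.
rewrite indepX//; apply: eq_bigr => i _.
by rewrite lawX// gaussv_mvnormal// gaussv_box.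
Qed.

End design_law.

(** Independence of the pairs [(Y i, X i)] passes to the rows [X i] through the cylinders
    [setT]*[A i]. *)
Lemma binary_regression_design_law (R : realType) dO (Omega : measurableType dO)
    (P : probability Omega R) (S : R -> R) (sigma2 s : R) n d (beta : 'cV[R]_d)
    (X : 'I_n -> {RV P >-> 'cV[R]_d}) (Y : 'I_n -> {RV P >-> bool}) :
  binary_regression_data S sigma2 beta X Y -> s != 0 -> s ^+ 2 = sigma2 / n%:R ->
  forall B, measurable B -> P [set w | B (design_mx (X ^~ w))] = gaussm s n d B.
Proof.
move=> [indep lawX _] s0 s2; apply: (@design_mx_law R s s0 dO Omega P n d X); last first.
  by move=> i B mB; rewrite s2; exact: lawX.
move=> A mA.
have E i : (fun w => (Y i w, X i w)) @^-1` (setT `*` A i) = X i @^-1` A i.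
  by apply/seteqP; split => w //= [].
have := indep [set: 'I_n]%SET (fun i => setT `*` A i) (fun i => measurableX measurableT (mA i)).
have -> : \bigcap_(i in [set` [set: 'I_n]%SET]) ((fun w => (Y i w, X i w)) @^-1` (setT `*` A i)) =
    \bigcap_i (X i @^-1` A i).
  apply/seteqP; split => w /= Aw i _; first by have [] := Aw i (finset.in_setT i).
  by split => //; exact: Aw.
move=> ->; apply: eq_big => [i|i _]; first by rewrite inE.
by rewrite E.
Qed.

(** * Almost sure bound on the largest eigenvalue of the Gram matrix *)

Section borel_cantelli.
Variables (R : realType) (dO : measure_display) (Omega : measurableType dO)
  (P : probability Omega R).

Lemma borel_cantelli_geometric (F : nat -> set Omega) (K q : R) :
  0 <= K -> 0 <= q < 1 -> (forall n, measurable (F n)) ->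
  (\forall n \near \oo, (P (F n) <= (K * q ^+ n)%:E)%E) ->
  {ae P, forall w, \forall n \near \oo, ~ F n w}.
Proof.
move=> K0 /andP[q0 q1] mF [n0 _ Fle].
(* The bound holds only from [n0] on; emptying the earlier events makes the whole series
   converge. *)
pose G n := if (n0 <= n)%N then F n else set0.
have mG n : measurable (G n) by rewrite /G; case: ifP.
have Gle n : (P (G n) <= (K * q ^+ n)%:E)%E.
  rewrite /G; case: ifPn => [nn0|_]; first exact: Fle.
  by rewrite measure0 lee_fin mulr_ge0// exprn_ge0.
have q10 : 0 < 1 - q by rewrite subr_gt0.
have GS : (\sum_(0 <= n <oo) P (G n) < +oo)%E.
  apply: (@le_lt_trans _ _ (K / (1 - q))%:E); last exact: ltry.
  apply: lime_le; first exact: is_cvg_nneseries.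
  apply: nearW => n; apply: (@le_trans _ _ (\sum_(0 <= i < n) (K * q ^+ i)%:E)%E).
    by apply: lee_sum => i _; exact: Gle.
  rewrite sumEFin lee_fin -mulr_sumr ler_wpM2l// big_mkord.
  rewrite -[leRHS]mul1r ler_pdivlMr// mulrC.
  rewrite -[X in X <= _]opprK -mulNr opprB -subrX1 opprB.
  by rewrite lerBlDr lerDl exprn_ge0.
have := lim_sup_set_cvg0 mG GS; rewrite /almost_everywhere => G0.
exists (lim_sup_set G); split => //.
  by apply: bigcap_measurable => [|n _]; [exists 0%N|exact: bigcup_measurable].
move=> w /= nw n _; apply: contrapT => nG; apply: nw.
exists (maxn n n0) => // k /=; rewrite geq_max => /andP[nk n0k] Fk; apply: nG.
by exists k => //; rewrite /G n0k.
Qed.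

End borel_cantelli.

Section spectral_bound.
Variables (R : realType) (S : R -> R) (sigma2 : R) (sigma2_gt0 : 0 < sigma2).
Variables (dO : measure_display) (Omega : measurableType dO) (P : probability Omega R).
Variable delta : R.
Hypothesis delta0 : 0 < delta.
Let r : R := expR (- (delta / 2)) * Num.sqrt (1 + delta).

Let r_gt0 : 0 < r.
Proof. by rewrite mulr_gt0 ?expR_gt0// sqrtr_gt0 addr_gt0. Qed.

Let r_lt1 : r < 1. Proof. exact: tail_rate_lt1. Qed.

Lemma lambda_max_gram_le n d (a b : R) (M : 'M[R]_(n, d)) : 0 <= a + b ->
  strong_bound a b 0 M -> lambda_max (M^T *m M) <= (a + b) ^+ 2.
Proof.
move=> ab GM; apply: lambda_max_le; first exact: exprn_ge0.
move=> v; have := GM v; rewrite dot0v expr0n/= mulr0 addr0.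
by rewrite /quadform /dotv trmx_mul !mulmxA.
Qed.

Section one_sample.
Variables (n d : nat) (n0 : (0 < n)%N) (d0 : (0 < d)%N) (beta : 'cV[R]_d).
Variables (X : 'I_n -> {RV P >-> 'cV[R]_d}) (Y : 'I_n -> {RV P >-> bool}).
Hypothesis data : binary_regression_data S sigma2 beta X Y.

Lemma design_lambda_max_tail : exists2 F : set Omega, measurable F &
  (P F <= (n%:R * (r ^+ n + r ^+ d))%:E)%E /\
  forall w, ~ F w -> lambda_max ((design_mx (X ^~ w))^T *m design_mx (X ^~ w)) <=
    sigma2 * (1 + delta) * (1 + Num.sqrt (d%:R / n%:R)) ^+ 2.
Proof.
have nR : (0 < n%:R :> R) by rewrite ltr0n.
have dR : (0 < d%:R :> R) by rewrite ltr0n.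
have c0 : 0 < sigma2 * (1 + delta) by rewrite mulr_gt0// addr_gt0.
pose s := Num.sqrt (sigma2 / n%:R).
have s2 : s ^+ 2 = sigma2 / n%:R by rewrite sqr_sqrtr// divr_ge0// ltW.
have s0 : s != 0 by rewrite gt_eqF// sqrtr_gt0 divr_gt0.
(* Chosen so that [a ^+ 2] and [b ^+ 2] are the chi-square thresholds for columns and rows, as [a2]
   and [b2] check. *)
pose a := Num.sqrt (sigma2 * (1 + delta)); pose b := a * Num.sqrt (d%:R / n%:R).
have a0 : 0 < a by rewrite sqrtr_gt0.
have b0 : 0 < b by rewrite mulr_gt0// sqrtr_gt0 divr_gt0.
have a2 : a ^+ 2 = n%:R * s ^+ 2 * (1 + delta).
  by rewrite sqr_sqrtr ?ltW// s2; field; rewrite gt_eqF.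
have b2 : b ^+ 2 = d%:R * s ^+ 2 * (1 + delta).
  rewrite s2 exprMn sqr_sqrtr ?(ltW c0)// sqr_sqrtr ?divr_ge0 ?ler0n//.
  by field; rewrite gt_eqF.
have mF := measurable_strong_bound a b (0 : 'cV[R]_d).
exists [set w | ~ strong_bound a b 0 (design_mx (X ^~ w))].
  rewrite -[X in measurable X]setTI.
  exact: (measurable_design_mx X measurableT (measurableC (mF n))).
split.
  rewrite (binary_regression_design_law data s0 s2 (measurableC (mF n))).
  apply: (@gaussm_strong_bound _ s s0 a b a0 b0 (r ^+ n) (r ^+ d) n d) => //.
  - by rewrite exprn_ge0// ltW.
  - by rewrite exprn_ge0// ltW.
  - by move=> k kn; rewrite a2; exact: gaussv_tail.
  - by move=> k kd; rewrite b2; exact: gaussv_tail.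
  - by rewrite dotv0 exprn_ge0// ltW.
move=> w /contrapT /lambda_max_gram_le; rewrite addr_ge0 ?(ltW a0) ?(ltW b0)// => /(_ isT).
by rewrite /b -{1}[a]mulr1 -mulrDr exprMn sqr_sqrtr// ltW.
Qed.

End one_sample.

Lemma tail_sum_geometric (gamma : R) (dn : nat -> nat) : 0 < gamma ->
  (dn n)%:R / n%:R @[n --> \oo] --> gamma ->
  exists K q : R, [/\ 0 <= K, 0 <= q < 1 & \forall n \near \oo,
    n%:R * (r ^+ n + r ^+ dn n) <= K * q ^+ n].
Proof.
move=> g0 dng.
pose u := - ln r; have u0 : 0 < u by rewrite oppr_gt0 ln_lt0// r_gt0 r_lt1.
have rE : r = expR (- u) by rewrite opprK lnK.
(* Half of the decay rate available once [dn n] exceeds [gamma / 2 * n]; the other half absorbs the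
   factor [n], since [c * n <= expR (c * n)]. This gives the constant [2 / c]. *)
pose c := u * Num.min 1 (gamma / 2) / 2.
have m0 : 0 < Num.min 1 (gamma / 2) by rewrite lt_min ltr01 divr_gt0.
have c0 : 0 < c by rewrite divr_gt0// mulr_gt0.
exists (2 / c), (expR (- c)); split; first by rewrite divr_ge0// ltW.
  by rewrite expR_ge0 -expR0 ltr_expR oppr_lt0.
have : gamma / 2 < gamma by rewrite ltr_pdivrMr// ltr_pMr// ltr1n.
move=> /(cvgr_gt _ dng); apply: filterS2 _ (nbhs_infty_gt 0) => n n0 dn_ge.
have nR : 0 < n%:R :> R by rewrite ltr0n.
rewrite ltr_pdivlMr// in dn_ge.
have mE : 2 * c = u * Num.min 1 (gamma / 2) by rewrite /c; field.
have T k : Num.min 1 (gamma / 2) * n%:R <= k%:R -> r ^+ k <= expR (- (2 * c * n%:R)).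
  move=> nk; rewrite rE -expRM_natl ler_expR mulrN lerN2 mE -mulrA mulrC.
  by rewrite ler_wpM2r// ltW.
have T1 : r ^+ n <= expR (- (2 * c * n%:R)).
  by apply: T; rewrite ler_piMl ?ler0n// ge_min lexx.
have T2 : r ^+ dn n <= expR (- (2 * c * n%:R)).
  apply: T; apply: le_trans (ltW dn_ge).
  by rewrite ler_wpM2r ?ler0n// ge_min lexx orbT.
apply: (@le_trans _ _ (n%:R * (2 * expR (- (2 * c * n%:R))))).
  by rewrite ler_wpM2l ?ler0n// mulr_natl mulr2n lerD.
rewrite -expRM_natl mulrN.
have -> : expR (- (2 * c * n%:R)) = (expR (c * n%:R))^-1 * expR (- (n%:R * c)).
  by rewrite -expRN -expRD; congr expR; ring.
rewrite !mulrA ler_wpM2r ?expR_ge0//.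
rewrite ler_pdivrMr ?expR_gt0// mulrAC ler_pdivlMr// mulrAC.
by rewrite mulrC ler_wpM2l// mulrC (le_trans _ (expR_ge1Dx _))// lerDr ler01.
Qed.

Lemma design_lambda_max_ae (beta : forall n d : nat, 'cV[R]_d)
  (X : forall n d : nat, 'I_n -> {RV P >-> 'cV[R]_d})
  (Y : forall n d : nat, 'I_n -> {RV P >-> bool})
  (data : forall n d : nat, binary_regression_data S sigma2 (beta n d) (X n d) (Y n d))
  (gamma : R) (dn : nat -> nat) : 0 < gamma ->
  dn n @[n --> \oo] --> \oo -> (dn n)%:R / n%:R @[n --> \oo] --> gamma ->
  {ae P, forall w, \forall n \near \oo,
     lambda_max ((design_mx (X n (dn n) ^~ w))^T *m design_mx (X n (dn n) ^~ w)) <=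
     sigma2 * (1 + delta) * (1 + Num.sqrt ((dn n)%:R / n%:R)) ^+ 2}.
Proof.
move=> g0 dn_oo dng.
have [K [q [K0 q01 Kq]]] := tail_sum_geometric g0 dng.
have /choice[F FP] : forall n, exists F : set Omega, measurable F /\
    ((0 < n)%N && (0 < dn n)%N ->
     (P F <= (n%:R * (r ^+ n + r ^+ dn n))%:E)%E /\
     forall w, ~ F w -> lambda_max ((design_mx (X n (dn n) ^~ w))^T *m design_mx (X n (dn n) ^~ w)) <=
      sigma2 * (1 + delta) * (1 + Num.sqrt ((dn n)%:R / n%:R)) ^+ 2).
  (* For an empty sample or dimension zero nothing is claimed, and the empty set is an arbitrary
     choice. *)
  move=> n; case: (boolP ((0 < n)%N && (0 < dn n)%N)) => [/andP[n0 d0]|]; last by exists set0.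
  by have [F mF HF] := design_lambda_max_tail n0 d0 (data n (dn n)); exists F.
have pos : \forall n \near \oo, (0 < n)%N && (0 < dn n)%N.
  by apply: filterS2 _ (nbhs_infty_gt 0) ((cvgnyPgt dn).1 dn_oo 0%N) => n -> ->.
have := @borel_cantelli_geometric _ _ _ P F K q K0 q01 (fun n => (FP n).1).
have FKq : \forall n \near \oo, (P (F n) <= (K * q ^+ n)%:E)%E.
  apply: filterS2 _ pos Kq => n p Kqn; have [+ _] := (FP n).2 p.
  by move=> /le_trans; apply; rewrite lee_fin.
move=> /(_ FKq); apply: filterS => w nF.
by apply: filterS2 _ pos nF => n p; exact: ((FP n).2 p).2.
Qed.

End spectral_bound.

(** * The sampler for fixed data *)

Section posterior_sampler.
Variables (R : realType) (S : R -> R) (alpha : R) (n d : nat) (C : 'M[R]_d).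
Variables (x : 'I_n -> 'cV[R]_d) (y : 'I_n -> bool) (bstar : 'cV[R]_d).
Hypotheses (alpha0 : 0 < alpha) (pC : sym_posdef C) (d0 : (0 < d)%N).
Local Notation w := (posterior_weight S alpha C x y).
Local Notation ppi := (posterior_pdf S alpha C x y).
Local Notation ell := (neg_log_lik S x y).
Hypothesis bstarP : unique_maximizer ppi bstar.
Hypothesis ellC2 : twice_continuously_differentiable ell.
Hypothesis ell_convex : convex_function [set: 'cV[R]_d] ell.

Let Z : R := fine (\int[lebv R d]_b (w b)%:E)%E.

Let ppiE b : ppi b = w b / Z.
Proof. by rewrite /posterior_pdf lebvE. Qed.

(** Measurability comes from the continuity of the negative log-likelihood as a whole. *)
Let measurable_posterior_weight : measurable_fun setT w.
Proof.
apply: measurableT_comp => //; apply: measurable_funB.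
  by apply: measurableT_comp => //; apply: continuous_measurable_mx; case: ellC2.
apply: measurable_funM => //; have := measurable_quadform (invmx C) 0.
by under eq_fun do rewrite subr0.
Qed.

Let mpi : measurable_fun setT ppi.
Proof. by rewrite (funext ppiE); exact: measurable_funM. Qed.

Let ppi_ge0 b : 0 <= ppi b.
Proof.
rewrite ppiE divr_ge0 ?expR_ge0// fine_ge0//.
by apply: integral_ge0 => z _; rewrite lee_fin expR_ge0.
Qed.

Let posteriorE : posterior S alpha C x y = dens_measure (lebv R d) mpi ppi_ge0.
Proof. by apply/funext => B; rewrite /posterior lebvE. Qed.

Lemma integral_posterior_ge0 (g : 'cV[R]_d -> \bar R) : (forall b, 0 <= g b)%E ->
  (0 <= \int[posterior S alpha C x y]_b g b)%E.
Proof. by move=> g0; rewrite posteriorE integral_ge0. Qed.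

(* If the weight had infinite integral, [fine] would make the density vanish
   identically, which a unique maximizer excludes as soon as [0 < d]. *)
Let Z0 : 0 < Z.
Proof.
rewrite lt_neqAle fine_ge0 ?andbT; last first.
  by apply: integral_ge0 => b _; rewrite lee_fin expR_ge0.
apply/eqP => Zz.
have : bstar + const_mx 1 <> bstar.
  move/eqP; rewrite -subr_eq0 addrC addKr => /eqP /matrixP /(_ (Ordinal d0) 0).
  by rewrite !mxE => /eqP; rewrite oner_eq0.
by move=> /bstarP; rewrite !ppiE -Zz invr0 !mulr0 ltxx.
Qed.

Let intw : (\int[lebv R d]_b (w b)%:E = Z%:E)%E.
Proof.
rewrite /Z fineK// ge0_fin_numE; last first.
  by apply: integral_ge0 => b _; rewrite lee_fin expR_ge0.
by rewrite ltey; apply/eqP => Ioo; move: Z0; rewrite /Z Ioo ltxx.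
Qed.

Let weight_max b : w b <= w bstar.
Proof.
have [->//|/eqP /bstarP] := eqVneq b bstar.
by rewrite !ppiE ltr_pM2r ?invr_gt0// => /ltW.
Qed.

(** The data are fixed here, and they enter the rate only through the Hessian bound [L]. *)
Lemma wasserstein_posterior_le (L : R) (rho : 'cV[R]_d -> 'cV[R]_d -> R) t :
  0 <= L -> (forall b, lambda_max (hessian ell b) <= L) ->
  lsc_metric rho -> (0 < t)%N ->
  (wasserstein rho (kernel_pow (mode_mhi_kernel S alpha C x y bstar) t bstar)
     (posterior S alpha C x y) <=
   ((1 - expR (- (L * \tr C / (2 * alpha)))) ^+ t)%:E *
   \int[posterior S alpha C x y]_b (rho b bstar)%:E)%E.
Proof.
move=> L0 HL lrho t0.
have pi0 b : 0 < ppi b by rewrite ppiE divr_gt0// expR_gt0.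
have pS : sym_posdef (alpha^-1 *: C) by apply: sym_posdefZ => //; rewrite invr_gt0.
have intpi : (\int[lebv R d]_b (ppi b)%:E = 1)%E.
  under eq_integral do rewrite ppiE mulrC EFinM.
  rewrite ge0_integralZl//=.
  - by rewrite intw -EFinM mulVf// gt_eqF.
  - exact/measurable_EFinP.
  - by move=> b _; rewrite lee_fin expR_ge0.
  - by rewrite lee_fin invr_ge0 ltW.
have bP b : mvnormal_pdf bstar (alpha^-1 *: C) bstar / ppi bstar * ppi b <=
    mvnormal_pdf bstar (alpha^-1 *: C) b.
  by rewrite !ppiE; apply: mode_ratio_le.
have E : posterior S alpha C x y = dens (lebv R d) ppi := posteriorE.
apply: le_trans.
  rewrite E.
  apply: (wasserstein_kernel_pow_mode mpi (measurable_mvnormal_pdf bstar _) pi0 _ _ _ bP) => //.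
  - by move=> b; exact: mvnormal_pdf_gt0.
  - exact: integral_mvnormal_pdf.
have eps_ge := mode_ratio_ge pC alpha0 ellC2 L0 HL weight_max Z0 intw
  measurable_posterior_weight.
rewrite -ppiE in eps_ge.
have eps_le : mvnormal_pdf bstar (alpha^-1 *: C) bstar / ppi bstar <= 1.
  have /andP[] // := mode_ratio_itv mpi (measurable_mvnormal_pdf bstar (alpha^-1 *: C)) pi0
    (fun b => mvnormal_pdf_gt0 bstar b pS) intpi (integral_mvnormal_pdf bstar pS) bP.
rewrite -E; apply: lee_wpmul2r.
  by apply: integral_posterior_ge0 => b; rewrite lee_fin; case: lrho => -[].
rewrite lee_fin; apply: lerXn2r; rewrite ?nnegrE ?subr_ge0//.
  exact: le_trans eps_ge eps_le.
by rewrite lerD2l lerN2.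
Qed.

End posterior_sampler.

(** * Upper limits *)

(** If the upper limit of [v] is infinite, [c > 0] makes the right-hand side infinite too; otherwise
    a tail on which [v] stays below its upper limit plus [h] is intersected with the set where the
    bound on [u] holds. *)
Lemma limn_esup_le_mulr (R : realType) (u v : nat -> \bar R) (c : R) :
  0 < c -> (forall n, 0 <= v n)%E ->
  (forall e, 0 < e -> \forall n \near \oo, (u n <= (c + e)%:E * v n)%E) ->
  (limn_esup u <= limn_esup v * c%:E)%E.
Proof.
move=> c0 v0 uv.
have : (0 <= limn_esup v)%E by apply: limf_esup_ge0.
case E : (limn_esup v) => [l| |] //=; last by rewrite gt0_mulye ?leey// lte_fin.
rewrite lee_fin => l0; apply/lee_addgt0Pr => e e0; rewrite -EFinM -EFinD.
have d0 : 0 < c + l + 1 by lra.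
(* As [h <= 1], [(c + h) * (l + h)] is at most [c * l + h * (c + l + 1)], hence at most
   [c * l + e]. *)
pose h := Num.min 1 (e / (c + l + 1)).
have h0 : 0 < h by rewrite lt_min ltr01 divr_gt0.
have h1 : h <= 1 by rewrite ge_min lexx.
have he : h * (c + l + 1) <= e by rewrite -ler_pdivlMr// ge_min lexx orbT.
have /ereal_inf_lt[_ [V Voo <-] Vl] : (ereal_inf [set ereal_sup (v @` V) | V in \oo] < (l + h)%:E)%E.
  by rewrite -[X in (X < _)%E]/(limn_esup v) E lte_fin ltrDl.
apply: ge_ereal_inf; exists (ereal_sup (u @` (V `&` [set n | (u n <= (c + h)%:E * v n)%E]))).
  by exists (V `&` [set n | (u n <= (c + h)%:E * v n)%E]) => //; apply: filterI => //; exact: uv.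
apply: ge_ereal_sup => _ [n [Vn /= un] <-].
apply: (le_trans un); apply: (@le_trans _ _ ((c + h)%:E * (l + h)%:E)%E).
  apply: lee_wpmul2l; first by rewrite lee_fin addr_ge0// ltW.
  by apply/ltW/(le_lt_trans _ Vl)/ereal_sup_ubound; exists n.
rewrite -EFinM lee_fin; nra.
Qed.

(** The slack [1 / (k + 1)] is fixed before [n] grows: continuity of the rate first picks [k] at the
    limit [a0], then the convergence of [y] gives the bound for large [n]. *)
Lemma cvg_contraction_rate (R : realType) (a0 : R) (y : nat -> R) (t : nat) (e : R) :
  0 < e -> y n @[n --> \oo] --> a0 ->
  exists k : nat, \forall n \near \oo,
    (1 - expR (- ((1 + k.+1%:R^-1) * y n))) ^+ t < (1 - expR (- a0)) ^+ t + e.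
Proof.
move=> e0 ya.
pose g (z : R) := (1 - expR (- z)) ^+ t.
have cg : continuous g.
  move=> z; apply: (@continuous_comp _ _ _ (fun z : R => 1 - expR (- z)) (fun z : R => z ^+ t)); last exact: exprn_continuous.
  apply: continuousB; first exact: cst_continuous.
  apply: continuous_comp; first exact: opp_continuous.
  exact: continuous_expR.
have ck : (1 + k.+1%:R^-1) * a0 @[k --> \oo] --> a0.
  rewrite -[X in _ --> X]mul1r; apply: cvgM; last exact: cvg_cst.
  rewrite -[X in _ --> X]addr0; apply: cvgD; first exact: cvg_cst.
  exact: cvg_harmonic.
have gk : \forall k \near \oo, g ((1 + k.+1%:R^-1) * a0) < g a0 + e.
  apply: (cvgr_lt (g a0)); last by rewrite ltrDl.
  exact: (cvg_comp _ _ ck (cg a0)).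
have [k _ /(_ k (leqnn k)) gka] := gk; exists k.
apply: (cvgr_lt (g ((1 + k.+1%:R^-1) * a0))) gka.
apply: (cvg_comp (fun n => (1 + k.+1%:R^-1) * y n) g); last exact: cg.
by apply: cvgM => //; exact: cvg_cst.
Qed.

Theorem theorem4 (R : realType)
  (S : R -> R) (hS : forall u, 0 < S u < 1)
  (sigma2 alpha : R) (sigma2_gt0 : 0 < sigma2) (alpha_gt0 : 0 < alpha)
  (C : forall d, 'M[R]_d) (C_posdef : forall d, sym_posdef (C d))
  (s0 : R) (s0_gt0 : 0 < s0) (trC : \tr (C d) @[d --> \oo] --> s0)
  (dO : measure_display) (Omega : measurableType dO) (P : probability Omega R)
  (beta : forall n d : nat, 'cV[R]_d)
  (X : forall n d : nat, 'I_n -> {RV P >-> 'cV[R]_d})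
  (Y : forall n d : nat, 'I_n -> {RV P >-> bool})
  (data : forall n d : nat,
     binary_regression_data S sigma2 (beta n d) (X n d) (Y n d))
  (rho : forall d : nat, 'cV[R]_d -> 'cV[R]_d -> R)
  (rho_lsc : forall d : nat, lsc_metric (rho d))
  (ell := fun n d w => neg_log_lik S (X n d ^~ w) (Y n d ^~ w))
  (Post := fun n d w => posterior S alpha (C d) (X n d ^~ w) (Y n d ^~ w))
  (bstar : forall n d : nat, Omega -> 'cV[R]_d)
  (bstarP : forall n d w, unique_maximizer
     (posterior_pdf S alpha (C d) (X n d ^~ w) (Y n d ^~ w)) (bstar n d w))
  (K := fun n d w =>
     mode_mhi_kernel S alpha (C d) (X n d ^~ w) (Y n d ^~ w) (bstar n d w))
  (ell_C2_convex : forall n d w,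
     twice_continuously_differentiable (ell n d w) /\
     convex_function [set: 'cV[R]_d] (ell n d w))
  (r0 : R) (r0_gt0 : 0 < r0)
  (hessian_le : forall n d w (b : 'cV[R]_d),
     lambda_max (hessian (ell n d w) b) <=
     r0 * lambda_max ((design_mx (X n d ^~ w))^T *m design_mx (X n d ^~ w)))
  (gamma : R) (gamma_gt0 : 0 < gamma)
  (dn : nat -> nat) (dn_oo : dn n @[n --> \oo] --> \oo)
  (dn_ratio : (dn n)%:R / n%:R @[n --> \oo] --> gamma)
  (a0 := r0 * (1 + Num.sqrt gamma) ^+ 2 * sigma2 * s0 / (2 * alpha)) :
  {ae P, forall w, forall t : nat, (1 <= t)%N ->
    (limn_esup (fun n =>
       wasserstein (rho (dn n))
         (kernel_pow (K n (dn n) w) t (bstar n (dn n) w)) (Post n (dn n) w))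
     <= limn_esup (fun n =>
          \int[Post n (dn n) w]_b (rho (dn n) b (bstar n (dn n) w))%:E) *
        ((1 - expR (- a0)) ^+ t)%:E)%E}.
Proof.
(* The exponent [a0] at finite size, without the slack of the spectral bound. *)
pose y n := r0 * (1 + Num.sqrt ((dn n)%:R / n%:R)) ^+ 2 * sigma2 * \tr (C (dn n)) / (2 * alpha).
have ya : y n @[n --> \oo] --> a0.
  apply: cvgM; last exact: cvg_cst.
  apply: cvgM; last exact: (cvg_comp _ _ dn_oo trC).
  apply: cvgM; last exact: cvg_cst.
  apply: cvgM; first exact: cvg_cst.
  have cs : 1 + Num.sqrt ((dn n)%:R / n%:R) @[n --> \oo] --> 1 + Num.sqrt gamma.
    apply: cvgD; first exact: cvg_cst.
    exact: (cvg_comp _ _ dn_ratio (@sqrt_continuous R gamma)).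
  by rewrite expr2; under eq_cvg do rewrite expr2; exact: cvgM.
have a0_gt0 : 0 < a0.
  by rewrite divr_gt0// ?mulr_gt0// exprn_gt0// ltr_pwDl// sqrtr_ge0.
(* A countable intersection over [k] is taken before [t] and [e] appear, so a single null set works
   for all of them. *)
have /ae_foralln : forall k : nat, {ae P, forall w, \forall n \near \oo,
     lambda_max ((design_mx (X n (dn n) ^~ w))^T *m design_mx (X n (dn n) ^~ w)) <=
     sigma2 * (1 + k.+1%:R^-1) * (1 + Num.sqrt ((dn n)%:R / n%:R)) ^+ 2}.
  move=> k; apply: (design_lambda_max_ae sigma2_gt0 _ data gamma_gt0 dn_oo dn_ratio).
  by rewrite invr_gt0 ltr0n.
apply: filterS => w Hw t t1.
(* Positivity of the factor covers the case of an infinite [M_0]. *)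
have c0 : 0 < (1 - expR (- a0)) ^+ t.
  by rewrite exprn_gt0// subr_gt0 -expR0 ltr_expR oppr_lt0.
apply: limn_esup_le_mulr => // [n|e e0].
  apply: integral_posterior_ge0; first by case: (ell_C2_convex n (dn n) w).
  by move=> b; rewrite lee_fin; case: (rho_lsc (dn n)) => -[].
have [k Hk] := cvg_contraction_rate t e0 ya.
(* A positive dimension, available for large [n], is what lets the unique maximizer force a finite
   normalizing constant. *)
apply: filterS3 _ Hk (Hw k) ((cvgnyPgt dn).1 dn_oo 0%N) => n yn Ln d0.
have [C2 cvx] := ell_C2_convex n (dn n) w.
set Lam := sigma2 * _ * _ in Ln.
have Lam0 : 0 <= Lam.
  by rewrite mulr_ge0 ?sqr_ge0// mulr_ge0 ?ltW// addr_gt0 ?ltr01// invr_gt0 ltr0n.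
apply: le_trans.
  apply: (wasserstein_posterior_le alpha_gt0 (C_posdef _) d0 (bstarP n (dn n) w) C2 cvx
    (L := r0 * Lam) _ _ (rho_lsc _) t1); first by rewrite mulr_ge0// ltW.
  by move=> b; rewrite (le_trans (hessian_le _ _ _ _))// ler_pM2l.
apply: lee_wpmul2r.
  apply: integral_posterior_ge0 => // b.
  by rewrite lee_fin; case: (rho_lsc (dn n)) => -[].
rewrite lee_fin (le_trans _ (ltW yn))//.
suff -> : r0 * Lam * \tr (C (dn n)) / (2 * alpha) = (1 + k.+1%:R^-1) * y n by [].
by rewrite /Lam /y; ring.
Qed.
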